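(* Fix $\varepsilon>0$. For each $n\ge 1$ let $(X_{ij})_{1\le i\le j\le n}$ (depending on $n$) be a centered multivariate Gaussian vector of dimension $n(n+1)/2$ with $\operatorname{Var}(X_{ij})=1$ for all $i\le j$ and $$\sup_{(i,j)\ne(i',j')}\big|\mathbb{E}[X_{ij}X_{i'j'}]\big|=O\Big(\frac{1}{n^{1+\varepsilon}}\Big)\quad (n\to\infty),$$ where the supremum is over pairs with $i\le j$ and $i'\le j'$. Let $X_n$ be the $n\times n$ symmetric random matrix with $X_n(i,j)=X_n(j,i)=X_{ij}$ for $i\le j$. Then $\lambda_1(n^{-1/2}X_n)\to 2$ almost surely as $n\to\infty$.
   Context: $\lambda_1(A)$ denotes the largest eigenvalue of a real symmetric matrix $A$. The matrices $X_n$, $n\ge1$, are all defined on a common probability space, with no assumption on the joint law for different $n$. *)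

(* Defs.v *)
From mathcomp Require Import all_boot all_order all_algebra.
From mathcomp Require Import all_classical all_reals all_analysis.

Set Implicit Arguments.
Unset Strict Implicit.
Unset Printing Implicit Defensive.

Import Order.TTheory GRing.Theory Num.Theory.
Import numFieldNormedType.Exports.

Local Open Scope classical_set_scope.
Local Open Scope ring_scope.

(* The dirac case is kept apart because the library's [normal_prob m 0] is not
   the point mass at [m] but the uniform distribution on [0, 1]. *)
Definition gaussian_law (R : realType) (mu : set R -> \bar R) : Prop :=
  (exists m : R, forall A, measurable A -> mu A = \d_m A) \/
  (exists m s : R,
     0 < s /\ forall A, measurable A -> mu A = normal_prob m s A).

(* A family is (jointly) Gaussian when all its linear combinations are Gaussian,
   possibly degenerate; the covariance matrix need not be invertible. *)
Definition gaussian_vector d (T : measurableType d) (R : realType)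
    (P : probability T R) (I : finType) (X : I -> {RV P >-> R}) : Prop :=
  forall a : I -> R,
    gaussian_law (pushforward P (fun w => \sum_(i : I) a i * X i w)).

Notation upper_index n := {p : 'I_n * 'I_n | (p.1 <= p.2)%N}.

Lemma sorted_pair_subproof n (i j : 'I_n) :
  ((if (i <= j)%N then (i, j) else (j, i)).1 <=
   (if (i <= j)%N then (i, j) else (j, i)).2)%N.
Proof. by case: (leqP i j) => //= /ltnW. Qed.

Definition sorted_pair n (i j : 'I_n) : upper_index n :=
  exist _ (if (i <= j)%N then (i, j) else (j, i)) (sorted_pair_subproof i j).

Definition sym_mx (R : Type) n (x : upper_index n -> R) : 'M[R]_n :=
  \matrix_(i, j) x (sorted_pair i j).

(* The set of eigenvalues of a real symmetric matrix of positive size is finite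
   and nonempty, so that the supremum is a maximum. *)
Definition lambda1 (R : realType) n (A : 'M[R]_n) : R :=
  sup [set a : R | eigenvalue A a].

(* For Gaussian [X i] the products are integrable, so [fine] only casts a finite
   value; over an index type with no two distinct elements the sup is 0. *)
Definition sup_cross_moment d (T : measurableType d) (R : realType)
    (P : probability T R) (I : finType) (X : I -> {RV P >-> R}) : R :=
  sup [set `|fine 'E_P[X pq.1 \* X pq.2]| | pq in [set pq : I * I | pq.1 != pq.2]].

(* Main.v *)
(* The moments of a Gaussian vector depend polynomially, with nonnegative
   coefficients, on its covariance. Bounding the covariance of the normalized matrix
   entries by the kernel ([p = q] + delta) / n, delta = O(n^-(1+eps)), therefore bounds
   all moments of traces by those computed with that kernel. Integration by parts gives a closed
   recursion for the products of the sums sigma_m = n^-1 1^T M^m 1 under the kernel,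
   and a supersolution built on the Catalan numbers yields E sigma_2K <= (2 theta)^2K
   for K of order log n; Markov and Borel-Cantelli then give the upper bound.
   For the lower bound, the same recursion for normalized traces converges to that of the
   semicircle moments, an interpolation formula bounds their variance by O(n^-2), and a
   top eigenvalue staying below c < 2 would contradict the growth of the Catalan numbers. *)
Require Import Defs.
From HB Require Import structures.
From mathcomp Require Import all_boot all_order all_algebra.
From mathcomp Require Import ring lra zify.
From mathcomp Require mpoly.
From mathcomp Require complex.

Set Implicit Arguments.
Unset Strict Implicit.
Unset Printing Implicit Defensive.
Import Order.TTheory GRing.Theory Num.Theory.
Local Open Scope ring_scope.

(** Traces alone satisfy no closed system of inequalities: a correlation between unrelated entries
    contracts $M_{ij}$ with every $M_{kl}$ at once and cuts the loop of a trace into sums over all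
    entries. The sums sigma_m are stable under this, and each exceeds the normalized trace by a
    polynomial with nonnegative coefficients, so it suffices to bound them. Products have to be
    carried along because integration by parts also differentiates the other factors. The comparison
    with the kernel takes place inside an algebraic functional on polynomials, where monotonicity is
    read off coefficients. The order K must grow like log n for $(2\theta/b)^{2K}$ to beat $n^{-3}$;
    the recursion then loses a power $K^5$, harmless against $n^{-\min(1,\epsilon)}$. As nothing
    links the matrices for different n, each almost sure statement rests on probabilities of order
    $n^{-2}$. In the lower bound, large negative eigenvalues could supply the even moments by
    themselves; the weight $x^{2k}(1+x)$, nonpositive for $x\le -1$, excludes this. *)

Module WickFunctional.
Import mpoly.

(** * Gaussian expectation as an algebraic functional on polynomials *)

Section Wick.
Variables (N : nat) (R : realFieldType).
Implicit Types (p q F G : {mpoly R[N]}) (K S : 'I_N -> 'I_N -> R).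

Definition nneg p := forall m, 0 <= p@_m.
Definition dominated p q := forall m, `|p@_m| <= q@_m.

Lemma nnegD p q : nneg p -> nneg q -> nneg (p + q).
Proof. by move=> hp hq m; rewrite mcoeffD addr_ge0. Qed.

Lemma nneg0 : nneg 0.
Proof. by move=> m; rewrite mcoeff0. Qed.

Lemma nneg1 : nneg 1.
Proof. by move=> m; rewrite mcoeff1 ler0n. Qed.

Lemma nnegX m : nneg 'X_[m].
Proof. by move=> k; rewrite mcoeffX ler0n. Qed.

Lemma nnegM p q : nneg p -> nneg q -> nneg (p * q).
Proof. by move=> hp hq m; rewrite mcoeffM sumr_ge0 // => k _; rewrite mulr_ge0. Qed.

Lemma nnegZ c p : 0 <= c -> nneg p -> nneg (c *: p).
Proof. by move=> hc hp m; rewrite mcoeffZ mulr_ge0. Qed.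

Lemma nneg_sum I (r : seq I) (P : pred I) (F : I -> {mpoly R[N]}) :
  (forall i, P i -> nneg (F i)) -> nneg (\sum_(i <- r | P i) F i).
Proof. by move=> h; apply: big_ind => //; [exact: nneg0|exact: nnegD]. Qed.

Lemma nneg_prod I (r : seq I) (P : pred I) (F : I -> {mpoly R[N]}) :
  (forall i, P i -> nneg (F i)) -> nneg (\prod_(i <- r | P i) F i).
Proof. by move=> h; apply: big_ind => //; [exact: nneg1|exact: nnegM]. Qed.

Lemma nneg_mderiv p i : nneg p -> nneg p^`M(i).
Proof. by move=> hp m; rewrite mcoeff_mderiv mulrn_wge0. Qed.

(** [grad K i] is row [i] of $K\nabla$, the operator produced by integration by parts, and [lap K]
    is $\sum_{ij}K_{ij}\partial_i\partial_j$. *)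
Definition grad K i p := \sum_j K i j *: p^`M(j).
Definition lap K p := \sum_i (grad K i p)^`M(i).

Fact grad_is_linear K i : linear (grad K i).
Proof.
move=> c p q; rewrite /grad scaler_sumr -big_split /=; apply: eq_bigr => j _.
by rewrite mderivD mderivZ scalerDr !scalerA mulrC.
Qed.
HB.instance Definition _ K i :=
  GRing.isLinear.Build R {mpoly R[N]} {mpoly R[N]} _ (grad K i) (grad_is_linear K i).

Fact lap_is_linear K : linear (lap K).
Proof.
move=> c p q; rewrite /lap scaler_sumr -big_split /=; apply: eq_bigr => i _.
by rewrite linearP mderivD mderivZ.
Qed.
HB.instance Definition _ K :=
  GRing.isLinear.Build R {mpoly R[N]} {mpoly R[N]} _ (lap K) (lap_is_linear K).

Fact iter_lap_is_linear K k : linear (iter k (lap K)).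
Proof. by move=> c p q; elim: k => //= k ->; rewrite linearP. Qed.
HB.instance Definition _ K k :=
  GRing.isLinear.Build R {mpoly R[N]} {mpoly R[N]} _ (iter k (lap K))
    (iter_lap_is_linear K k).

Lemma mcoeff_lap K p m : (lap K p)@_m =
  \sum_i \sum_j K i j * (p@_(m + U_(i) + U_(j)) *+ ((m + U_(i))%MM j).+1 *+ (m i).+1).
Proof.
rewrite /lap raddf_sum /=; apply: eq_bigr => i _.
rewrite mcoeff_mderiv /grad raddf_sum /= -sumrMnl; apply: eq_bigr => j _.
by rewrite mcoeffZ mcoeff_mderiv !mulrnAr.
Qed.

(** Each [lap K] lowers the degree by two; counting only one per step already justifies cutting the
    series at [msize p]. *)
Lemma iter_lap_eq0 K k p :
  (forall m, (k <= mdeg m)%N -> p@_m = 0) -> iter k (lap K) p = 0.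
Proof.
elim: k p => [|k IH] p hp.
  by apply/mpolyP => m; rewrite hp // mcoeff0.
rewrite iterSr IH // => m hm; rewrite mcoeff_lap big1 // => i _; rewrite big1 // => j _.
rewrite hp ?mul0rn ?mulr0 // !mdegD !mdeg1; lia.
Qed.

Definition wick_coef k : R := ((2 ^ k * k`!)%:R)^-1.

(* The expectation under the centered Gaussian law of covariance K:
   E p = (exp (lap / 2) p)(0), the exponential series being finite. *)
Definition wick K p : R :=
  \sum_(k < msize p) wick_coef k * (iter k (lap K) p)@_0%MM.

(** Polynomials of different degrees can thus be compared term by term under one common cut-off. *)
Lemma wick_trunc K p B : (msize p <= B)%N ->
  wick K p = \sum_(k < B) wick_coef k * (iter k (lap K) p)@_0%MM.
Proof.
move=> hB; rewrite /wick -!(big_mkord xpredT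
  (fun k => wick_coef k * (iter k (lap K) p)@_0%MM)).
rewrite (big_cat_nat (leq0n _) hB) /=.
rewrite [X in _ = _ + X]big_nat_cond [X in _ = _ + X]big1 ?addr0 // => k.
rewrite andbT => /andP[hk _]; rewrite iter_lap_eq0 ?mcoeff0 ?mulr0 // => m hm.
by apply/eqP; rewrite mcoeff_eq0 msize_mdeg_ge // (leq_trans hk).
Qed.

Fact wick_is_linear K : linear_for *%R (wick K).
Proof.
move=> c p q.
pose B := maxn (msize (c *: p + q)) (maxn (msize p) (msize q)).
rewrite (@wick_trunc _ (c *: p + q) B) ?leq_maxl //.
rewrite (@wick_trunc _ p B) ?(leq_trans (leq_maxl _ _) (leq_maxr _ _)) //.
rewrite (@wick_trunc _ q B) ?(leq_trans (leq_maxr _ _) (leq_maxr _ _)) //.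
rewrite mulr_sumr -big_split; apply: eq_bigr => k _ /=.
by rewrite linearP mcoeffD mcoeffZ; ring.
Qed.
HB.instance Definition _ K :=
  GRing.isLinear.Build R {mpoly R[N]} R *%R (wick K) (wick_is_linear K).

Lemma wickD K p q : wick K (p + q) = wick K p + wick K q.
Proof. exact: raddfD. Qed.

Lemma wickZ K c p : wick K (c *: p) = c * wick K p.
Proof. exact: linearZ. Qed.

Lemma wick_sum K I (r : seq I) (P : pred I) (F : I -> {mpoly R[N]}) :
  wick K (\sum_(i <- r | P i) F i) = \sum_(i <- r | P i) wick K (F i).
Proof. exact: raddf_sum. Qed.

Lemma wick1 K : wick K 1 = 1.
Proof.
by rewrite /wick msize1 big_ord_recl big_ord0 /= mcoeff1 eqxx /wick_coef invr1 mulr1 addr0.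
Qed.

Lemma grad_mderiv K i j p : grad K i p^`M(j) = (grad K i p)^`M(j).
Proof.
rewrite /grad raddf_sum /=; apply: eq_bigr => l _.
by rewrite mderivZ mderiv_comm.
Qed.

Lemma grad_comm K i j p : grad K i (grad K j p) = grad K j (grad K i p).
Proof.
rewrite {2}/grad linear_sum /= {3}/grad; apply: eq_bigr => l _.
by rewrite linearZ /= grad_mderiv.
Qed.

Lemma lap_grad K i p : lap K (grad K i p) = grad K i (lap K p).
Proof.
rewrite /lap linear_sum /=; apply: eq_bigr => l _.
by rewrite grad_comm grad_mderiv.
Qed.

Lemma iter_lap_grad K i k p :
  iter k (lap K) (grad K i p) = grad K i (iter k (lap K) p).
Proof. by elim: k => //= k ->; rewrite lap_grad. Qed.

Lemma mderivXU i j : ('X_i : {mpoly R[N]})^`M(j) = (i == j)%:R.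
Proof.
apply/mpolyP => m; rewrite mcoeff_mderiv mcoeffX.
rewrite -[(i == j)%:R]/((i == j)%:R) -mpolyC_nat mcoeffC.
have [->|nij] := eqVneq i j.
  have [->|nm] := eqVneq m 0%MM; first by rewrite add0m eqxx mnm0E mulr1.
  case: eqP => [e|_]; last by rewrite mul0rn mulr0.
  case/eqP: nm; have := f_equal mdeg e; rewrite mdegD !mdeg1 => h.
  by apply/eqP; rewrite -mdeg_eq0; lia.
rewrite mul0r; case: eqP => [e|_]; last by rewrite mul0rn.
have := congr1 (fun m : 'X_{1..N} => m j) e.
by rewrite mnmDE !mnm1E eqxx (negbTE nij) => h; exfalso; lia.
Qed.

Lemma lapXM K i p : (forall i j, K i j = K j i) ->
  lap K ('X_i * p) = 'X_i * lap K p + 2 *: grad K i p.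
Proof.
move=> Ksym.
have gX l : grad K l ('X_i * p) = K l i *: p + 'X_i * grad K l p.
  rewrite /grad mulr_sumr (eq_bigr (fun j => (K l j * (i == j)%:R) *: p +
      'X_i * (K l j *: p^`M(j)))).
    rewrite big_split /=; congr (_ + _).
    rewrite (bigD1 i) //= eqxx mulr1 big1 ?addr0 // => j ji.
    by rewrite eq_sym (negbTE ji) mulr0 scale0r.
  move=> j _; rewrite mderivM mderivXU scalerDr -scalerAr; congr (_ + _).
  by case: (i == j); rewrite ?mul1r ?mulr1 // mul0r mulr0 scaler0 scale0r.
rewrite /lap mulr_sumr (eq_bigr (fun l => 'X_i * (grad K l p)^`M(l) +
    (K i l *: p^`M(l) + (i == l)%:R *: grad K l p))); last first.
  move=> l _; rewrite gX mderivD mderivZ mderivM mderivXU Ksym.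
  rewrite addrA addrC; congr (_ + (_ + _)).
  by case: (i == l); rewrite ?mul1r ?scale1r // mul0r scale0r.
rewrite big_split /=; congr (_ + _); rewrite big_split /=.
rewrite [X in _ + X](bigD1 i) //= eqxx scale1r [X in _ + (_ + X)]big1 ?addr0.
  by rewrite -[X in X + _]/(grad K i p) -mulr2n scaler_nat.
by move=> j ji; rewrite eq_sym (negbTE ji) scale0r.
Qed.

(** The commutator of [lap K] with multiplication by ['X_i] is [2 *: grad K i], which commutes with
    [lap K]; hence the factor $2(k+1)$, as in differentiating a power. *)
Lemma iter_lapXM K i k p : (forall i j, K i j = K j i) ->
  iter k.+1 (lap K) ('X_i * p) =
  'X_i * iter k.+1 (lap K) p + (2 * k.+1)%:R *: grad K i (iter k (lap K) p).
Proof.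
move=> Ksym; elim: k => [|k IH]; first by rewrite /= lapXM.
rewrite iterS IH linearD linearZ /= lapXM // lap_grad -addrA -scalerDl.
by congr (_ + _ *: _); rewrite -natrD; congr (_%:R); lia.
Qed.

(** Evaluation at the origin kills the terms carrying ['X_i], and the commutator factor $2(k+1)$ is
    exactly the ratio of [wick_coef k] to [wick_coef k.+1]. *)
Lemma wick_ibp K i p : (forall i j, K i j = K j i) ->
  wick K ('X_i * p) = \sum_j K i j * wick K p^`M(j).
Proof.
move=> Ksym; transitivity (wick K (grad K i p)); last first.
  by rewrite /grad wick_sum; apply: eq_bigr => j _; rewrite wickZ.
have X0 q : ('X_i * q)@_0%MM = 0.
  by rewrite mcoeff0_is_multiplicative mcoeffX mnm1_eq0 mul0r.
pose B := maxn (msize ('X_i * p)) (msize (grad K i p)).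
rewrite (@wick_trunc _ _ B.+1) ?(leq_trans (leq_maxl _ _) (leqnSn _)) //.
rewrite (@wick_trunc _ (grad K i p) B) ?leq_maxr //.
rewrite big_ord_recl /= X0 mulr0 add0r; apply: eq_bigr => k _.
rewrite -[lap K (iter _ _ _)]/(iter k.+1 (lap K) ('X_i * p)) iter_lapXM //.
rewrite mcoeffD X0 add0r mcoeffZ iter_lap_grad mulrA; congr (_ * _).
rewrite /wick_coef expnS factS !natrM; field.
by rewrite nat1r !pnatr_eq0 -!lt0n fact_gt0 expn_gt0.
Qed.

Lemma lap_dominated S K p q : (forall i j, `|S i j| <= K i j) ->
  dominated p q -> dominated (lap S p) (lap K q).
Proof.
move=> SK pq m; rewrite !mcoeff_lap; apply: le_trans (ler_norm_sum _ _ _) _.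
apply: ler_sum => i _; apply: le_trans (ler_norm_sum _ _ _) _.
apply: ler_sum => j _; rewrite normrM ler_pM // !normrMn.
by rewrite !lerMn2r pq !orbT.
Qed.

(** The coefficients of the exponential series are nonnegative, so absolute values may be taken
    entry by entry in the covariance and coefficient by coefficient in the polynomial. *)
Lemma wick_dominated S K p q : (forall i j, `|S i j| <= K i j) ->
  dominated p q -> `|wick S p| <= wick K q.
Proof.
move=> SK pq; pose B := maxn (msize p) (msize q).
rewrite (@wick_trunc _ p B) ?leq_maxl // (@wick_trunc _ q B) ?leq_maxr //.
apply: le_trans (ler_norm_sum _ _ _) _; apply: ler_sum => k _.
have hk : 0 <= wick_coef k by rewrite invr_ge0 ler0n.
rewrite normrM (ger0_norm hk) ler_wpM2l //.
suff : dominated (iter k (lap S) p) (iter k (lap K) q) by exact.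
by elim: (k : nat) => //= l; exact: lap_dominated.
Qed.

Lemma wick_norm_le S K p : (forall i j, `|S i j| <= K i j) -> nneg p ->
  `|wick S p| <= wick K p.
Proof. by move=> SK hp; apply: wick_dominated => // m; rewrite ger0_norm. Qed.

Lemma wick_ge0 K p : (forall i j, 0 <= K i j) -> nneg p -> 0 <= wick K p.
Proof.
move=> hK hp; apply: le_trans (normr_ge0 (wick K p)) _; apply: wick_norm_le => // i j.
by rewrite ger0_norm.
Qed.

Lemma wick_le K p q : (forall i j, 0 <= K i j) -> nneg (q - p) -> wick K p <= wick K q.
Proof. by move=> hK /(wick_ge0 hK); rewrite raddfB /= subr_ge0. Qed.

(** Inequalities between moments survive only nonnegative combinations; within this cone a property
    reduces to monomials, ordered by degree. *)
Lemma nneg_ind (Q : {mpoly R[N]} -> Prop) :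
  Q 0 -> (forall p q, Q p -> Q q -> Q (p + q)) ->
  (forall c p, 0 <= c -> Q p -> Q (c *: p)) ->
  (forall m, (forall k : 'X_{1..N}, (mdeg k < mdeg m)%N -> Q 'X_[k]) -> Q 'X_[m]) ->
  forall p, nneg p -> Q p.
Proof.
move=> Q0 QD QZ QX p hp; rewrite (mpolyE p); apply: big_ind => // m _; apply: QZ => //.
move: {2}(mdeg m).+1 (ltnSn (mdeg m)) => B; elim: B m => // B IH m hm.
by apply: QX => k hk; apply: IH; lia.
Qed.

(* The interpolation bound behind the concentration of linear statistics. *)
Lemma wick_cov_le S K F G :
  (forall i j, S i j = S j i) -> (forall i j, K i j = K j i) ->
  (forall i j, `|S i j| <= K i j) -> nneg F -> nneg G ->
  `|wick S (F * G) - wick S F * wick S G| <=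
  \sum_i \sum_j K i j * wick K (F^`M(i) * G^`M(j)).
Proof.
move=> Ssym Ksym SK hF; elim/nneg_ind: F / hF G => [|p q IHp IHq|c p hc IH|m IH] G hG.
- rewrite !mul0r raddf0 mul0r subr0 normr0 big1 // => i _; rewrite big1 // => j _.
  by rewrite mderiv0 mul0r raddf0 mulr0.
- rewrite (eq_bigr (fun i => \sum_j K i j * wick K (p^`M(i) * G^`M(j)) +
      \sum_j K i j * wick K (q^`M(i) * G^`M(j)))); last first.
    move=> i _; rewrite -big_split /=; apply: eq_bigr => j _.
    by rewrite mderivD mulrDl wickD mulrDr.
  rewrite big_split /=; apply: le_trans (lerD (IHp _ hG) (IHq _ hG)).
  rewrite mulrDl !wickD mulrDl opprD addrACA; exact: ler_normD.
- rewrite -scalerAl !wickZ -mulrA -mulrBr normrM ger0_norm //.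
  apply: le_trans (ler_wpM2l hc (IH _ hG)) _; rewrite mulr_sumr; apply: ler_sum => i _.
  rewrite mulr_sumr; apply: ler_sum => j _.
  by rewrite mderivZ -scalerAl wickZ mulrCA.
have K0 i j : 0 <= K i j by apply: le_trans (normr_ge0 _) (SK i j).
have [->|m0] := eqVneq m 0%MM.
  rewrite mpolyX0 mul1r wick1 mul1r subrr normr0 sumr_ge0 // => i _.
  rewrite sumr_ge0 // => j _; rewrite -mpolyC1 mderivC mul0r raddf0 mulr0 //.
have [i mi] : exists i, (0 < m i)%N.
  apply/existsP; apply: contraNT m0 => /existsPn h; apply/eqP/mnmP => i.
  by rewrite mnm0E; have := h i; rewrite -eqn0Ngt => /eqP.
(* One variable is split off the monomial, so that integration by parts lowers the degree. *)
pose F := 'X_[R, m - U_(i)].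
have -> : 'X_[R, m] = 'X_i * F by rewrite -mpolyXD addmC submK // lep1mP -lt0n.
have dF j G' : nneg G' ->
    `|wick S (F^`M(j) * G') - wick S F^`M(j) * wick S G'| <=
    \sum_r \sum_s K r s * wick K (F^`M(j)^`M(r) * G'^`M(s)).
  move=> hG'; rewrite mderivX -scalerAl !wickZ -mulrA -mulrBr normrM.
  rewrite ger0_norm ?ler0n //; set c := (_)%:R.
  have [|mj] := posnP ((m - U_(i))%MM j).
    move=> c0; rewrite /c c0 mul0r sumr_ge0 // => r _; rewrite sumr_ge0 // => s _.
    by rewrite scale0r mderiv0 mul0r raddf0 mulr0.
  have h : (mdeg (m - U_(i) - U_(j))%MM < mdeg m)%N.
    have e1 : (m - U_(i) + U_(i))%MM = m by rewrite submK // lep1mP -lt0n.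
    have e2 : (m - U_(i) - U_(j) + U_(j))%MM = (m - U_(i))%MM.
      by rewrite submK // lep1mP -lt0n.
    by have := congr1 mdeg e1; have := congr1 mdeg e2; rewrite !mdegD !mdeg1; lia.
  apply: le_trans (ler_wpM2l (ler0n _ _) (IH _ h _ hG')) _.
  rewrite mulr_sumr; apply: ler_sum => r _; rewrite mulr_sumr; apply: ler_sum => s _.
  by rewrite mderivZ -scalerAl wickZ mulrCA.
have nF : nneg F by exact: nnegX.
(* The covariance of ['X_i * F] and [G] becomes $\sum_j
   S_{ij}(E[F\partial_jG]+\mathrm{Cov}(\partial_jF,G))$; the expectation is bounded by comparison
   with [K], the covariance by [dF]. *)
rewrite -mulrA !wick_ibp // mulr_suml -sumrB.
apply: (@le_trans _ _ (\sum_j K i j * (wick K (F * G^`M(j)) +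
   \sum_r \sum_s K r s * wick K (F^`M(j)^`M(r) * G^`M(s))))).
  apply: le_trans (ler_norm_sum _ _ _) _; apply: ler_sum => j _.
  rewrite mderivM wickD -mulrA -mulrBr normrM ler_pM //.
  rewrite addrAC addrC; apply: le_trans (ler_normD _ _) _; apply: lerD; last exact: dF.
  by apply: wick_norm_le => //; apply: nnegM => //; exact: nneg_mderiv.
under [X in _ <= X]eq_bigr => r _.
  under eq_bigr => s _ do rewrite mderivM mderivXU mulrDl wickD mulrDr.
  rewrite big_split /=; over.
rewrite big_split /=; under eq_bigr do rewrite mulrDr.
rewrite big_split /=; apply: lerD.
  rewrite [X in _ <= X](bigD1 i) //= eqxx [X in _ <= _ + X]big1 ?addr0; last first.
    move=> j ji; rewrite big1 // => s _.
    by rewrite eq_sym (negbTE ji) !mul0r raddf0 mulr0.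
  by under [X in _ <= X]eq_bigr do rewrite mul1r.
under eq_bigr do rewrite mulr_sumr.
rewrite exchange_big /=; apply: ler_sum => r _.
under eq_bigr do rewrite mulr_sumr.
rewrite exchange_big /=; apply: ler_sum => s _.
under eq_bigr do rewrite mulrCA.
(* Under [K] the variable ['X_i] is integrated by parts as well; the terms differentiating [G] twice
   are nonnegative and dropped. *)
rewrite -mulr_sumr ler_wpM2l // -mulrA wick_ibp //; apply: ler_sum => j _.
rewrite ler_wpM2l // mderivM wickD mderiv_comm lerDl; apply: wick_ge0 => //.
by apply: nnegM; do ?apply: nneg_mderiv.
Qed.

Definition linform (a : 'I_N -> R) : {mpoly R[N]} := \sum_i a i *: 'X_i.

Lemma mderiv_linform a j : (linform a)^`M(j) = (a j)%:MP.
Proof.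
rewrite /linform raddf_sum /= (bigD1 j) //= mderivZ mderivXU eqxx big1 ?addr0.
  by rewrite -mul_mpolyC mulr1.
by move=> i ij; rewrite mderivZ mderivXU (negbTE ij) scaler0.
Qed.

Lemma mderivXn p j k : (p ^+ k)^`M(j) = k%:R *: (p^`M(j) * p ^+ k.-1).
Proof.
elim: k => [|k IH]; first by rewrite expr0 -mpolyC1 mderivC scale0r.
rewrite exprS mderivM IH /=; case: k {IH} => [|k]; first by rewrite !scale0r mulr0 addr0 scale1r.
by rewrite /= -scalerAr mulrCA -exprS !scaler_nat -mulrS.
Qed.

Lemma wick_linform K a k : (forall i j, K i j = K j i) ->
  wick K (linform a ^+ k.+2) =
  k.+1%:R * (\sum_i \sum_j a i * a j * K i j) * wick K (linform a ^+ k).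
Proof.
move=> Ksym; rewrite exprS {1}/linform mulr_suml wick_sum -mulrA mulrC -mulrA mulr_suml.
apply: eq_bigr => i _; rewrite -scalerAl wickZ wick_ibp // mulr_suml mulr_sumr.
apply: eq_bigr => j _.
by rewrite mderivXn mderiv_linform /= wickZ mul_mpolyC wickZ; ring.
Qed.

Lemma wick_linform1 K a : (forall i j, K i j = K j i) -> wick K (linform a) = 0.
Proof.
move=> Ksym; rewrite /linform wick_sum big1 // => i _.
rewrite wickZ -['X_i]mulr1 wick_ibp // big1 ?mulr0 // => j _.
by rewrite -mpolyC1 mderivC raddf0 mulr0.
Qed.

(* Polarization: powers of linear forms determine a linear functional. *)
Lemma eq_linform_powers (f g : {mpoly R[N]} -> R) :
  linear_for *%R f -> linear_for *%R g ->
  (forall a k, f (linform a ^+ k) = g (linform a ^+ k)) -> f =1 g.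
Proof.
move=> lf lg fg.
have f0 : f 0 = 0 by have := lf (-1) 0 0; rewrite scaler0 addr0 mulN1r addNr.
have g0 : g 0 = 0 by have := lg (-1) 0 0; rewrite scaler0 addr0 mulN1r addNr.
pose h p := f p - g p.
have hl c p q : h (c *: p + q) = c * h p + h q by rewrite /h lf lg; ring.
have h0 : h 0 = 0 by rewrite /h f0 g0 subr0.
have hsum I (r : seq I) (c : I -> R) (p : I -> {mpoly R[N]}) :
    h (\sum_(i <- r) c i *: p i) = \sum_(i <- r) c i * h (p i).
  by elim: r => [|i r IH]; rewrite ?big_nil // !big_cons hl IH.
(* The variables of the monomial are produced one at a time: with $a+te_i$ in place of $a$ the
   induction hypothesis makes the polynomial [Q] in $t$ vanish identically, and its linear
   coefficient is the claim for one more variable, up to the factor $k+1$. *)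
have hX (s : seq 'I_N) a k : h (linform a ^+ k * \prod_(i <- s) 'X_i) = 0.
  elim: s a k => [|i s IH] a k; first by rewrite big_nil mulr1 /h fg subrr.
  rewrite big_cons; set W : {mpoly R[N]} := \prod_(j <- s) _.
  pose c j : R := h (linform a ^+ (k.+1 - j) * 'X_i ^+ j * W) * 'C(k.+1, j)%:R.
  pose Q := \poly_(j < k.+2) c j.
  have Q0 t : Q.[t] = 0.
    rewrite horner_poly; apply: etrans (IH (fun l => a l + t * (i == l)%:R) k.+1).
    have -> : linform (fun l => a l + t * (i == l)%:R) = linform a + t *: 'X_i.
      rewrite /linform (eq_bigr (fun l => a l *: 'X_l + (t * (i == l)%:R) *: 'X_l)).
        rewrite big_split /=; congr (_ + _); rewrite (bigD1 i) //= eqxx mulr1.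
        by rewrite big1 ?addr0 // => l li; rewrite eq_sym (negbTE li) mulr0 scale0r.
      by move=> l _; rewrite scalerDl.
    rewrite exprDn mulr_suml.
    rewrite (eq_bigr (fun j : 'I_k.+2 => ('C(k.+1, j)%:R * t ^+ j) *:
        (linform a ^+ (k.+1 - j) * 'X_i ^+ j * W))).
      rewrite hsum; apply: eq_bigr => j _; rewrite /c; ring.
    move=> j _; by rewrite exprZn -scaler_nat -scalerAr scalerA -scalerAl.
  have : Q = 0.
    apply/eqP; apply: contraT => nQ.
    have := max_poly_roots nQ (rs := [seq j%:R | j <- iota 0 (size Q)]).
    rewrite size_map size_iota ltnn; apply.
      by apply/allP => x _; apply/eqP/Q0.
    by rewrite map_inj_uniq ?iota_uniq // => x y /eqP; rewrite eqr_nat => /eqP.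
  move/(congr1 (fun q : {poly R} => q`_1)); rewrite coef_poly coef0 /c subn1 /= expr1.
  rewrite -mulrA => /eqP; rewrite mulf_eq0 pnatr_eq0 bin1 /= orbF => /eqP.
  by rewrite mulrA.
move=> p; apply/eqP; rewrite -subr_eq0 -/(h p); apply/eqP.
rewrite (mpolyE p) hsum big1 // => m _; suff -> : h 'X_[m] = 0 by rewrite mulr0.
pose s := flatten [seq nseq (m i) i | i <- enum 'I_N].
rewrite -(hX s (fun=> 0) 0%N) expr0 mul1r mpolyXE_id; congr (h _).
rewrite big_flatten /= big_map big_enum /=; apply: eq_bigr => i _.
by rewrite big_nseq -Monoid.iteropE.
Qed.

End Wick.
End WickFunctional.

Module Catalan.

(** * Catalan numbers: convolution and growth *)

Section Catalan.
Variable R : realFieldType.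

(** The ratio of consecutive terms serves as definition because the growth bounds follow from it by
    induction; the convolution is recovered in [catalan_segner]. *)
Fixpoint catalan k : R :=
  if k is j.+1 then (4 * j%:R + 2) / (j%:R + 2) * catalan j else 1.

Let nat2_gt0 k : 0 < k%:R + 2 :> R.
Proof. by rewrite ltr_wpDl ?ler0n ?ltr0n. Qed.

Lemma catalan_gt0 k : 0 < catalan k.
Proof.
elim: k => [|k IH] /=; first exact: ltr01.
by rewrite mulr_gt0 // divr_gt0 // ltr_wpDl ?mulr_ge0 ?ler0n ?ltr0n.
Qed.

Lemma catalan_rec k : (k%:R + 2) * catalan k.+1 = (4 * k%:R + 2) * catalan k.
Proof. by rewrite /= mulrA; congr (_ * _); field; rewrite lt0r_neq0. Qed.

(** Weighting the convolution [S] by $i+1$ gives [T]: reflection yields $2T_k=(k+2)S_k$, and the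
    ratio recursion yields $T_{k+1}=C_{k+1}+4T_k-2S_k$. Together they close the induction. *)
Lemma catalan_segner k : \sum_(i < k.+1) catalan i * catalan (k - i) = catalan k.+1.
Proof.
pose S k := \sum_(i < k.+1) catalan i * catalan (k - i).
pose T k := \sum_(i < k.+1) (i%:R + 1) * (catalan i * catalan (k - i)).
have TS j : 2 * T j = (j%:R + 2) * S j.
  rewrite mulr_natl mulr2n {2}/T (reindex_inj rev_ord_inj) -big_split /= mulr_sumr.
  apply: eq_bigr => i _; rewrite subSS.
  have ij : (i <= j)%N by rewrite -ltnS.
  by rewrite subKn // natrB //; ring.
rewrite -/(S k); elim: k => [|k IH].
  by rewrite /S big_ord_recl big_ord0 /= mulr0 !add0r divff ?pnatr_eq0 // !mulr1 addr0.
have e : T k.+1 = catalan k.+1 + 4 * T k - 2 * S k.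
  rewrite {1}/T big_ord_recl /= add0r !mul1r -addrA; congr (_ + _).
  rewrite /T /S !mulr_sumr -sumrB; apply: eq_bigr => i _; rewrite subSS.
  by rewrite /bump leq0n add1n -natr1; field; rewrite lt0r_neq0.
have k3 : (k.+1%:R + 2 : R) != 0 by rewrite lt0r_neq0.
apply: (mulfI k3); rewrite catalan_rec -TS e.
have := TS k; rewrite IH => h; rewrite -(natr1 k).
have -> : 2 * (catalan k.+1 + 4 * T k - 2 * catalan k.+1) =
  4 * (2 * T k) - 2 * catalan k.+1 by ring.
by rewrite h; ring.
Qed.

Lemma catalan_le k : catalan k <= 4 ^+ k.
Proof.
elim: k => [|k IH]; first by rewrite expr0.
have k0 := ler0n R k; have := catalan_gt0 k; rewrite exprS => c0.
rewrite -(ler_pM2l (nat2_gt0 k)) catalan_rec mulrA ler_pM //; [lra|exact: ltW|lra].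
Qed.

(** The loss is only polynomial: $(k+1)^2$ in place of the true order $k^{3/2}$. *)
Lemma catalan_ge k : 4 ^+ k <= (k.+1%:R) ^+ 2 * catalan k.
Proof.
elim: k => [|k IH]; first by rewrite expr0 mulr1 expr1n.
rewrite -(ler_pM2l (nat2_gt0 k)) mulrCA catalan_rec exprS.
apply: (@le_trans _ _ ((k%:R + 2) * (4 * (k.+1%:R ^+ 2 * catalan k)))).
  by rewrite !ler_pM2l // ltr0n.
rewrite -!(natr1 k.+1) -!(natr1 k).
rewrite -subr_ge0 (_ : _ - _ = catalan k * (k%:R + 2) * (2 * k%:R)); last by ring.
by rewrite !mulr_ge0 ?ler0n ?(ltW (catalan_gt0 _)) ?(ltW (nat2_gt0 _)).
Qed.

Lemma catalan_leS k : catalan k <= catalan k.+1.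
Proof.
rewrite -(ler_pM2l (nat2_gt0 k)) catalan_rec ler_pM2r ?catalan_gt0 //.
by have := ler0n R k; lra.
Qed.

(** The value 2 is that of the generating function at its radius of convergence 1/4; an explicit
    remainder makes the partial sums accessible to induction. *)
Lemma catalan_sum_le k : \sum_(i < k) catalan i / 4 ^+ i <= 2.
Proof.
have -> : \sum_(i < k) catalan i / 4 ^+ i = 2 - (2 * k%:R + 2) * (catalan k / 4 ^+ k).
  elim: k => [|k IH]; first by rewrite big_ord0 /= expr0 divr1; ring.
  rewrite big_ord_recr IH exprS /= -(natr1 k); field.
  by rewrite expf_neq0 ?pnatr_eq0 //= lt0r_neq0.
rewrite gerBl mulr_ge0 ?divr_ge0 ?(ltW (catalan_gt0 _)) ?exprn_ge0 ?ler0n //.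
by rewrite addr_ge0 ?mulr_ge0 ?ler0n.
Qed.

End Catalan.

Local Ltac nat_lia R := clear dependent R; lia.

(** * A supersolution of the abstract moment recursion *)

Section MomentBound.
Variables (R : realFieldType) (V : seq nat -> R) (e D eta theta : R) (K : nat).
Hypotheses (V_nil : V [::] = 1) (V_0 : forall F, V (0%N :: F) = V F).
Hypotheses (e_ge0 : 0 <= e) (D_ge0 : 0 <= D) (e_le : e <= eta) (D_le : D <= eta).
Hypothesis theta_gt0 : 0 < theta.
(** Shape of an integration by parts in the first factor: the first sum collects the derivatives of
    that factor itself, the second those of the others. The intended values are $e=1/n$ and
    $D=n\delta$, with [eta] bounding both. *)
Hypothesis V_rec : forall m F, V (m.+1 :: F) <=
  \sum_(a < m) ((1 + D) * V [:: a : nat, (m - a.+1)%N & F] + e * V (m.-1 :: F)) +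
  \sum_(q <- F) \sum_(x < q)
    (e * (V [:: (m + x)%N, (q - x.+1)%N & rem q F] +
          V [:: (m + (q - x.+1))%N, x : nat & rem q F]) +
     D * V [:: m, x : nat, (q - x.+1)%N & rem q F]).
(** The summands pay, in turn, for the Catalan convolution with its parity correction, for the at
    most $2K$ lower-order terms of weight [e], and for the coupling with other factors. *)
Hypothesis theta_large :
  (1 + eta) * (1 + (K.+1%:R)^-1) + 2 * K%:R * eta + 6 * K%:R * K.+1%:R ^+ 4 * eta
   <= theta ^+ 2.

(** Small enough for $\beta 4^k\le C_k$ when $k\le K$ and for $K\beta\le 1/(K+1)$, yet only
    polynomially small in $K$. *)
Let beta : R := (K.+1%:R ^+ 2)^-1.

(* A supersolution of the moment recursion. The even part is forced up to theta
   by the Catalan recursion; the small odd part absorbs the coupling between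
   the factors. *)
Let u r : R :=
  if odd r then beta * theta ^+ r * 4 ^+ r./2 else theta ^+ r * catalan R r./2.

Let K1_gt0 : 0 < K.+1%:R :> R. Proof. by rewrite ltr0n. Qed.

Let beta_gt0 : 0 < beta. Proof. by rewrite invr_gt0 exprn_gt0. Qed.

Let beta_le1 : beta <= 1.
Proof. by rewrite invf_le1 ?exprn_gt0 // exprn_ege1 // ler1n. Qed.

Let betaK : beta * K.+1%:R ^+ 2 = 1.
Proof. by rewrite mulVf // expf_neq0 // lt0r_neq0. Qed.

Let u_gt0 r : 0 < u r.
Proof. by rewrite /u; case: odd; rewrite !mulr_gt0 ?exprn_gt0 ?catalan_gt0. Qed.

Let u_ge0 r : 0 <= u r. Proof. exact: ltW. Qed.

Let u_even k : u (2 * k) = theta ^+ (2 * k) * catalan R k.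
Proof. by rewrite /u mul2n odd_double doubleK. Qed.

Let u_odd k : u (2 * k).+1 = beta * theta ^+ (2 * k).+1 * 4 ^+ k.
Proof. by rewrite /u mul2n /= odd_double /= uphalf_double. Qed.

Let four_pow k : (4 : R) ^+ k = 2 ^+ (2 * k).
Proof. by rewrite exprM; congr (_ ^+ _); ring. Qed.

Let parityP r : exists k, r = (2 * k)%N \/ r = (2 * k).+1.
Proof. by exists r./2; case h: (odd r); [right|left]; nat_lia R. Qed.

Let u_le r : u r <= (2 * theta) ^+ r.
Proof.
have [k [] ->] := parityP r; rewrite exprMn mulrC ?u_even ?u_odd.
  by rewrite ler_pM2l ?exprn_gt0 // -four_pow catalan_le.
rewrite [beta * _]mulrC -mulrA ler_pM2l ?exprn_gt0 // exprS -four_pow.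
by rewrite ler_pM2r ?exprn_gt0 // (le_trans beta_le1) // ler1n.
Qed.

(** Coupling adds up indices of arbitrary parity, for which a geometric sequence is multiplicative
    and [u] is not. [u_le] passes to that sequence; this bound returns to [u] at a cost of
    $2(K+1)^2$ per factor, the origin of $(K+1)^4$ in [theta_large]. *)
Let u_large r : (r <= 2 * K)%N -> (2 * theta) ^+ r <= 2 * K.+1%:R ^+ 2 * u r.
Proof.
have [k [] ->] := parityP r => hk; rewrite exprMn mulrC ?u_even ?u_odd.
  rewrite [X in _ <= X]mulrCA ler_pM2l ?exprn_gt0 // -four_pow.
  apply: le_trans (catalan_ge R k) _; rewrite ler_pM2r ?catalan_gt0 //.
  apply: (@le_trans _ _ (K.+1%:R ^+ 2)).
    by rewrite ler_pXn2r ?nnegrE ?ler0n // ler_nat; nat_lia R.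
  by rewrite ler_peMl ?ler1n ?exprn_ge0.
rewrite (_ : 2 * _ * _ = beta * K.+1%:R ^+ 2 * (theta ^+ (2 * k).+1 * (2 * 4 ^+ k))).
  by rewrite betaK mul1r four_pow -exprS.
by ring.
Qed.

Let u_mono r : theta ^+ 2 * u r <= u r.+2.
Proof.
have [k [] ->] := parityP r.
  have -> : (2 * k).+2 = (2 * k.+1)%N by nat_lia R.
  rewrite !u_even mulrA -exprD; have -> : (2 + 2 * k = 2 * k.+1)%N by nat_lia R.
  by rewrite ler_pM2l ?exprn_gt0 ?catalan_leS.
have -> : (2 * k).+3 = (2 * k.+1).+1 by nat_lia R.
rewrite !u_odd.
have -> : beta * theta ^+ (2 * k.+1).+1 * 4 ^+ k.+1 =
  4 * (theta ^+ 2 * (beta * theta ^+ (2 * k).+1 * 4 ^+ k)).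
  rewrite [4 ^+ k.+1]exprS; have -> : (2 * k.+1).+1 = (2 + (2 * k).+1)%N by nat_lia R.
  by rewrite exprD; ring.
by rewrite ler_peMl ?ler1n // !mulr_ge0 ?exprn_ge0 ?(ltW beta_gt0) ?(ltW theta_gt0).
Qed.

Let sum_parity (f : nat -> R) k :
  \sum_(i < (2 * k)) f i = \sum_(i < k) (f (2 * i)%N + f (2 * i).+1).
Proof.
elim: k => [|k IH]; first by rewrite muln0 !big_ord0.
by rewrite mulnS big_ord_recr big_ord_recr IH [RHS]big_ord_recr /= addrA.
Qed.

(** For even [m] each product pairs an odd with an even index, and [catalan_sum_le] gives exactly
    the growth $4^{k+1}$ of the odd part. For odd [m] the even pairs form Segner's convolution,
    while the odd pairs carry $\beta^2$ and fit into the slack $1/(K+1)$. *)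
Let u_conv m : (m < 2 * K)%N ->
  theta ^+ 2 * \sum_(a < m) u a * u (m - a.+1) <= (1 + (K.+1%:R)^-1) * u m.+1.
Proof.
have [k [] ->] := parityP m => hm.
  have K1 : 1 <= 1 + (K.+1%:R)^-1 :> R by rewrite lerDl invr_ge0.
  apply: le_trans (ler_peMl (u_ge0 _) K1).
  rewrite (sum_parity (fun a => u a * u (2 * k - a.+1)%N)).
  case: k {hm} => [|k]; first by rewrite big_ord0 mulr0.
  rewrite (eq_bigr (fun i : 'I_k.+1 => beta * theta ^+ (2 * k).+1 *
     (catalan R i * 4 ^+ (k - i) + 4 ^+ i * catalan R (k - i)))); last first.
    move=> i _; have ik : (i <= k)%N by rewrite -ltnS.
    have -> : (2 * k.+1 - (2 * i).+1 = (2 * (k - i)).+1)%N by nat_lia R.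
    have -> : (2 * k.+1 - (2 * i).+2 = 2 * (k - i))%N by nat_lia R.
    have -> : (2 * k).+1 = (2 * i + (2 * (k - i)).+1)%N by nat_lia R.
    rewrite !u_even !u_odd mulrDr; congr (_ + _); first by rewrite exprD; ring.
    have -> : (2 * i + (2 * (k - i)).+1 = (2 * i).+1 + 2 * (k - i))%N by nat_lia R.
    by rewrite exprD; ring.
  rewrite -mulr_sumr big_split /= [X in _ + X](reindex_inj rev_ord_inj) /=.
  rewrite [X in _ + X](eq_bigr (fun i : 'I_k.+1 => catalan R i * 4 ^+ (k - i))); last first.
    move=> i _; have ik : (i <= k)%N by rewrite -ltnS.
    have -> : (k.+1 - i.+1 = k - i)%N by [].
    by have -> : (k - (k - i) = i)%N; [rewrite subKn|rewrite mulrC].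
  have dbl (x : R) : x + x = 2 * x by ring.
  rewrite dbl (eq_bigr (fun i : 'I_k.+1 => 4 ^+ k * (catalan R i / 4 ^+ i))); last first.
    move=> i _; have ik : (i <= k)%N by rewrite -ltnS.
    have -> : 4 ^+ k = 4 ^+ (k - i) * 4 ^+ i :> R by rewrite -exprD subnK.
    field.
    by rewrite expf_neq0 // pnatr_eq0.
  rewrite -mulr_sumr u_odd.
  have -> : (2 * k.+1).+1 = (2 + (2 * k).+1)%N by nat_lia R.
  have -> : beta * theta ^+ (2 + (2 * k).+1) * 4 ^+ k.+1 =
     theta ^+ 2 * (beta * theta ^+ (2 * k).+1) * (2 * (4 ^+ k * 2)).
    by rewrite [4 ^+ k.+1]exprS exprD; ring.
  rewrite mulrA ler_wpM2l ?mulr_ge0 ?exprn_ge0 ?(ltW beta_gt0) ?(ltW theta_gt0) //.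
  rewrite ler_wpM2l // ler_wpM2l ?exprn_ge0 //.
  exact: catalan_sum_le.
rewrite big_ord_recr /= (sum_parity (fun a => u a * u ((2 * k).+1 - a.+1)%N)).
rewrite big_split /= addrAC subSS subnn.
rewrite (_ : \sum_(i < k) u (2 * i)%N * u ((2 * k).+1 - (2 * i).+1)%N +
  u (2 * k)%N * u 0%N = theta ^+ (2 * k) * catalan R k.+1); last first.
  rewrite -catalan_segner mulr_sumr [RHS]big_ord_recr /= subnn -[0%N]/((2 * 0)%N) !u_even.
  congr (_ + _); last by rewrite muln0 expr0; ring.
  apply: eq_bigr => i _; have -> : ((2 * k).+1 - (2 * i).+1 = 2 * (k - i))%N by nat_lia R.
  rewrite !u_even; have -> : (2 * k = 2 * i + 2 * (k - i))%N by have := ltn_ord i; nat_lia R.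
  by rewrite exprD; ring.
rewrite (eq_bigr (fun i : 'I_k => theta ^+ (2 * k) * (beta ^+ 2 * (4 ^+ k / 4)))); last first.
  move=> i _; have ik := ltn_ord i.
  have -> : ((2 * k).+1 - (2 * i).+2 = (2 * (k - i.+1)).+1)%N by nat_lia R.
  rewrite !u_odd; have -> : (2 * k = (2 * i).+1 + (2 * (k - i.+1)).+1)%N by nat_lia R.
  have -> : 4 ^+ k = 4 ^+ i * (4 * 4 ^+ (k - i.+1)) :> R.
    by rewrite -exprS -exprD; congr (_ ^+ _); nat_lia R.
  by rewrite exprD; field.
rewrite sumr_const card_ord -mulrnAr -mulrDr mulrA -exprD.
have -> : (2 * k).+2 = (2 * k.+1)%N by nat_lia R.
have -> : (2 + 2 * k = 2 * k.+1)%N by nat_lia R.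
rewrite u_even [X in _ <= X]mulrCA ler_wpM2l ?exprn_ge0 ?(ltW theta_gt0) //.
rewrite mulrDl mul1r lerD2l.
have kK : (k.+1 <= K)%N by nat_lia R.
have h1 : 4 ^+ k.+1 <= K.+1%:R ^+ 2 * catalan R k.+1.
  apply: le_trans (catalan_ge R k.+1) _; rewrite ler_pM2r ?catalan_gt0 //.
  by rewrite ler_pXn2r ?nnegrE ?ler0n // ler_nat.
have h2 : beta * (4 ^+ k / 4) <= catalan R k.+1.
  apply: le_trans (_ : beta * 4 ^+ k.+1 <= _).
    rewrite ler_pM2l // exprS ler_pdivrMr ?ltr0n //.
    by have h : 0 <= (4 : R) ^+ k := exprn_ge0 k (ler0n R 4); lra.
  apply: le_trans (ler_wpM2l (ltW beta_gt0) h1) _.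
  by rewrite mulrA betaK mul1r.
have h3 : beta * k%:R <= (K.+1%:R)^-1.
  have -> : (K.+1%:R)^-1 = beta * K.+1%:R by rewrite /beta; field; rewrite nat1r lt0r_neq0.
  by rewrite ler_pM2l // ler_nat; nat_lia R.
rewrite -mulr_natr (_ : _ * k%:R = (beta * k%:R) * (beta * (4 ^+ k / 4))); last by ring.
by apply: ler_pM => //; rewrite !mulr_ge0 ?(ltW beta_gt0) ?invr_ge0 ?exprn_ge0 ?ler0n.
Qed.

Let eta_ge0 : 0 <= eta. Proof. exact: le_trans e_le. Qed.

Let prod_ge0 F : 0 <= \prod_(q <- F) u q.
Proof. by apply: prodr_ge0 => q _. Qed.

(** Induction on the total index plus the number of factors: the recursion lowers the index sum by
    two and adds at most one factor, while [V_0] removes a factor. *)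
Let V_le F : (sumn F <= 2 * K)%N -> V F <= \prod_(q <- F) u q.
Proof.
move: {2}(sumn F + size F).+1 (ltnSn (sumn F + size F)) => B.
elim: B F => // B IH [|[|m] F] hB hK; first by rewrite V_nil big_nil.
  rewrite V_0 big_cons {1}/u /= expr0 !mul1r; apply: IH => //.
  by move: hB => /=; rewrite add0n; nat_lia R.
move: hB hK => /= hB hK; rewrite big_cons.
set P := \prod_(q <- F) u q; have P0 : 0 <= P by exact: prod_ge0.
have remP (q : nat) : q \in F -> P = u q * \prod_(r <- rem q F) u r.
  by move=> qF; rewrite /P (big_rem q).
have rems (q : nat) : q \in F -> (sumn F = q + sumn (rem q F))%N.
  by move=> qF; rewrite (perm_sumn (perm_to_rem qF)).
have remz (q : nat) : q \in F -> size F = (size (rem q F)).+1.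
  by move=> qF; rewrite (perm_size (perm_to_rem qF)).
apply: le_trans (V_rec m F) _.
have t2 : 0 < theta ^+ 2 by rewrite exprn_gt0.
rewrite -(ler_pM2l t2) mulrDr.
have A1 : theta ^+ 2 * \sum_(a < m) ((1 + D) * V [:: a : nat, (m - a.+1)%N & F] +
    e * V (m.-1 :: F)) <=
   ((1 + eta) * (1 + (K.+1%:R)^-1) + 2 * K%:R * eta) * (u m.+1 * P).
  apply: (@le_trans _ _ (theta ^+ 2 * \sum_(a < m)
     ((1 + eta) * (u a * u (m - a.+1)%N * P) + eta * (u m.-1 * P)))).
    rewrite ler_pM2l //; apply: ler_sum => a _; have am := ltn_ord a; apply: lerD.
      have h : V [:: a : nat, (m - a.+1)%N & F] <= u a * u (m - a.+1)%N * P.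
        rewrite -mulrA -[P]/(\prod_(q <- F) u q) -!(big_cons _ _ _ _ xpredT).
        by apply: IH => /=; nat_lia R.
      apply: le_trans (ler_wpM2l _ h) _; first by rewrite addr_ge0.
      by rewrite ler_wpM2r ?mulr_ge0 // lerD2l.
    have h : V (m.-1 :: F) <= u m.-1 * P.
      rewrite -[P]/(\prod_(q <- F) u q) -(big_cons _ _ _ _ xpredT).
      by apply: IH => /=; nat_lia R.
    apply: le_trans (ler_wpM2l e_ge0 h) _.
    by rewrite ler_wpM2r ?mulr_ge0.
  rewrite big_split /= -mulr_sumr -mulr_suml sumr_const card_ord mulrDr [X in _ <= X]mulrDl.
  apply: lerD.
    rewrite mulrCA -mulrA ler_wpM2l ?addr_ge0 // mulrA mulrA ler_wpM2r //.
    by apply: u_conv; nat_lia R.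
  case: m hK {hB IH} => [|m] hK.
    have h : 0 <= eta * (u 1 * P) by rewrite mulr_ge0 // mulr_ge0.
    by rewrite mulr0n mulr0 -mulrA mulr_ge0 // mulr_ge0 ?ler0n.
  rewrite [_.-1]/= (_ : theta ^+ 2 * _ = (m.+1%:R * eta) * (theta ^+ 2 * u m) * P); last first.
    by rewrite -[X in _ * X]mulr_natl; ring.
  rewrite [X in _ <= X]mulrA ler_wpM2r //.
  have := u_mono m; have : m.+1%:R <= 2 * K%:R :> R by rewrite -natrM ler_nat; nat_lia R.
  move=> h1 h2.
  by apply: ler_pM => //; rewrite ?mulr_ge0 ?exprn_ge0 ?(ltW theta_gt0) // ler_wpM2r.
(* Each of the three terms, for each of the [q] choices of [x], is at most the geometric value at
   $m+q-1$ times the untouched factors; the [q] add up to at most $2K$. *)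
have A2 : theta ^+ 2 * \sum_(q <- F) \sum_(x < q)
    (e * (V [:: (m + x)%N, (q - x.+1)%N & rem q F] +
          V [:: (m + (q - x.+1))%N, x : nat & rem q F]) +
     D * V [:: m, x : nat, (q - x.+1)%N & rem q F]) <=
   6 * K%:R * K.+1%:R ^+ 4 * eta * (u m.+1 * P).
  pose w := 2 * theta.
  have w0 : 0 < w by rewrite mulr_gt0.
  have q_bound (q : nat) : q \in F -> \sum_(x < q)
    (e * (V [:: (m + x)%N, (q - x.+1)%N & rem q F] +
          V [:: (m + (q - x.+1))%N, x : nat & rem q F]) +
     D * V [:: m, x : nat, (q - x.+1)%N & rem q F]) <=
     q%:R * (3 * eta * (w ^+ (m + q.-1) * \prod_(r <- rem q F) u r)).
    move=> qF; have := rems _ qF; have := remz _ qF => s1 s2.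
    set Pq := \prod_(r <- _) u r; have Pq0 : 0 <= Pq by exact: prod_ge0.
    rewrite mulr_natl -[X in _ *+ X]card_ord -sumr_const; apply: ler_sum => x _.
    have xq := ltn_ord x.
    have q0 : (0 < q)%N by exact: leq_ltn_trans xq.
    have rem_bounds b j : (b.+1 = m + q)%N -> (j <= 3)%N ->
        (b + sumn (rem q F) <= 2 * K)%N /\ (b + sumn (rem q F) + (size (rem q F) + j) < B)%N.
      move: hB hK s1 s2 q0; clear; move: (sumn (rem q F)) (size (rem q F)).
      by move: (sumn F) (size F) => A1 A2 A3 A4; lia.
    have V2 a b : (a + b = m + q.-1)%N -> V [:: a, b & rem q F] <= w ^+ (m + q.-1) * Pq.
      move=> ab; apply: le_trans (_ : u a * (u b * Pq) <= _).
        have [|//|h1 h2] := @rem_bounds (a + b)%N 2; first by move: ab q0; clear; lia.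
        by rewrite /Pq -!(big_cons _ _ _ _ xpredT); apply: IH => /=; move: h1 h2; rewrite ?addnS ?addn0 ?addnA.
      rewrite mulrA ler_wpM2r // -ab exprD ler_pM //; exact: u_le.
    have V3 a b c : (a + b + c = m + q.-1)%N ->
        V [:: a, b, c & rem q F] <= w ^+ (m + q.-1) * Pq.
      move=> ab; apply: le_trans (_ : u a * (u b * (u c * Pq)) <= _).
        have [|//|h1 h2] := @rem_bounds (a + b + c)%N 3; first by move: ab q0; clear; lia.
        by rewrite /Pq -!(big_cons _ _ _ _ xpredT); apply: IH => /=; move: h1 h2; rewrite ?addnS ?addn0 ?addnA.
      rewrite !mulrA ler_wpM2r // -ab !exprD.
      by apply: ler_pM; rewrite ?u_le ?mulr_ge0 //; apply: ler_pM; rewrite ?u_le.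
    set Z := w ^+ _ * Pq in V2 V3 *.
    have Z0 : 0 <= Z by rewrite mulr_ge0 ?exprn_ge0 ?(ltW w0).
    have h1 := V2 (m + x)%N (q - x.+1)%N ltac:(nat_lia R).
    have h2 := V2 (m + (q - x.+1))%N x ltac:(nat_lia R).
    have h3 := V3 m x (q - x.+1)%N ltac:(nat_lia R).
    have -> : 3 * eta * Z = eta * (Z + Z) + eta * Z by ring.
    apply: lerD.
      by apply: le_trans (ler_wpM2l e_ge0 (lerD h1 h2)) _; rewrite ler_wpM2r // addr_ge0.
    by apply: le_trans (ler_wpM2l D_ge0 h3) _; rewrite ler_wpM2r.
  apply: (@le_trans _ _ (theta ^+ 2 * \sum_(q <- F)
     q%:R * (3 * K.+1%:R ^+ 4 * eta * (theta ^+ 2)^-1 * (u m.+1 * P)))).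
    rewrite ler_pM2l // !big_seq; apply: ler_sum => q qF.
    apply: le_trans (q_bound q qF) _.
    have s2 := rems _ qF.
    case: q {q_bound} qF s2 => [|q] qF s2; first by rewrite !mul0r.
    rewrite ler_wpM2l // (remP _ qF) /=; set Pq := \prod_(r <- _) u r.
    have Pq0 : 0 <= Pq by exact: prod_ge0.
    rewrite !mulrA ler_wpM2r //.
    have h1 := @u_large m.+1 ltac:(nat_lia R); have h2 := @u_large q.+1 ltac:(nat_lia R).
    (* The exponents are shifted to the indices of [u m.+1] and of the factor removed from [P]; the
       difference $w^2=4\theta^2$ cancels the [theta ^+ 2] in front. *)
    have w2 : w ^+ (m + q) = (4 * theta ^+ 2)^-1 * (w ^+ m.+1 * w ^+ q.+1).
      by rewrite !exprS exprD /w; field; rewrite lt0r_neq0.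
    rewrite w2.
    have h3 : w ^+ m.+1 * w ^+ q.+1 <=
        2 * K.+1%:R ^+ 2 * u m.+1 * (2 * K.+1%:R ^+ 2 * u q.+1).
      by apply: ler_pM => //; rewrite exprn_ge0 ?(ltW w0).
    have h4 : 0 <= 3 * eta * (4 * theta ^+ 2)^-1.
      by rewrite !mulr_ge0 ?invr_ge0 ?mulr_ge0 ?exprn_ge0 ?(ltW theta_gt0).
    rewrite mulrA; apply: le_trans (ler_wpM2l h4 h3) _.
    rewrite le_eqVlt; apply/orP; left; apply/eqP; field.
    by rewrite lt0r_neq0.
  rewrite -mulr_suml mulrCA.
  have -> : theta ^+ 2 * (3 * K.+1%:R ^+ 4 * eta * (theta ^+ 2)^-1 * (u m.+1 * P)) =
     3 * K.+1%:R ^+ 4 * eta * (u m.+1 * P).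
    by field; rewrite lt0r_neq0.
  have -> : 6 * K%:R * K.+1%:R ^+ 4 * eta * (u m.+1 * P) =
    (2 * K%:R) * (3 * K.+1%:R ^+ 4 * eta * (u m.+1 * P)) by ring.
  rewrite ler_wpM2r ?mulr_ge0 ?exprn_ge0 //.
  by rewrite -natr_sum -sumnE -natrM ler_nat; nat_lia R.
apply: le_trans (lerD A1 A2) _; rewrite -mulrDl ler_wpM2r ?mulr_ge0 //.
Qed.

Lemma moment_bound F : (sumn F <= 2 * K)%N -> V F <= (2 * theta) ^+ sumn F.
Proof.
move=> hF; apply: le_trans (V_le hF) _.
elim: F {hF} => [|q F IH]; first by rewrite big_nil expr0.
rewrite big_cons /= exprD ler_pM //; exact: u_le.
Qed.

End MomentBound.
End Catalan.

Module WignerMoments.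
Import mpoly WickFunctional Catalan.

(** * Polynomials in the matrix entries: powers, total sums and traces *)

Section Wigner.
Variables (R : realFieldType) (n N : nat) (ix : 'I_n -> 'I_n -> 'I_N).
Hypothesis n_gt0 : (0 < n)%N.
Hypothesis ix_sym : forall i j, ix i j = ix j i.
Hypothesis ix_inj : forall i j k l,
  ix i j = ix k l -> (i = k /\ j = l) \/ (i = l /\ j = k).
Local Notation poly := {mpoly R[N]}.

(** Generic symmetric matrix: [ix i j] is the coordinate shared by the positions $(i,j)$ and
    $(j,i)$. The factor $n^{-1/2}$ sits in the covariance, so no power of [n] accompanies [mpow]. *)
Definition wigner_mx : 'M[poly]_n := \matrix_(i, j) 'X_(ix i j).
Definition mpow m i j : poly := (wigner_mx ^+ m) i j.
Definition row_sum m j : poly := \sum_i mpow m i j.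
Definition invn : poly := (n%:R^-1)%:MP.
Definition sigma m : poly := invn * \sum_j row_sum m j.
Definition tau m : poly := invn * \sum_i mpow m i i.

Lemma mpow0 i j : mpow 0 i j = (i == j)%:R.
Proof. by rewrite /mpow expr0 mxE. Qed.

Lemma mpowS m i j : mpow m.+1 i j = \sum_k 'X_(ix i k) * mpow m k j.
Proof. by rewrite /mpow exprS mxE; apply: eq_bigr => k _; rewrite mxE. Qed.

Lemma mpowD a b i j : mpow (a + b) i j = \sum_k mpow a i k * mpow b k j.
Proof. by rewrite /mpow exprD mxE. Qed.

Lemma mpow_sym m i j : mpow m i j = mpow m j i.
Proof.
have symM : wigner_mx^T = wigner_mx by apply/matrixP => k l; rewrite !mxE ix_sym.
rewrite /mpow -[in RHS]symM; elim: m i j => [|m IH] i j.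
  by rewrite !expr0 !mxE eq_sym.
rewrite exprS exprSr !mxE; apply: eq_bigr => k _.
by rewrite IH mulrC; congr (_ * _); rewrite [RHS]mxE.
Qed.

Lemma row_sumE m j : row_sum m j = \sum_i mpow m j i.
Proof. by apply: eq_bigr => i _; rewrite mpow_sym. Qed.

Lemma row_sum_dot a b : \sum_j row_sum a j * row_sum b j = \sum_j row_sum (a + b) j.
Proof.
rewrite [RHS](eq_bigr (fun j => \sum_i \sum_k mpow a i k * mpow b k j)); last first.
  by move=> j _; apply: eq_bigr => i _; rewrite mpowD.
rewrite exchange_big; under [RHS]eq_bigr do rewrite exchange_big /=.
rewrite [RHS]exchange_big; apply: eq_bigr => k _; rewrite (row_sumE b) mulr_suml.
by apply: eq_bigr => i _; rewrite mulr_sumr.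
Qed.

Lemma mpow_dot a b : \sum_i \sum_j mpow a i j * mpow b i j = \sum_i mpow (a + b) i i.
Proof.
apply: eq_bigr => i _; rewrite mpowD; apply: eq_bigr => j _.
by rewrite (mpow_sym b).
Qed.

Lemma invnK : n%:R * invn = 1.
Proof.
by rewrite /invn -[n%:R]mpolyC_nat -mpolyCM mulfV ?mpolyC1 // pnatr_eq0 -lt0n.
Qed.

Lemma sigma0 : sigma 0 = 1.
Proof.
rewrite /sigma (eq_bigr (fun=> 1)); last first.
  move=> j _; rewrite row_sumE (bigD1 j) //= mpow0 eqxx big1 ?addr0 // => i ij.
  by rewrite mpow0 eq_sym (negbTE ij).
by rewrite sumr_const card_ord mulrC invnK.
Qed.

Lemma tau0 : tau 0 = 1.
Proof.
rewrite /tau (eq_bigr (fun=> 1)); last by move=> j _; rewrite mpow0 eqxx.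
by rewrite sumr_const card_ord mulrC invnK.
Qed.

Lemma nneg_mpow m i j : nneg (mpow m i j).
Proof.
elim: m i j => [|m IH] i j; first by rewrite mpow0; case: eqP; [move=> _; exact: nneg1|move=> _; exact: nneg0].
by rewrite mpowS; apply: nneg_sum => k _; apply: nnegM => //; exact: nnegX.
Qed.

Lemma nneg_row_sum m j : nneg (row_sum m j).
Proof. by apply: nneg_sum => i _; exact: nneg_mpow. Qed.

Lemma nneg_invn : nneg invn.
Proof. by move=> m; rewrite mcoeffC mulr_ge0 ?ler0n ?invr_ge0. Qed.

Lemma nneg_sigma m : nneg (sigma m).
Proof. by apply: nnegM; [exact: nneg_invn|apply: nneg_sum => j _; exact: nneg_row_sum]. Qed.

Lemma nneg_tau m : nneg (tau m).
Proof. by apply: nnegM; [exact: nneg_invn|apply: nneg_sum => j _; exact: nneg_mpow]. Qed.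

(** Only off-diagonal entries of the power remain, and their coefficients are nonnegative; this
    trades traces for the family closed under the recursion. *)
Lemma nneg_sigma_tau m : nneg (sigma m - tau m).
Proof.
rewrite /sigma /tau -mulrBr -sumrB; apply: nnegM; first exact: nneg_invn.
apply: nneg_sum => j _; rewrite /row_sum (bigD1 j) //= addrAC subrr add0r.
by apply: nneg_sum => i _; exact: nneg_mpow.
Qed.

(** [H k l] is the derivative in position $(k,l)$ as if all positions were independent; a coordinate
    collects the contributions of its one or two positions. *)
Definition grad_of (G : poly) (H : 'I_n -> 'I_n -> poly) :=
  forall q, G^`M(q) = \sum_k \sum_l (q == ix k l)%:R * H k l.

Lemma grad_ofM G G' H H' : grad_of G H -> grad_of G' H' ->
  grad_of (G * G') (fun k l => H k l * G' + G * H' k l).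
Proof.
move=> dG dG' q; rewrite mderivM dG dG' mulr_suml mulr_sumr -big_split /=.
apply: eq_bigr => k _; rewrite mulr_suml mulr_sumr -big_split /=.
by apply: eq_bigr => l _; ring.
Qed.

Lemma grad_ofC c G H : grad_of G H -> grad_of (c%:MP * G) (fun k l => c%:MP * H k l).
Proof.
move=> dG q; rewrite mderiv_mulC dG mulr_sumr; apply: eq_bigr => k _.
by rewrite mulr_sumr; apply: eq_bigr => l _; rewrite mulrCA.
Qed.

Lemma grad_of_sum I (r : seq I) G H : (forall i, grad_of (G i) (H i)) ->
  grad_of (\sum_(i <- r) G i) (fun k l => \sum_(i <- r) H i k l).
Proof.
move=> dG q; rewrite raddf_sum /=; under eq_bigr do rewrite dG.
rewrite exchange_big; apply: eq_bigr => k _; rewrite exchange_big; apply: eq_bigr => l _.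
by rewrite mulr_sumr.
Qed.

Lemma grad_of1 : grad_of 1 (fun _ _ => 0).
Proof.
move=> q; rewrite -mpolyC1 mderivC big1 // => k _.
by rewrite big1 // => l _; rewrite mulr0.
Qed.

(** Leibniz rule for a matrix power: the differentiated factor has [a] factors on its left and
    [m - a.+1] on its right. *)
Lemma grad_mpow m i j :
  grad_of (mpow m i j) (fun k l => \sum_(a < m) mpow a i k * mpow (m - a.+1) l j).
Proof.
elim: m i j => [|m IH] i j q.
  have -> : mpow 0 i j = ((i == j)%:R)%:MP by rewrite mpow0 mpolyC_nat.
  rewrite mderivC big1 // => k _.
  by rewrite big1 // => l _; rewrite big_ord0 mulr0.
rewrite mpowS raddf_sum /=.
under eq_bigr do rewrite mderivM mderivXU IH.
rewrite big_split /=.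
under [RHS]eq_bigr => k _.
  under eq_bigr => l _ do rewrite big_ord_recl mulrDr mpow0 subSS subn0.
  rewrite big_split /=; over.
rewrite big_split /=; congr (_ + _).
  rewrite [RHS](bigD1 i) //= [X in _ = _ + X]big1 ?addr0; last first.
    by move=> k ki; rewrite big1 // => l _; rewrite [i == k]eq_sym (negbTE ki) mul0r mulr0.
  by apply: eq_bigr => l _; rewrite eqxx mul1r eq_sym.
under eq_bigr do rewrite mulr_sumr.
rewrite exchange_big; apply: eq_bigr => k _.
under eq_bigr do rewrite mulr_sumr.
rewrite exchange_big; apply: eq_bigr => l _.
rewrite (eq_bigr (fun k' => (q == ix k l)%:R * \sum_(a < m)
   'X_(ix i k') * mpow a k' k * mpow (m - a.+1) l j)).
  rewrite -mulr_sumr exchange_big; congr (_ * _); apply: eq_bigr => a _.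
  by rewrite -mulr_suml -mpowS.
by move=> k' _; rewrite mulrCA mulr_sumr; congr (_ * _); apply: eq_bigr => a _; rewrite mulrA.
Qed.

Lemma grad_row_sum m j : grad_of (row_sum m j)
  (fun k l => \sum_(a < m) mpow a j k * row_sum (m - a.+1) l).
Proof.
have := grad_of_sum (index_enum 'I_n) (grad_mpow m j); rewrite -row_sumE => h q.
rewrite h; apply: eq_bigr => k _; apply: eq_bigr => l _; congr (_ * _).
rewrite exchange_big; apply: eq_bigr => a _.
by rewrite row_sumE mulr_sumr.
Qed.

Lemma grad_sigma m : grad_of (sigma m)
  (fun k l => invn * \sum_(a < m) row_sum a k * row_sum (m - a.+1) l).
Proof.
have := grad_ofC n%:R^-1 (grad_of_sum (index_enum 'I_n) (grad_row_sum m)) => h q.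
rewrite /sigma h; apply: eq_bigr => k _; apply: eq_bigr => l _; congr (_ * (_ * _)).
by rewrite exchange_big; apply: eq_bigr => a _; rewrite -mulr_suml.
Qed.

(** Cyclicity of the trace makes the [m] terms of the Leibniz rule equal. *)
Lemma grad_tau m : grad_of (tau m) (fun k l => invn * (m%:R * mpow m.-1 k l)).
Proof.
have := grad_ofC n%:R^-1 (grad_of_sum (index_enum 'I_n) (fun i => grad_mpow m i i)) => h q.
rewrite /tau h; apply: eq_bigr => k _; apply: eq_bigr => l _; congr (_ * (_ * _)).
rewrite exchange_big /= mulr_natl -[X in _ *+ X]card_ord -sumr_const.
apply: eq_bigr => a _; rewrite (_ : m.-1 = (m - a.+1) + a)%N; last first.
  by have := ltn_ord a; lia.
rewrite mpow_sym mpowD; apply: eq_bigr => i _; exact: mulrC.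
Qed.

Lemma grad_sigma_prod F : grad_of (\prod_(q <- F) sigma q)
  (fun k l => \sum_(q <- F) invn * (\sum_(x < q) row_sum x k * row_sum (q - x.+1) l) *
     \prod_(r <- rem q F) sigma r).
Proof.
elim: F => [|q0 F IH] q.
  rewrite big_nil grad_of1; apply: eq_bigr => k _; apply: eq_bigr => l _.
  by rewrite big_nil.
rewrite big_cons (grad_ofM (grad_sigma q0) IH).
apply: eq_bigr => k _; apply: eq_bigr => l _; congr (_ * _).
rewrite big_cons /= eqxx; congr (_ + _); rewrite !big_seq mulr_sumr.
apply: eq_bigr => r rF; rewrite mulrCA; congr (_ * _).
(* [rem] deletes one occurrence only: if the head equals the differentiated factor, the whole tail
   is left. *)
case: eqP => [->|_]; first by rewrite (big_rem _ rF).
by rewrite big_cons.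
Qed.

Lemma wick_ibp_grad K G H i j : (forall p q, K p q = K q p) -> grad_of G H ->
  wick K ('X_(ix i j) * G) = \sum_k \sum_l K (ix i j) (ix k l) * wick K (H k l).
Proof.
move=> Ksym dG; rewrite wick_ibp //.
under eq_bigr => q _.
  rewrite dG wick_sum mulr_sumr; under eq_bigr do rewrite wick_sum mulr_sumr.
  over.
rewrite exchange_big; apply: eq_bigr => k _.
rewrite exchange_big; apply: eq_bigr => l _.
rewrite (bigD1 (ix k l)) //= eqxx mul1r big1 ?addr0 // => q qkl.
by rewrite (negbTE qkl) mul0r raddf0 mulr0.
Qed.

(** * Moment recursion under the dominating kernel *)

Variable delta : R.
Hypothesis delta_ge0 : 0 <= delta.

Definition kernel (p q : 'I_N) : R := n%:R^-1 * ((p == q)%:R + delta).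
Local Notation L := (wick kernel).
Local Notation D := (n%:R * delta).

Let n0 : 0 < n%:R :> R. Proof. by rewrite ltr0n. Qed.

Let in0 : 0 <= n%:R^-1 :> R. Proof. by rewrite invr_ge0 ltW. Qed.

Lemma kernel_sym p q : kernel p q = kernel q p.
Proof. by rewrite /kernel eq_sym. Qed.

Lemma kernel_ge0 p q : 0 <= kernel p q.
Proof. by rewrite mulr_ge0 ?addr_ge0 ?ler0n. Qed.

(** Distinct positions with equal coordinates are transposes of each other; a diagonal position is
    counted twice on the right, whence an inequality. *)
Lemma ix_eq_sum_le i j (h : 'I_n -> 'I_n -> R) : (forall k l, 0 <= h k l) ->
  \sum_k \sum_l (ix i j == ix k l)%:R * h k l <= h i j + h j i.
Proof.
move=> h0.
have e a b : h a b = \sum_k \sum_l ((k == a) && (l == b))%:R * h k l.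
  rewrite (bigD1 a) //= (bigD1 b) //= !eqxx mul1r !big1 ?addr0 //.
    by move=> k ka; rewrite big1 // => l _; rewrite (negbTE ka) mul0r.
  by move=> l lb; rewrite (negbTE lb) mul0r.
rewrite (e i j) (e j i) -big_split; apply: ler_sum => k _ /=.
rewrite -big_split; apply: ler_sum => l _ /=; rewrite -mulrDl ler_wpM2r // -natrD ler_nat.
case: (ix i j =P ix k l) => // /ix_inj [] [-> ->]; rewrite !eqxx //=.
by rewrite addn1.
Qed.

(** The diagonal part of the kernel leaves a straight and a crossed contraction; the constant
    [delta] leaves a free sum over all positions. *)
Lemma kernel_sum_le i j (h : 'I_n -> 'I_n -> R) : (forall k l, 0 <= h k l) ->
  \sum_k \sum_l kernel (ix i j) (ix k l) * h k l <=
  n%:R^-1 * (h i j + h j i + delta * \sum_k \sum_l h k l).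
Proof.
move=> h0; rewrite (eq_bigr (fun k => n%:R^-1 * (\sum_l (ix i j == ix k l)%:R * h k l +
   delta * \sum_l h k l))); last first.
  move=> k _; rewrite mulr_sumr -big_split mulr_sumr /=; apply: eq_bigr => l _.
  by rewrite /kernel; ring.
rewrite -mulr_sumr ler_wpM2l // big_split /= -mulr_sumr lerD2r; exact: ix_eq_sum_le.
Qed.

Let L_ge0 p : nneg p -> 0 <= L p. Proof. exact: wick_ge0 kernel_ge0. Qed.

Let L_invn p : L (invn * p) = n%:R^-1 * L p.
Proof. by rewrite mul_mpolyC wickZ. Qed.

Let L_le p q : nneg (q - p) -> L p <= L q. Proof. exact: wick_le kernel_ge0. Qed.

Let pull_sum (c p r : poly) q (f : 'I_q -> poly) :
  c * (p * (\sum_x f x) * r) = \sum_x c * (p * f x * r).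
Proof. by rewrite mulr_sumr mulr_suml mulr_sumr. Qed.

(** One entry is taken out of [sigma m.+1] and integrated by parts. The resulting contractions are
    sorted by how they reconnect the chains of matrix factors: [I1], [I2] and [I3]. *)
Lemma wick_sigma_rec m F : L (\prod_(q <- m.+1 :: F) sigma q) <=
  \sum_(a < m) ((1 + D) * L (\prod_(q <- [:: a : nat, (m - a.+1)%N & F]) sigma q) +
    n%:R^-1 * L (\prod_(q <- m.-1 :: F) sigma q)) +
  \sum_(q <- F) \sum_(x < q)
    (n%:R^-1 * (L (\prod_(r <- [:: (m + x)%N, (q - x.+1)%N & rem q F]) sigma r) +
          L (\prod_(r <- [:: (m + (q - x.+1))%N, x : nat & rem q F]) sigma r)) +
     D * L (\prod_(r <- [:: m, x : nat, (q - x.+1)%N & rem q F]) sigma r)).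
Proof.
set PF := \prod_(q <- F) sigma q.
pose HF k l := \sum_(q <- F) invn * (\sum_(x < q) row_sum x k * row_sum (q - x.+1) l) *
     \prod_(r <- rem q F) sigma r.
pose H j k l := (\sum_(a < m) mpow a j k * row_sum (m - a.+1) l) * PF + row_sum m j * HF k l.
have nPF s : nneg (\prod_(q <- s) sigma q) by apply: nneg_prod => q _; exact: nneg_sigma.
have nPF0 : nneg PF by exact: nPF.
have nHF k l : nneg (HF k l).
  apply: nneg_sum => q _; apply: nnegM => //; apply: nnegM; first exact: nneg_invn.
  by apply: nneg_sum => x _; apply: nnegM; exact: nneg_row_sum.
have nH j k l : nneg (H j k l).
  apply: nnegD; apply: nnegM => //; last exact: nneg_row_sum.
  by apply: nneg_sum => a _; apply: nnegM; [exact: nneg_mpow|exact: nneg_row_sum].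
have dH : forall j, grad_of (row_sum m j * PF) (H j).
  by move=> j0; apply: grad_ofM; [exact: grad_row_sum|exact: grad_sigma_prod].
have e0 : L (\prod_(q <- m.+1 :: F) sigma q) =
    n%:R^-1 * \sum_i \sum_j L ('X_(ix i j) * (row_sum m j * PF)).
  rewrite big_cons -/PF /sigma -mulrA L_invn mulr_suml wick_sum; congr (_ * _).
  apply: eq_bigr => i _; rewrite -wick_sum row_sumE; congr (L _).
  under [in LHS]eq_bigr do rewrite mpowS.
  rewrite exchange_big mulr_suml /=; apply: eq_bigr => j _.
  by rewrite -mulr_sumr -row_sumE mulrA.
rewrite e0.
apply: (@le_trans _ _ (n%:R^-1 * \sum_i \sum_j n%:R^-1 *
   (L (H j i j) + L (H j j i) + delta * \sum_k \sum_l L (H j k l)))).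
  rewrite ler_wpM2l //; apply: ler_sum => i _; apply: ler_sum => j _.
  rewrite (wick_ibp_grad _ _ kernel_sym (dH j)); apply: kernel_sum_le => k l.
  exact: L_ge0.
(* Straight contraction: two pieces are glued into one chain, and the summation lost this way leaves
   a factor $1/n$. *)
have I1 : invn * (invn * \sum_j \sum_i H j i j) = \sum_(a < m) invn * (sigma m.-1 * PF) +
   \sum_(q <- F) \sum_(x < q)
     invn * \prod_(r <- [:: (m + (q - x.+1))%N, x : nat & rem q F]) sigma r.
  rewrite (eq_bigr (fun j => (\sum_(a < m) row_sum a j * row_sum (m - a.+1) j) * PF +
     \sum_(q <- F) \sum_(x < q) invn * ((row_sum m j * row_sum (q - x.+1) j) *
       (\sum_i row_sum x i)) * \prod_(r <- rem q F) sigma r)); last first.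
    move=> j _; rewrite big_split -mulr_suml exchange_big /=; congr (_ * _ + _).
      by apply: eq_bigr => a _; rewrite -mulr_suml -row_sumE.
    rewrite -mulr_sumr /HF exchange_big /= mulr_sumr; apply: eq_bigr => q _.
    rewrite -mulr_suml -mulr_sumr exchange_big /= pull_sum.
    by apply: eq_bigr => x _; rewrite -mulr_suml; ring.
  rewrite big_split !mulrDr /=; congr (_ + _).
    rewrite -mulr_suml exchange_big /= mulr_suml !mulr_sumr; apply: eq_bigr => a _.
    rewrite row_sum_dot /sigma; have -> : (a + (m - a.+1) = m.-1)%N by have := ltn_ord a; lia.
    by ring.
  rewrite exchange_big !mulr_sumr; apply: eq_bigr => q _.
  rewrite exchange_big !mulr_sumr; apply: eq_bigr => x _.
  by rewrite -mulr_suml -mulr_sumr -mulr_suml row_sum_dot !big_cons /sigma; ring.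
(* Crossed contraction: within [sigma m.+1] a piece closes into a loop, the trace [tau a]. This is
   the leading term, without a factor $1/n$. *)
have I2 : invn * (invn * \sum_j \sum_i H j j i) =
   \sum_(a < m) tau a * (sigma (m - a.+1) * PF) +
   \sum_(q <- F) \sum_(x < q)
     invn * \prod_(r <- [:: (m + x)%N, (q - x.+1)%N & rem q F]) sigma r.
  rewrite (eq_bigr (fun j => (\sum_(a < m) mpow a j j * (\sum_i row_sum (m - a.+1) i)) * PF +
     \sum_(q <- F) \sum_(x < q) invn * ((row_sum m j * row_sum x j) *
       (\sum_i row_sum (q - x.+1) i)) * \prod_(r <- rem q F) sigma r)); last first.
    move=> j _; rewrite big_split -mulr_suml exchange_big /=; congr (_ * _ + _).
      by apply: eq_bigr => a _; rewrite -mulr_sumr.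
    rewrite -mulr_sumr /HF exchange_big /= mulr_sumr; apply: eq_bigr => q _.
    rewrite -mulr_suml -mulr_sumr exchange_big /= pull_sum.
    by apply: eq_bigr => x _; rewrite -mulr_sumr; ring.
  rewrite big_split !mulrDr /=; congr (_ + _).
    rewrite -mulr_suml exchange_big /= mulr_suml !mulr_sumr; apply: eq_bigr => a _.
    by rewrite -mulr_suml /sigma /tau; ring.
  rewrite exchange_big !mulr_sumr; apply: eq_bigr => q _.
  rewrite exchange_big !mulr_sumr; apply: eq_bigr => x _.
  by rewrite -mulr_suml -mulr_sumr -mulr_suml row_sum_dot !big_cons /sigma; ring.
(* Free summation: all pieces become chains summed independently, with total weight $n\delta$. *)
have I3 : invn * (invn * \sum_j \sum_k \sum_l H j k l) =
   \sum_(a < m) sigma a * (sigma (m - a.+1) * PF) +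
   \sum_(q <- F) \sum_(x < q)
     \prod_(r <- [:: m, x : nat, (q - x.+1)%N & rem q F]) sigma r.
  rewrite (eq_bigr (fun j => (\sum_(a < m) row_sum a j * (\sum_i row_sum (m - a.+1) i)) * PF +
     \sum_(q <- F) \sum_(x < q) invn * ((row_sum m j * \sum_i row_sum x i) *
       (\sum_i row_sum (q - x.+1) i)) * \prod_(r <- rem q F) sigma r)); last first.
    move=> j _; transitivity ((\sum_k \sum_l \sum_(a < m) mpow a j k * row_sum (m - a.+1) l) * PF +
        row_sum m j * (\sum_k \sum_l HF k l)).
      rewrite mulr_suml mulr_sumr -big_split; apply: eq_bigr => k _.
      by rewrite mulr_suml mulr_sumr -big_split.
    congr (_ * _ + _).
      under eq_bigr do rewrite exchange_big /=.
      rewrite exchange_big; apply: eq_bigr => a _; rewrite row_sumE mulr_suml.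
      by apply: eq_bigr => i _; rewrite mulr_sumr.
    rewrite /HF; under eq_bigr do rewrite exchange_big /=.
    rewrite exchange_big /= mulr_sumr; apply: eq_bigr => q _.
    rewrite (eq_bigr (fun k => invn * (\sum_(x < q) row_sum x k * \sum_l row_sum (q - x.+1) l) *
       \prod_(r <- rem q F) sigma r)); last first.
      move=> k _; rewrite -mulr_suml -mulr_sumr exchange_big; congr (_ * _ * _).
      by apply: eq_bigr => x _; rewrite mulr_sumr.
    rewrite -mulr_suml -mulr_sumr exchange_big pull_sum; apply: eq_bigr => x _.
    by rewrite -mulr_suml; ring.
  rewrite big_split !mulrDr /=; congr (_ + _).
    rewrite -mulr_suml exchange_big /= mulr_suml !mulr_sumr; apply: eq_bigr => a _.
    by rewrite -mulr_suml /sigma; ring.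
  rewrite exchange_big !mulr_sumr; apply: eq_bigr => q _.
  rewrite exchange_big !mulr_sumr; apply: eq_bigr => x _.
  by rewrite -mulr_suml -mulr_sumr -!mulr_suml !big_cons /sigma; ring.
have -> : n%:R^-1 * (\sum_i \sum_j n%:R^-1 *
   (L (H j i j) + L (H j j i) + delta * \sum_k \sum_l L (H j k l))) =
   L (invn * (invn * \sum_j \sum_i H j i j)) + L (invn * (invn * \sum_j \sum_i H j j i)) +
   D * L (invn * (invn * \sum_j \sum_k \sum_l H j k l)).
  have e3 : L (\sum_j \sum_k \sum_l H j k l) = \sum_j \sum_k \sum_l L (H j k l).
    rewrite wick_sum; apply: eq_bigr => j _; rewrite wick_sum; apply: eq_bigr => k _.
    by rewrite wick_sum.
  rewrite !L_invn e3 !wick_sum.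
  rewrite exchange_big.
  rewrite (eq_bigr (fun j => n%:R^-1 * (L (\sum_i H j i j) + L (\sum_i H j j i) +
    n%:R * (delta * \sum_k \sum_l L (H j k l))))); last first.
    move=> j _; rewrite -mulr_sumr !wick_sum big_split big_split /=; congr (_ * (_ + _)).
    by rewrite sumr_const card_ord mulr_natl.
  rewrite -mulr_sumr big_split big_split /= -!mulr_sumr; ring.
rewrite I1 I2 I3 !wickD !wick_sum.
have -> : forall a b c x y z : R, a + b + (x + y) + D * (c + z) =
    (a + x + D * c) + (b + y + D * z) by move=> *; ring.
apply: lerD.
  rewrite mulr_sumr -!big_split /=; apply: ler_sum => a _.
  rewrite L_invn !big_cons -/PF.
  (* Giving up the trace for a total sum keeps the recursion inside the family [sigma]. *)
  have h : L (tau a * (sigma (m - a.+1) * PF)) <= L (sigma a * (sigma (m - a.+1) * PF)).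
    apply: L_le; rewrite -mulrBl; apply: nnegM; first exact: nneg_sigma_tau.
    by apply: nnegM => //; exact: nneg_sigma.
  rewrite [X in _ <= X]addrC mulrDl mul1r addrA lerD2r lerD2l; exact: h.
rewrite mulr_sumr -!big_split /=; apply: ler_sum => q _.
rewrite !wick_sum mulr_sumr -!big_split /=; apply: ler_sum => x _.
by rewrite !L_invn le_eqVlt; apply/orP; left; apply/eqP; ring.
Qed.

Lemma wick_sigma_le eta theta K F : n%:R^-1 <= eta -> D <= eta -> 0 < theta ->
  (1 + eta) * (1 + (K.+1%:R)^-1) + 2 * K%:R * eta + 6 * K%:R * K.+1%:R ^+ 4 * eta
    <= theta ^+ 2 ->
  (sumn F <= 2 * K)%N -> L (\prod_(q <- F) sigma q) <= (2 * theta) ^+ sumn F.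
Proof.
move=> he hD ht hc hF.
have D0 : 0 <= D by rewrite mulr_ge0 ?ler0n.
apply: (@moment_bound R (fun s => L (\prod_(q <- s) sigma q)) n%:R^-1 D eta theta K) => //.
- by rewrite big_nil wick1.
- by move=> s; rewrite big_cons sigma0 mul1r.
- exact: wick_sigma_rec.
Qed.

(* A bound on moments of bounded order, uniform in the size of the matrix. *)
Definition moment_cst m : R := (2 * (4 + 2 * m%:R + 6 * m%:R * m.+1%:R ^+ 4)) ^+ m.

Lemma wick_sigma_le_cst m F : D <= 1 -> (sumn F <= m)%N ->
  L (\prod_(q <- F) sigma q) <= moment_cst m.
Proof.
move=> hD hF; rewrite /moment_cst; set theta := (4 + _ + _).
have m0 : 0 <= 2 * m%:R :> R by rewrite mulr_ge0 ?ler0n.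
have m1 : 0 <= 6 * m%:R * m.+1%:R ^+ 4 :> R by rewrite !mulr_ge0 ?exprn_ge0 ?ler0n.
have t1 : 1 <= theta by rewrite /theta; lra.
have t2 : theta <= theta ^+ 2 by rewrite expr2 ler_peMr // (le_trans ler01 t1).
apply: le_trans (_ : (2 * theta) ^+ sumn F <= _).
  (* With [eta] equal to 1 the first product of the condition is at most 4, so its left side is at
     most [theta], hence at most [theta ^+ 2]. *)
  apply: (@wick_sigma_le 1 theta m); [|exact: hD|lra| |lia].
    by rewrite invf_le1 // ler1n.
  apply: le_trans t2; rewrite !mulr1 /theta.
  rewrite !lerD2r.
  have : (m.+1%:R)^-1 <= 1 :> R by rewrite invf_le1 ?ltr0n // ler1n.
  by move: (_^-1) => x; lra.
by rewrite ler_weXn2l //; lra.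
Qed.

Lemma moment_cst_ge0 m : 0 <= moment_cst m.
Proof.
by rewrite exprn_ge0 ?mulr_ge0 ?addr_ge0 ?mulr_ge0 ?exprn_ge0 ?ler0n.
Qed.

(** * Comparison of the true covariance with the kernel *)

Variable S : 'I_N -> 'I_N -> R.
Hypothesis S_sym : forall p q, S p q = S q p.
Hypothesis S_diag : forall p, S p p = n%:R^-1.
Hypothesis S_off : forall p q, p != q -> `|S p q| <= n%:R^-1 * delta.

Let S_le p q : `|S p q| <= kernel p q.
Proof.
rewrite /kernel; have [->|pq] := eqVneq p q.
  by rewrite S_diag ger0_norm // ler_peMr // lerDl.
by rewrite add0r S_off.
Qed.

Lemma grad_contract (K : 'I_N -> 'I_N -> R) A G H (f : 'I_N -> R) : grad_of G H ->
  \sum_q f q * wick K (A * G^`M(q)) = \sum_k \sum_l f (ix k l) * wick K (A * H k l).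
Proof.
move=> dG.
rewrite (eq_bigr (fun q => \sum_k \sum_l f q * ((q == ix k l)%:R * wick K (A * H k l)))).
  rewrite exchange_big; apply: eq_bigr => k _; rewrite exchange_big; apply: eq_bigr => l _.
  rewrite (bigD1 (ix k l)) //= eqxx mul1r big1 ?addr0 // => q qkl.
  by rewrite (negbTE qkl) mul0r mulr0.
move=> q _; rewrite dG [A * _]mulr_sumr wick_sum mulr_sumr; apply: eq_bigr => k _.
rewrite [A * _]mulr_sumr wick_sum mulr_sumr; apply: eq_bigr => l _; congr (_ * _).
by case: (q == _); rewrite ?mul1r // !mul0r mulr0 raddf0.
Qed.

(** The gradient of [tau a] is $(a/n)M^{a-1}$, and the diagonal part of the kernel, of size $1/n$,
    contracts two such matrices into $n$ times a normalized trace: altogether $n^{-2}$, which makes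
    the fluctuations summable. *)
Lemma tau_cov_le a b :
  `|wick S (tau a * tau b) - wick S (tau a) * wick S (tau b)| <=
  n%:R^-1 ^+ 2 * (a%:R * b%:R) *
    (2 * L (sigma (a.-1 + b.-1)) + D * L (sigma a.-1 * sigma b.-1)).
Proof.
apply: le_trans (wick_cov_le S_sym kernel_sym S_le (nneg_tau a) (nneg_tau b)) _.
pose Ha i j := invn * (a%:R * mpow a.-1 i j).
pose Hb i j := invn * (b%:R * mpow b.-1 i j).
have nH c m i j : nneg (invn * (c%:R * mpow m i j)).
  apply: nnegM; first exact: nneg_invn.
  by rewrite -[c%:R]mpolyC_nat mul_mpolyC; apply: nnegZ; [exact: ler0n|exact: nneg_mpow].
rewrite (eq_bigr (fun p => \sum_k \sum_l kernel p (ix k l) *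
    L (Hb k l * (tau a)^`M(p)))); last first.
  move=> p _; rewrite (grad_contract _ _ _ (grad_tau b)).
  by apply: eq_bigr => k _; apply: eq_bigr => l _; rewrite [X in L X]mulrC.
rewrite exchange_big; under eq_bigr do rewrite exchange_big /=.
rewrite (eq_bigr (fun k => \sum_l \sum_i \sum_j kernel (ix k l) (ix i j) *
    L (Hb k l * Ha i j))); last first.
  move=> k _; apply: eq_bigr => l _.
  rewrite (grad_contract _ _ (fun p => kernel p (ix k l)) (grad_tau a)).
  by apply: eq_bigr => i _; apply: eq_bigr => j _; rewrite kernel_sym.
apply: (@le_trans _ _ (\sum_k \sum_l n%:R^-1 * (L (Hb k l * Ha k l) + L (Hb k l * Ha l k) +
    delta * \sum_i \sum_j L (Hb k l * Ha i j)))).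
  apply: ler_sum => k _; apply: ler_sum => l _; apply: kernel_sum_le => i j.
  by apply: L_ge0; apply: nnegM; exact: nH.
have e1 : \sum_k \sum_l L (Hb k l * Ha k l) = n%:R^-1 * (a%:R * b%:R) * L (tau (a.-1 + b.-1)).
  have -> : \sum_k \sum_l L (Hb k l * Ha k l) =
      L (invn * ((a%:R * b%:R)%:MP * tau (a.-1 + b.-1))).
    rewrite /tau -mpow_dot !mulr_sumr wick_sum; apply: eq_bigr => k _.
    rewrite !mulr_sumr wick_sum; apply: eq_bigr => l _; congr (L _).
    by rewrite /Ha /Hb mpolyCM !mpolyC_nat; ring.
  by rewrite L_invn mul_mpolyC wickZ; exact: mulrA.
have e2 : \sum_k \sum_l L (Hb k l * Ha l k) = \sum_k \sum_l L (Hb k l * Ha k l).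
  by apply: eq_bigr => k _; apply: eq_bigr => l _; rewrite /Ha mpow_sym.
have e3 : \sum_k \sum_l \sum_i \sum_j L (Hb k l * Ha i j) =
    (a%:R * b%:R) * L (sigma a.-1 * sigma b.-1).
  have -> : (a%:R * b%:R) * L (sigma a.-1 * sigma b.-1) =
     L ((\sum_k \sum_l Hb k l) * (\sum_i \sum_j Ha i j)).
    rewrite -wickZ -mul_mpolyC mpolyCM !mpolyC_nat; congr (L _).
    have sH c m : \sum_k \sum_l invn * (c%:R * mpow m k l) = c%:R * sigma m.
      rewrite /sigma mulrCA !mulr_sumr; apply: eq_bigr => k _.
      by rewrite row_sumE !mulr_sumr.
    by rewrite !sH; ring.
  rewrite mulr_suml wick_sum; apply: eq_bigr => k _.
  rewrite mulr_suml wick_sum; apply: eq_bigr => l _.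
  rewrite mulr_sumr wick_sum; apply: eq_bigr => i _.
  by rewrite mulr_sumr wick_sum.
have -> : \sum_k \sum_l n%:R^-1 * (L (Hb k l * Ha k l) + L (Hb k l * Ha l k) +
    delta * \sum_i \sum_j L (Hb k l * Ha i j)) =
  n%:R^-1 * (\sum_k \sum_l L (Hb k l * Ha k l) + \sum_k \sum_l L (Hb k l * Ha l k) +
    delta * \sum_k \sum_l \sum_i \sum_j L (Hb k l * Ha i j)).
  rewrite [delta * _ in RHS]mulr_sumr -!big_split mulr_sumr; apply: eq_bigr => k _ /=.
  by rewrite [delta * _ in RHS]mulr_sumr -!big_split mulr_sumr.
rewrite e2 e1 e3.
have h : L (tau (a.-1 + b.-1)) <= L (sigma (a.-1 + b.-1)) by apply: L_le; exact: nneg_sigma_tau.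
have ab0 : 0 <= n%:R^-1 ^+ 2 * (a%:R * b%:R) :> R by rewrite !mulr_ge0 ?exprn_ge0 ?ler0n.
have -> : n%:R^-1 * (n%:R^-1 * (a%:R * b%:R) * L (tau (a.-1 + b.-1)) +
   n%:R^-1 * (a%:R * b%:R) * L (tau (a.-1 + b.-1)) +
   delta * (a%:R * b%:R * L (sigma a.-1 * sigma b.-1))) =
  n%:R^-1 ^+ 2 * (a%:R * b%:R) *
   (2 * L (tau (a.-1 + b.-1)) + D * L (sigma a.-1 * sigma b.-1)).
  by field; rewrite lt0r_neq0.
by rewrite ler_wpM2l // lerD2r ler_wpM2l.
Qed.

(** The crossed contraction $(k,l)=(j,i)$ has covariance exactly $1/n$ and reproduces the products
    of traces. The rest is bounded under the kernel: the straight contraction gives the term in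
    $1/n$, the free summation the one in [delta]. *)
Lemma tau_rec_le m :
  `|wick S (tau m.+1) - \sum_(a < m) wick S (tau a * tau (m - a.+1))| <=
  \sum_(a < m) (n%:R^-1 * L (sigma m.-1) + delta * L (sigma a * sigma (m - a.+1))).
Proof.
pose H i j k l := \sum_(a < m) mpow a j k * mpow (m - a.+1) l i.
have nH i j k l : nneg (H i j k l).
  by apply: nneg_sum => a _; apply: nnegM; exact: nneg_mpow.
have S_invn p : wick S (invn * p) = n%:R^-1 * wick S p by rewrite mul_mpolyC wickZ.
have -> : wick S (tau m.+1) = n%:R^-1 * \sum_i \sum_j \sum_k \sum_l
    S (ix i j) (ix k l) * wick S (H i j k l).
  rewrite /tau S_invn wick_sum; congr (_ * _); apply: eq_bigr => i _.
  rewrite mpowS wick_sum; apply: eq_bigr => j _.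
  by rewrite (wick_ibp_grad _ _ S_sym (grad_mpow m j i)).
have -> : \sum_(a < m) wick S (tau a * tau (m - a.+1)) =
    n%:R^-1 * \sum_i \sum_j n%:R^-1 * wick S (H i j j i).
  have -> : \sum_i \sum_j n%:R^-1 * wick S (H i j j i) =
      \sum_i wick S (\sum_j invn * H i j j i).
    by apply: eq_bigr => i _; rewrite wick_sum; apply: eq_bigr => j _; rewrite S_invn.
  rewrite -wick_sum -S_invn -wick_sum; congr (wick S _).
  rewrite (eq_bigr (fun i => \sum_(a < m) invn * ((\sum_j mpow a j j) * mpow (m - a.+1) i i))).
    rewrite exchange_big mulr_sumr; apply: eq_bigr => a _.
    by rewrite -mulr_sumr -mulr_sumr /tau; ring.
  move=> i _; rewrite -mulr_sumr exchange_big mulr_sumr; apply: eq_bigr => a _.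
  by rewrite mulr_suml.
rewrite -mulrBr normrM ger0_norm // -sumrB.
apply: (@le_trans _ _ (n%:R^-1 * \sum_i \sum_j n%:R^-1 *
    (L (H i j i j) + delta * \sum_k \sum_l L (H i j k l)))).
  rewrite ler_wpM2l //; apply: le_trans (ler_norm_sum _ _ _) _.
  apply: ler_sum => i _; rewrite -sumrB; apply: le_trans (ler_norm_sum _ _ _) _.
  apply: ler_sum => j _.
  (* Values at a single position are spread into sums over all positions, so that the difference can
     be estimated term by term. *)
  have e a b (h : 'I_n -> 'I_n -> R) : h a b = \sum_k \sum_l ((k == a) && (l == b))%:R * h k l.
    rewrite (bigD1 a) //= (bigD1 b) //= !eqxx mul1r !big1 ?addr0 //.
      by move=> k ka; rewrite big1 // => l _; rewrite (negbTE ka) mul0r.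
    by move=> l lb; rewrite (negbTE lb) mul0r.
  rewrite (e j i (fun k l => wick S (H i j k l))) (e i j (fun k l => L (H i j k l))).
  rewrite !mulr_sumr -sumrB -big_split mulr_sumr /=.
  apply: le_trans (ler_norm_sum _ _ _) _; apply: ler_sum => k _.
  rewrite !mulr_sumr -sumrB -big_split mulr_sumr /=.
  apply: le_trans (ler_norm_sum _ _ _) _; apply: ler_sum => l _.
  rewrite mulrA -mulrBl -mulrDl mulrA normrM; apply: ler_pM => //; last first.
    exact: wick_norm_le.
  have dl0 : 0 <= n%:R^-1 * delta by rewrite mulr_ge0.
  (* Equal coordinates mean the straight or the crossed position, which coincide when $i=j$;
     elsewhere [S_off] applies. *)
  have [/ix_inj|nij] := eqVneq (ix i j) (ix k l).
    case=> [[ei ej]|[ei ej]]; subst; rewrite !eqxx /=.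
      rewrite S_diag; case: (_ && _); rewrite ?mulr1 ?mulr0 ?subrr ?subr0 ?normr0.
        by rewrite mulr_ge0 ?addr_ge0.
      by rewrite ger0_norm // mulrDr mulr1 lerDl.
    rewrite ix_sym S_diag mulr1 subrr normr0 mulr_ge0 ?addr_ge0 ?ler0n //.
  have -> : (k == j) && (l == i) = false.
    by apply/negP => /andP[/eqP ek /eqP el]; move: nij; rewrite ek el ix_sym eqxx.
  rewrite mulr0 subr0; apply: le_trans (S_off nij) _.
  by rewrite ler_wpM2l // lerDr ler0n.
have e1 : L (invn * \sum_i \sum_j invn * H i j i j) =
    n%:R^-1 * \sum_i \sum_j n%:R^-1 * L (H i j i j).
  rewrite L_invn wick_sum; congr (_ * _); apply: eq_bigr => i _.
  by rewrite wick_sum; apply: eq_bigr => j _; rewrite L_invn.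
have e2 : L (invn * (invn * \sum_i \sum_j \sum_k \sum_l H i j k l)) =
    n%:R^-1 * (n%:R^-1 * \sum_i \sum_j \sum_k \sum_l L (H i j k l)).
  rewrite !L_invn wick_sum; congr (_ * (_ * _)); apply: eq_bigr => i _.
  rewrite wick_sum; apply: eq_bigr => j _; rewrite wick_sum; apply: eq_bigr => k _.
  by rewrite wick_sum.
have -> : n%:R^-1 * (\sum_i \sum_j n%:R^-1 * (L (H i j i j) + delta * \sum_k \sum_l L (H i j k l))) =
    L (invn * \sum_i \sum_j invn * H i j i j) +
    delta * L (invn * (invn * \sum_i \sum_j \sum_k \sum_l H i j k l)).
  rewrite e1 e2 [delta * _ in RHS]mulrCA -mulrDr; congr (_ * _).
  rewrite [delta * (n%:R^-1 * _)]mulrA [(delta * _) * _ in RHS]mulr_sumr -big_split.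
  apply: eq_bigr => i _ /=; rewrite [(delta * _) * _ in RHS]mulr_sumr -big_split.
  by apply: eq_bigr => j _ /=; rewrite mulrDr mulrA [delta * n%:R^-1]mulrC.
have -> : invn * (invn * \sum_i \sum_j \sum_k \sum_l H i j k l) =
    \sum_(a < m) sigma a * sigma (m - a.+1).
  rewrite (eq_bigr (fun i => \sum_(a < m) (\sum_j row_sum a j) * row_sum (m - a.+1) i)).
    rewrite exchange_big !mulr_sumr; apply: eq_bigr => a _.
    by rewrite -mulr_sumr /sigma; ring.
  move=> i _; under eq_bigr do under eq_bigr do rewrite exchange_big /=.
  under eq_bigr do rewrite exchange_big /=.
  rewrite exchange_big; apply: eq_bigr => a _.
  rewrite mulr_suml; apply: eq_bigr => j _; rewrite row_sumE mulr_suml.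
  by apply: eq_bigr => k _; rewrite -mulr_sumr.
have -> : invn * \sum_i \sum_j invn * H i j i j = \sum_(a < m) invn * tau m.-1.
  rewrite (eq_bigr (fun i => \sum_(a < m) invn * \sum_j mpow (m - a.+1) i j * mpow a i j)).
    rewrite exchange_big mulr_sumr; apply: eq_bigr => a _; congr (_ * _).
    rewrite -mulr_sumr mpow_dot /tau.
    by have -> : (m - a.+1 + a = m.-1)%N by have := ltn_ord a; lia.
  move=> i _; rewrite -mulr_sumr exchange_big mulr_sumr; apply: eq_bigr => a _.
  by congr (_ * _); apply: eq_bigr => j _; rewrite mulrC (mpow_sym a) (mpow_sym (m - a.+1)) mpow_sym.
rewrite !wick_sum big_split /= -[X in _ <= _ + X]mulr_sumr lerD2r; apply: ler_sum => a _.
rewrite L_invn ler_wpM2l //; apply: L_le; exact: nneg_sigma_tau.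
Qed.

Lemma tau_cov_bound a b : D <= 1 ->
  `|wick S (tau a * tau b) - wick S (tau a) * wick S (tau b)| <=
  n%:R^-1 ^+ 2 * (3 * (a%:R * b%:R) * moment_cst (a + b)).
Proof.
move=> hD; apply: le_trans (tau_cov_le a b) _.
have h1 : L (sigma (a.-1 + b.-1)) <= moment_cst (a + b).
  by have := @wick_sigma_le_cst (a + b) [:: (a.-1 + b.-1)%N] hD; rewrite big_seq1; apply=> /=; lia.
have h2 : L (sigma a.-1 * sigma b.-1) <= moment_cst (a + b).
  have := @wick_sigma_le_cst (a + b) [:: a.-1; b.-1] hD; rewrite big_cons big_seq1; apply=> /=; lia.
have D0 : 0 <= D by rewrite mulr_ge0 ?ler0n.
have -> : 3 * (a%:R * b%:R) * moment_cst (a + b) =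
  (a%:R * b%:R) * (2 * moment_cst (a + b) + 1 * moment_cst (a + b)) by ring.
rewrite [X in _ <= X]mulrA ler_wpM2l ?mulr_ge0 ?exprn_ge0 ?ler0n //.
apply: lerD; first by rewrite ler_wpM2l.
apply: ler_pM => //; apply: L_ge0; apply: nnegM; exact: nneg_sigma.
Qed.

Definition rec_cst m : R :=
  \sum_(a < m) (2 * moment_cst m + 3 * (a%:R * (m - a.+1)%:R) * moment_cst (a + (m - a.+1))).

(** Replacing the mean of a product of traces by the product of means costs a covariance, of order
    $n^{-2}$ by [tau_cov_bound]. *)
Lemma tau_rec_bound eta m : n%:R^-1 <= eta -> D <= eta -> eta <= 1 ->
  `|wick S (tau m.+1) - \sum_(a < m) wick S (tau a) * wick S (tau (m - a.+1))| <=
  eta * rec_cst m.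
Proof.
move=> he hD he1; have hD1 := le_trans hD he1.
have n1 : 1 <= n%:R :> R by rewrite ler1n.
have de : delta <= eta by apply: le_trans hD; rewrite ler_peMl.
have e0 : 0 <= eta by exact: le_trans de.
rewrite -[X in `|X - _|](subrK (\sum_(a < m) wick S (tau a * tau (m - a.+1)))) -addrA -sumrB.
apply: le_trans (ler_normD _ _) _.
have -> : eta * rec_cst m = \sum_(a < m) eta * (2 * moment_cst m) +
  \sum_(a < m) eta * (3 * (a%:R * (m - a.+1)%:R) * moment_cst (a + (m - a.+1))).
  by rewrite /rec_cst mulr_sumr -big_split; apply: eq_bigr => a _; rewrite mulrDr.
apply: lerD.
  apply: le_trans (tau_rec_le m) _; apply: ler_sum => a _.
  have am := ltn_ord a.
  have -> : eta * (2 * moment_cst m) = eta * moment_cst m + eta * moment_cst m by ring.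
  apply: lerD; apply: ler_pM => //.
  - by apply: L_ge0; exact: nneg_sigma.
  - by have := @wick_sigma_le_cst m [:: m.-1] hD1; rewrite big_seq1; apply=> /=; lia.
  - by apply: L_ge0; apply: nnegM; exact: nneg_sigma.
  - have := @wick_sigma_le_cst m [:: a : nat; (m - a.+1)%N] hD1.
    by rewrite big_cons big_seq1; apply=> /=; lia.
apply: le_trans (ler_norm_sum _ _ _) _; apply: ler_sum => a _.
apply: le_trans (tau_cov_bound _ _ hD1) _; apply: ler_wpM2r.
  by rewrite !mulr_ge0 ?moment_cst_ge0 ?ler0n.
by apply: le_trans he; rewrite expr2 ler_piMl // invf_le1.
Qed.

Lemma tau_moment_le eta theta K : n%:R^-1 <= eta -> D <= eta -> 0 < theta ->
  (1 + eta) * (1 + (K.+1%:R)^-1) + 2 * K%:R * eta + 6 * K%:R * K.+1%:R ^+ 4 * eta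
    <= theta ^+ 2 ->
  wick S (tau (2 * K)) <= (2 * theta) ^+ (2 * K).
Proof.
move=> he hD ht hc; apply: le_trans (ler_norm _) _.
apply: le_trans (wick_norm_le S_le (nneg_tau _)) _.
apply: le_trans (L_le (nneg_sigma_tau _)) _.
have := @wick_sigma_le eta theta K [:: (2 * K)%N] he hD ht hc.
by rewrite big_seq1 /= addn0; apply.
Qed.

End Wigner.
End WignerMoments.

From mathcomp Require Import all_classical all_reals all_analysis.
From mathcomp Require Import measurable_realfun.

Import numFieldNormedType.Exports.
Local Open Scope classical_set_scope.
Local Open Scope ring_scope.

(** * Moments of the normal density by integration by parts *)

Section NormalMoments.
Variable R : realType.
Implicit Types (m s x : R).
Local Notation mu := (@lebesgue_measure R).

(** The Radon-Nikodym derivative and the explicit density have the same integral over every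
    measurable set, hence agree almost everywhere. *)
Lemma ge0_integral_normal_prob m s (f : R -> \bar R) :
  measurable_fun setT f -> (forall x, 0 <= f x)%E ->
  (\int[normal_prob m s]_x f x = \int[mu]_x (f x * (normal_pdf m s x)%:E))%E.
Proof.
move=> mf f0.
pose RN := Radon_Nikodym_SigmaFinite.f (normal_prob m s) mu.
have dom := normal_prob_dominates m s.
rewrite -(Radon_Nikodym_SigmaFinite.change_of_variables dom f0 measurableT mf).
have iRN : mu.-integrable setT RN by exact: Radon_Nikodym_SigmaFinite.f_integrable.
have mpdf : measurable_fun setT (fun x => (normal_pdf m s x)%:E).
  by apply/measurable_EFinP; exact: measurable_normal_pdf.
apply: ae_eq_integral => //.
- by apply: emeasurable_funM => //; exact: measurable_int iRN.
- exact: emeasurable_funM.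
have h : ae_eq mu setT RN (fun x => (normal_pdf m s x)%:E).
  apply: integral_ae_eq => // E _ mE.
  by rewrite -Radon_Nikodym_SigmaFinite.f_integral.
by apply: filterS h => x hx xT; congr (f x * _)%E; exact: hx.
Qed.

Lemma integral_normal_prob m s (f : R -> \bar R) : measurable_fun setT f ->
  (\int[normal_prob m s]_x f x = \int[mu]_x (f x * (normal_pdf m s x)%:E))%E.
Proof.
move=> mf; rewrite integralE [RHS]integralE.
rewrite !ge0_integral_normal_prob //; [|exact: measurable_funeneg|exact: measurable_funepos].
have max_mulr (a : \bar R) x : (maxe a 0 * (normal_pdf m s x)%:E =
    maxe (a * (normal_pdf m s x)%:E) 0)%E.
  by rewrite muleC maxe_pMr // ?lee_fin ?normal_pdf_ge0 // mule0 muleC.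
congr (_ - _)%E; apply: eq_integral => x _.
  by rewrite [X in (X * _)%E]funeposE [RHS]funeposE max_mulr.
by rewrite [X in (X * _)%E]funenegE [RHS]funenegE max_mulr mulNe.
Qed.

Lemma normal_pdf_exp m s x : 0 < s ->
  normal_pdf m s x = normal_peak s * expR (- (x - m) ^+ 2 / (s ^+ 2 *+ 2)).
Proof. by move=> s0; rewrite normal_pdfE ?gt_eqF. Qed.

(** Doubling the standard deviation absorbs a polynomial factor, which reduces integrability and
    decay to facts about normal densities. *)
Lemma pow_normal_pdf_le m s k : 0 < s ->
  exists2 C, 0 <= C & forall x, x ^+ (2 * k) * normal_pdf m s x <= C * normal_pdf m (2 * s) x.
Proof.
move=> s0; have s20 : 0 < 2 * s by rewrite mulr_gt0.
(* The gain in the exponent: $1/(2s^2)-1/(2(2s)^2)$. *)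
pose c := 3 / (8 * s ^+ 2).
have c0 : 0 < c by rewrite divr_gt0 // mulr_gt0 // exprn_gt0.
pose A := 2 * m ^+ 2 + 2 * k.+1%:R / c.
have A0 : 0 <= A by rewrite addr_ge0 // mulr_ge0 ?sqr_ge0 ?ler0n ?invr_ge0 ?(ltW c0) // mulr_ge0.
exists (A ^+ k * (normal_peak s / normal_peak (2 * s))).
  by rewrite mulr_ge0 ?exprn_ge0 // divr_ge0 // normal_peak_ge0.
move=> x; rewrite !normal_pdf_exp //.
have p0 : normal_peak (2 * s) != 0 by rewrite gt_eqF // normal_peak_gt0 // gt_eqF.
set y := (x - m) ^+ 2; have y0 : 0 <= y by exact: sqr_ge0.
have -> : A ^+ k * (normal_peak s / normal_peak (2 * s)) *
   (normal_peak (2 * s) * expR (- y / ((2 * s) ^+ 2 *+ 2))) =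
   normal_peak s * (A ^+ k * expR (- y / ((2 * s) ^+ 2 *+ 2))) by field.
rewrite mulrCA ler_wpM2l ?normal_peak_ge0 //.
have -> : - y / ((2 * s) ^+ 2 *+ 2) = c * y + - y / (s ^+ 2 *+ 2).
  by rewrite /c; field; rewrite gt_eqF.
rewrite expRD mulrA ler_wpM2r ?expR_ge0 //.
(* Combines $x^2\le 2m^2+2(x-m)^2$ with $1+t\le e^t$ for $t=c(x-m)^2/(k+1)$, small enough to be
   raised to the power [k]; dividing by $k+1$ also covers $k=0$. *)
have h1 : x ^+ 2 <= A * expR (c * y / k.+1%:R).
  apply: le_trans (_ : A * (1 + c * y / k.+1%:R) <= _); last first.
    by rewrite ler_wpM2l // expR_ge1Dx.
  have k0 : 0 < k.+1%:R :> R by rewrite ltr0n.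
  have h2 : 0 <= 2 * m ^+ 2 * (c * y / k.+1%:R).
    apply: mulr_ge0; first by rewrite mulr_ge0 ?sqr_ge0.
    by rewrite divr_ge0 ?ler0n // mulr_ge0 // ltW.
  have h4 : 0 <= 2 * k.+1%:R / c by rewrite !mulr_ge0 ?invr_ge0 // ltW.
  have -> : A * (1 + c * y / k.+1%:R) =
    2 * m ^+ 2 + 2 * y + 2 * k.+1%:R / c + 2 * m ^+ 2 * (c * y / k.+1%:R).
    by rewrite /A; field; rewrite nat1r !gt_eqF.
  rewrite -[x ^+ 2]addr0 -[x ^+ 2 + 0]addr0 !lerD //.
  have := sqr_ge0 (x - 2 * m); rewrite /y => h; lra.
rewrite exprM; apply: le_trans (_ : (A * expR (c * y / k.+1%:R)) ^+ k <= _).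
  by apply: lerXn2r => //; rewrite nnegrE ?sqr_ge0 // mulr_ge0 ?expR_ge0.
rewrite exprMn ler_wpM2l ?exprn_ge0 // -expRM_natl ler_expR.
have cy0 : 0 <= c * y by exact: mulr_ge0 (ltW c0) y0.
rewrite mulrCA ler_piMr //.
by rewrite ler_pdivrMr ?ltr0n // mul1r ler_nat.
Qed.

Lemma integrable_pow_normal_pdf m s k : 0 < s ->
  mu.-integrable setT (fun x => (x ^+ k * normal_pdf m s x)%:E).
Proof.
move=> s0; have [C C0 hC] := pow_normal_pdf_le m k s0.
apply: (@le_integrable _ _ _ mu setT measurableT _
  (fun x => (normal_pdf m s x)%:E + C%:E * (normal_pdf m (2 * s) x)%:E)%E).
- apply/measurable_EFinP; apply: measurable_funM; last exact: measurable_normal_pdf.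
  exact: measurable_funX.
- move=> x _; rewrite -EFinM -EFinD !abse_EFin lee_fin normrM (ger0_norm (normal_pdf_ge0 _ _ _)).
  rewrite [X in _ <= X]ger0_norm ?addr_ge0 ?mulr_ge0 ?normal_pdf_ge0 //.
  apply: le_trans (_ : (1 + x ^+ (2 * k)) * normal_pdf m s x <= _).
    rewrite ler_wpM2r ?normal_pdf_ge0 // mulnC exprM.
    by have := sqr_ge0 (1 - `|x ^+ k|); have := real_normK (num_real (x ^+ k)) => h1 h2; nra.
  by rewrite mulrDl mul1r lerD2l.
- apply: integrableD => //; first exact: integrable_normal_pdf.
  by apply: integrableZl => //; exact: integrable_normal_pdf.
Qed.

Lemma is_derive_pow_normal_pdf m s k x : 0 < s ->
  is_derive x 1 (fun x => x ^+ k * normal_pdf m s x)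
    ((k%:R * x ^+ k.-1 - x ^+ k * (x - m) / s ^+ 2) * normal_pdf m s x).
Proof.
move=> s0; rewrite normal_pdf_exp //.
pose g x := - (x - m) ^+ 2 / (s ^+ 2 *+ 2).
have -> : (fun x => x ^+ k * normal_pdf m s x) =
  ((@idfun R : R -> R) ^+ k) * (cst (normal_peak s) * (expR \o g)).
  apply/funext => y; rewrite normal_pdf_exp //.
  by rewrite -[RHS]/((((@idfun R : R -> R) ^+ k) y) * (normal_peak s * expR (g y))) exprfctE.
have h1 : is_derive x 1 g (- (x - m) / s ^+ 2).
  have -> : g = (- (s ^+ 2 *+ 2)^-1) *: ((@idfun R : R -> R) - cst m) ^+ 2.
    apply/funext => y.
    rewrite -[RHS]/(- (s ^+ 2 *+ 2)^-1 * ((((@idfun R : R -> R) - cst m) ^+ 2) y)) exprfctE.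
    by rewrite /g mulrC mulrN mulNr.
  apply: is_derive_eq; rewrite /GRing.scale /= subr0 mulr1.
  by rewrite expr1 -[(_ - _) x]/(x - m); field; rewrite gt_eqF.
have h2 := is_derive1_comp (is_derive_expR (g x)) h1.
apply: is_derive_eq.
rewrite exprfctE -[LHS]/(x ^+ k * (normal_peak s * (expR (g x) * (- (x - m) / s ^+ 2)) +
  expR (g x) * 0) + (normal_peak s * expR (g x)) * (k%:R * x ^+ k.-1 * 1)) /g; field.
by rewrite gt_eqF.
Qed.

Lemma continuous_pow_normal_pdf m s k : 0 < s ->
  continuous (fun x => x ^+ k * normal_pdf m s x).
Proof.
move=> s0 x; apply/differentiable_continuous/derivable1_diffP.
by have [] := is_derive_pow_normal_pdf m k x s0.
Qed.

(** Decay like $1/|x|$ makes the boundary terms of the integration by parts vanish. *)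
Lemma pow_normal_pdf_vanish m s k : 0 < s -> exists2 B, 0 <= B &
  forall x, `|x| * `|x ^+ k * normal_pdf m s x| <= B.
Proof.
move=> s0; have [C C0 hC] := pow_normal_pdf_le m k.+1 s0.
have s20 : 0 < 2 * s by rewrite mulr_gt0.
have s1 : s != 0 by rewrite gt_eqF.
have s2 : 2 * s != 0 by rewrite gt_eqF.
exists (normal_peak s + C * normal_peak (2 * s)).
  by rewrite addr_ge0 ?mulr_ge0 ?normal_peak_ge0.
move=> x; rewrite normrM (ger0_norm (normal_pdf_ge0 _ _ _)) mulrA -normrM -exprS.
apply: le_trans (_ : (1 + x ^+ (2 * k.+1)) * normal_pdf m s x <= _).
  rewrite ler_wpM2r ?normal_pdf_ge0 // mulnC exprM.
  by have := sqr_ge0 (1 - `|x ^+ k.+1|); have := real_normK (num_real (x ^+ k.+1)) => h1 h2; nra.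
rewrite mulrDl mul1r; apply: lerD; first exact: normal_pdf_ub.
by apply: le_trans (hC x) _; rewrite ler_wpM2l // normal_pdf_ub.
Qed.

Definition normal_moment m s k := (\int[mu]_x (x ^+ k * normal_pdf m s x))%R.

(** The integrand is the derivative of $x^k$ times the density: the fundamental theorem on
    $[-n-1,n+1]$ leaves boundary terms tending to 0, and dominated convergence identifies the limit
    of the integrals. *)
Lemma integral_pow_normal_deriv m s k : 0 < s ->
  (\int[mu]_x (((k%:R * x ^+ k.-1 - x ^+ k * (x - m) / s ^+ 2) * normal_pdf m s x)%:E) = 0)%E.
Proof.
move=> s0; set f := fun x => (k%:R * x ^+ k.-1 - x ^+ k * (x - m) / s ^+ 2) * normal_pdf m s x.
have fE : f = (fun x => k%:R * (x ^+ k.-1 * normal_pdf m s x) -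
   (s ^+ 2)^-1 * (x ^+ k.+1 * normal_pdf m s x) +
   m * (s ^+ 2)^-1 * (x ^+ k * normal_pdf m s x)).
  by apply/funext => x; rewrite /f [x ^+ k.+1]exprS; field; rewrite gt_eqF.
have intf : mu.-integrable setT (EFin \o f).
  rewrite fE.
  have h a j : mu.-integrable setT (fun x => (a * (x ^+ j * normal_pdf m s x))%:E).
    by apply: (integrableZl measurableT a (integrable_pow_normal_pdf m j s0)).
  have := integrableD measurableT (integrableB measurableT (h k%:R k.-1) (h (s ^+ 2)^-1 k.+1))
    (h (m * (s ^+ 2)^-1) k).
  by apply: eq_integrable => // x _; rewrite /= EFinD EFinB.
have contf : continuous f.
  move=> x; rewrite fE; apply: cvgD; [apply: cvgB|].
  - apply: cvgM; [exact: cvg_cst|exact: continuous_pow_normal_pdf].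
  - apply: cvgM; [exact: cvg_cst|exact: continuous_pow_normal_pdf].
  - apply: cvgM; [exact: cvg_cst|exact: continuous_pow_normal_pdf].
pose F x := x ^+ k * normal_pdf m s x.
pose D (n : nat) := `[- n.+1%:R, n.+1%:R]%classic : set R.
have FTC n : (\int[mu]_(x in D n) (f x)%:E = (F n.+1%:R - F (- n.+1%:R))%:E)%E.
  have n0 : 0 < n.+1%:R :> R by rewrite ltr0n.
  rewrite /D (@continuous_FTC2 _ f F) ?EFinB //; first by rewrite gtrN.
  - exact: continuous_subspaceT.
  - split.
    + by move=> x _; have [] := is_derive_pow_normal_pdf m k x s0.
    + by apply: cvg_at_right_filter; exact: continuous_pow_normal_pdf.
    + by apply: cvg_at_left_filter; exact: continuous_pow_normal_pdf.
  - move=> x _; rewrite derive1E; have hd := is_derive_pow_normal_pdf m k x s0.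
    exact: derive_val.
have [_ _] : [/\ mu.-integrable setT (EFin \o f),
    (\int[mu]_(x in setT) `|((EFin \o f) \_ (D n)) x - (EFin \o f) x|)%E @[n --> \oo] --> 0%E &
    (\int[mu]_(x in setT) ((EFin \o f) \_ (D n)) x)%E @[n --> \oo] -->
      (\int[mu]_(x in setT) (EFin \o f) x)%E].
  have mf := measurable_int _ intf.
  apply: (@dominated_convergence _ _ _ mu setT measurableT
     (fun n => (EFin \o f) \_ (D n)) (EFin \o f) (abse \o (EFin \o f))) => //.
  - move=> n; have mD : measurable (D n) by exact: measurable_itv.
    by apply/(measurable_restrictT _ mD); exact: measurable_funTS.
  - apply: aeW => x _; apply: cvg_near_cst; exists (Num.truncn `|x|) => // n /= hn.
    rewrite patchE ifT // inE /D /= in_itv /= -ler_norml.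
    apply: ltW; apply: lt_le_trans (truncnS_gt _) _.
    by rewrite ler_nat.
  - exact: integrable_abse.
  - apply: aeW => x n _; rewrite patchE; case: ifP => // _.
    by rewrite (_ : point = 0%E) // abse0 abse_ge0.
under eq_fun do rewrite -integral_mkcond FTC.
have [B B0 hB] := pow_normal_pdf_vanish m k s0.
have cv : (F n.+1%:R - F (- n.+1%:R))%:E @[n --> \oo] --> 0%:E.
  apply: cvg_EFin; first by near=> n.
  rewrite -[X in _ --> X](subr0 0); apply: cvgB.
  - apply: (@squeeze_cvgr _ _ _ _ (fun n => - (B * (n.+1%:R)^-1)) (fun n => B * (n.+1%:R)^-1)).
    + near=> n; rewrite -ler_norml ler_pdivlMr ?ltr0n // mulrC.
      by have := hB n.+1%:R; rewrite ger0_norm.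
    + rewrite -oppr0; apply: cvgN; rewrite -[X in _ --> X](mulr0 B).
      apply: cvgM; [exact: cvg_cst|exact: cvg_harmonic].
    + rewrite -[X in _ --> X](mulr0 B); apply: cvgM; [exact: cvg_cst|exact: cvg_harmonic].
  - apply: (@squeeze_cvgr _ _ _ _ (fun n => - (B * (n.+1%:R)^-1)) (fun n => B * (n.+1%:R)^-1)).
    + near=> n; rewrite -ler_norml ler_pdivlMr ?ltr0n // mulrC.
      by have := hB (- n.+1%:R); rewrite normrN ger0_norm.
    + rewrite -oppr0; apply: cvgN; rewrite -[X in _ --> X](mulr0 B).
      apply: cvgM; [exact: cvg_cst|exact: cvg_harmonic].
    + rewrite -[X in _ --> X](mulr0 B); apply: cvgM; [exact: cvg_cst|exact: cvg_harmonic].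
by move=> h; exact: etrans (esym (cvg_lim (@ereal_hausdorff R) h)) (cvg_lim (@ereal_hausdorff R) cv).
Unshelve. all: by end_near. Qed.

Lemma normal_moment_rec m s k : 0 < s ->
  normal_moment m s k.+1 = m * normal_moment m s k + k%:R * s ^+ 2 * normal_moment m s k.-1.
Proof.
move=> s0; have s1 : s != 0 by rewrite gt_eqF.
have h a j : mu.-integrable setT (EFin \o (fun x => (a * (x ^+ j * normal_pdf m s x)))).
  by apply: (integrableZl measurableT a (integrable_pow_normal_pdf m j s0)).
have e a j : (\int[mu]_x (a * (x ^+ j * normal_pdf m s x)))%R = a * normal_moment m s j.
  by rewrite RintegralZl //; exact: integrable_pow_normal_pdf.
have : (\int[mu]_x (k%:R * (x ^+ k.-1 * normal_pdf m s x) -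
   (s ^+ 2)^-1 * (x ^+ k.+1 * normal_pdf m s x) +
   m * (s ^+ 2)^-1 * (x ^+ k * normal_pdf m s x)))%R = 0.
  rewrite /Rintegral -[RHS]/(fine 0%E) -(integral_pow_normal_deriv m k s0).
  congr fine; apply: eq_integral => x _; congr EFin.
  by rewrite [x ^+ k.+1]exprS; field.
rewrite RintegralD //; last first.
  have := integrableB measurableT (h k%:R k.-1) (h (s ^+ 2)^-1 k.+1).
  by apply: eq_integrable => // x _; rewrite /= EFinB.
rewrite RintegralB // !e => h0.
apply: (mulfI (_ : (s ^+ 2)^-1 != 0)); first by rewrite invr_eq0 expf_neq0.
apply/eqP; rewrite -subr_eq0; apply/eqP.
rewrite -[RHS]oppr0 -h0; field; exact: s1.
Qed.

Lemma normal_moment0 m s : normal_moment m s 0 = 1.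
Proof.
rewrite /normal_moment /Rintegral.
under eq_integral do rewrite expr0 mul1r.
by rewrite integral_normal_pdf.
Qed.

End NormalMoments.

(** * Random variables with finite moments of all orders *)

Section GaussianMoments.
Context d (T : measurableType d) (R : realType) (P : probability T R).
Local Notation mu := (@lebesgue_measure R).

(** Even powers are nonnegative and can be bounded without absolute values; the odd ones follow from
    $|f|^k\le 1+f^{2k}$. *)
Definition has_moments (f : T -> R) :=
  measurable_fun setT f /\ forall k, P.-integrable setT (fun w => (f w ^+ (2 * k))%:E).

Definition mean (f : T -> R) : R := (\int[P]_w f w)%R.

Lemma has_moments_pow f k : has_moments f -> P.-integrable setT (fun w => (f w ^+ k)%:E).
Proof.
move=> [mf hf]; apply: (@le_integrable _ _ _ P setT measurableT _
  (fun w => (f w ^+ (2 * 0))%:E + (f w ^+ (2 * k))%:E)%E).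
- by apply/measurable_EFinP; exact: measurable_funX.
- move=> x _; rewrite -EFinD !abse_EFin lee_fin muln0 expr0 mulnC exprM.
  rewrite [X in _ <= X]ger0_norm ?addr_ge0 ?sqr_ge0 //.
  by have := sqr_ge0 (1 - `|f x ^+ k|); have := real_normK (num_real (f x ^+ k)) => h1 h2; nra.
- by apply: integrableD.
Qed.

Lemma has_moments_integrable f : has_moments f -> P.-integrable setT (EFin \o f).
Proof. by move=> /(has_moments_pow 1); apply: eq_integrable => // w _; rewrite expr1. Qed.

Lemma has_moments_le (f : T -> R) (g : nat -> T -> R) : measurable_fun setT f ->
  (forall k, P.-integrable setT (EFin \o g k)) ->
  (forall k w, f w ^+ (2 * k) <= g k w) -> has_moments f.
Proof.
move=> mf ig fg; split=> // k; apply: le_integrable (ig k) => //.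
  by apply/measurable_EFinP; exact: measurable_funX.
move=> x _; have p0 : 0 <= f x ^+ (2 * k) by rewrite exprM exprn_ge0 ?sqr_ge0.
by rewrite !abse_EFin lee_fin (ger0_norm p0) (le_trans (fg k x)) // ler_norm.
Qed.

Lemma has_moments_cst c : has_moments (cst c).
Proof.
split; first exact: measurable_cst.
by move=> k; exact: (finite_measure_integrable_cst P (c ^+ (2 * k))).
Qed.

Lemma has_momentsM (f g : T -> R) : has_moments f -> has_moments g -> has_moments (fun w => f w * g w).
Proof.
move=> [mf hf] [mg hg].
apply: (@has_moments_le _ (fun k w => f w ^+ (2 * (2 * k)) + g w ^+ (2 * (2 * k)))).
- exact: measurable_funM.
- by move=> k; have := integrableD measurableT (hf (2 * k)%N) (hg (2 * k)%N).
move=> k w; rewrite !(mulnA 2 2) ![(2 * 2 * k)%N]mulnAC !(exprM _ (2 * k)) exprMn.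
by have := sqr_ge0 (f w ^+ (2 * k) - g w ^+ (2 * k));
  have := sqr_ge0 (f w ^+ (2 * k)); have := sqr_ge0 (g w ^+ (2 * k)); nra.
Qed.

Lemma has_momentsD (f g : T -> R) : has_moments f -> has_moments g -> has_moments (fun w => f w + g w).
Proof.
move=> [mf hf] [mg hg].
apply: (@has_moments_le _ (fun k w => 4 ^+ k * (f w ^+ (2 * k) + g w ^+ (2 * k)))).
- exact: measurable_funD.
- move=> k; have := integrableZl measurableT (4 ^+ k) (integrableD measurableT (hf k) (hg k)).
  by apply: eq_integrable => // w _; rewrite /= EFinM EFinD.
move=> k w; rewrite !exprM; set a := f w; set b := g w.
have h : (a + b) ^+ 2 <= 4 * Num.max (a ^+ 2) (b ^+ 2).
  have [h|h] := leP (a ^+ 2) (b ^+ 2); have := sqr_ge0 (a - b); nra.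
apply: le_trans (_ : (4 * Num.max (a ^+ 2) (b ^+ 2)) ^+ k <= _).
  by apply: lerXn2r => //; rewrite nnegrE ?sqr_ge0 // mulr_ge0 // le_max sqr_ge0.
rewrite exprMn ler_wpM2l ?exprn_ge0 //.
have [h1|h1] := leP (a ^+ 2) (b ^+ 2).
  by rewrite lerDr exprn_ge0 ?sqr_ge0.
by rewrite lerDl exprn_ge0 ?sqr_ge0.
Qed.

Lemma meanD (f g : T -> R) : has_moments f -> has_moments g ->
  mean (fun w => f w + g w) = mean f + mean g.
Proof. by move=> hf hg; rewrite /mean RintegralD //; exact: has_moments_integrable. Qed.

Lemma meanZ c (f : T -> R) : has_moments f -> mean (fun w => c * f w) = c * mean f.
Proof. by move=> hf; rewrite /mean RintegralZl //; exact: has_moments_integrable. Qed.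

Lemma mean_cst c : mean (cst c) = c.
Proof.
rewrite /mean /Rintegral -[X in fine X]/(\int[P]_x (cst c%:E x))%E.
by rewrite integral_cst //= probability_setT mule1.
Qed.

(* Degenerate laws included: a centered Gaussian variable satisfies the moment
   recursion of integration by parts. *)
Lemma gaussian_law_moments (Y : T -> R) : measurable_fun setT Y ->
  gaussian_law (pushforward P Y) -> mean Y = 0 ->
  has_moments Y /\ forall k, mean (fun w => Y w ^+ k.+2) =
    k.+1%:R * mean (fun w => Y w ^+ 2) * mean (fun w => Y w ^+ k).
Proof.
move=> mY law m0; pose nu := pushforward P Y.
have mX k : measurable_fun [set: R] (fun x : R => (x ^+ k)%:E).
  by apply/measurable_EFinP; exact: measurable_funX.
(* Point masses and normal laws share one recursion, with [s] the variance; centering then forces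
   the coefficient [m] to be 0. *)
suff [M [M0 [hM hrec]]] : exists M : nat -> R, M 0%N = 1 /\
    (forall k, nu.-integrable setT (fun x : R => (x ^+ k)%:E) /\
       (\int[nu]_x (x ^+ k)%:E = (M k)%:E)%E) /\
    exists m s, forall k, M k.+1 = m * M k + k%:R * s * M k.-1.
  have intY k : P.-integrable setT (fun w => (Y w ^+ k)%:E).
    have /integrableP[_ h] := (hM k).1; apply/integrableP; split.
      by apply/measurable_EFinP; exact: measurable_funX.
    move: h; rewrite ge0_integral_pushforward //; last exact: measurableT_comp.
  have eY k : mean (fun w => Y w ^+ k) = M k.
    rewrite /mean /Rintegral -[RHS]/(fine (M k)%:E) -(hM k).2.
    by rewrite (integral_pushforward mY (mX k)) ?preimage_setT //; exact: intY.
  split; first by split.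
  have [m [s hr]] := hrec.
  have mE : M 1%N = m by rewrite hr M0 /= mul0r mul0r addr0 mulr1.
  have m00 : m = 0 by rewrite -mE -eY -m0; congr Rintegral; apply/funext => w; rewrite expr1.
  move=> k; rewrite !eY hr m00 mul0r add0r (hr 1%N) m00 mul0r add0r /= M0; ring.
case: law => [[m hm]|[m [s [s0 hm]]]].
  exists (fun k => m ^+ k); split; first by rewrite expr0.
  have e (f : R -> \bar R) : (\int[nu]_x f x = \int[\d_m]_x f x)%E.
    by apply: eq_measure_integral => A mA _; exact: hm.
  split.
    move=> k; split.
      apply/integrableP; split => //; rewrite e integral_dirac //; last first.
        by apply: measurableT_comp.
      by rewrite diracT mul1e ltry.
    by rewrite e integral_dirac // diracT mul1e.
  by exists m, 0 => k; rewrite mulr0 mul0r addr0 exprS.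
(* The library's normal law lives on a copy of the reals carrying another display. *)
pose idR : measurableTypeR R -> R := idfun.
have mid : measurable_fun setT idR by move=> _ A mA; rewrite setTI; exact: mA.
have e (f : R -> \bar R) :
    (\int[nu]_x f x = \int[pushforward (normal_prob m s) idR]_x f x)%E.
  by apply: eq_measure_integral => A mA _; exact: hm.
exists (normal_moment m s); split; first exact: normal_moment0.
split; last by exists m, (s ^+ 2) => k; exact: normal_moment_rec.
move=> k.
have mk : measurable_fun [set: R] (fun x : R => `|(x ^+ k)%:E|%E) by exact: measurableT_comp.
have lty : (\int[normal_prob m s]_x `|(x ^+ k)%:E| < +oo)%E.
  rewrite ge0_integral_normal_prob //.
  have /integrableP[_] := integrable_pow_normal_pdf m k s0.
  congr (_ < _)%E; apply: eq_integral => x _.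
  have p0 : (0 <= (normal_pdf m s x)%:E)%E by rewrite lee_fin normal_pdf_ge0.
  by rewrite EFinM abseM (gee0_abs p0).
split.
  by apply/integrableP; split => //; rewrite e (ge0_integral_pushforward mid).
have intN : (normal_prob m s).-integrable setT (fun x : R => (x ^+ k)%:E).
  by apply/integrableP; split; [exact: (mX k)|exact: lty].
transitivity (\int[normal_prob m s]_x (x ^+ k)%:E)%E.
  by rewrite e (integral_pushforward mid (mX k)) ?preimage_setT //; exact: intN.
rewrite integral_normal_prob // /normal_moment /Rintegral fineK //.
exact: integrable_fin_num (integrable_pow_normal_pdf m k s0).
Qed.

End GaussianMoments.

(** * The algebraic functional computes Gaussian expectations *)

Section GaussianWick.
Import -(notations) mpoly.
Import WickFunctional.
Context d (T : measurableType d) (R : realType) (P : probability T R).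

Lemma has_moments_sum I (r : seq I) (f : I -> T -> R) :
  (forall i, has_moments P (f i)) -> has_moments P (fun w => \sum_(i <- r) f i w).
Proof.
move=> hf; elim: r => [|i r IH].
  rewrite (_ : (fun w => _) = cst 0); first exact: has_moments_cst.
  by apply/funext => w; rewrite big_nil.
rewrite (_ : (fun w => _) = (fun w => f i w + \sum_(j <- r) f j w)); first exact: has_momentsD.
by apply/funext => w; rewrite big_cons.
Qed.

Lemma mean_sum I (r : seq I) (f : I -> T -> R) : (forall i, has_moments P (f i)) ->
  mean P (fun w => \sum_(i <- r) f i w) = \sum_(i <- r) mean P (f i).
Proof.
move=> hf; elim: r => [|i r IH].
  rewrite big_nil (_ : (fun w => _) = cst 0); first exact: mean_cst.
  by apply/funext => w; rewrite big_nil.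
rewrite big_cons -IH -meanD //; last exact: has_moments_sum.
by congr (mean P _); apply/funext => w; rewrite big_cons.
Qed.

Lemma has_moments_prod I (r : seq I) (f : I -> T -> R) :
  (forall i, has_moments P (f i)) -> has_moments P (fun w => \prod_(i <- r) f i w).
Proof.
move=> hf; elim: r => [|i r IH].
  rewrite (_ : (fun w => _) = cst 1); first exact: has_moments_cst.
  by apply/funext => w; rewrite big_nil.
rewrite (_ : (fun w => _) = (fun w => f i w * \prod_(j <- r) f j w)); first exact: has_momentsM.
by apply/funext => w; rewrite big_cons.
Qed.

Lemma has_momentsZ c (f : T -> R) : has_moments P f -> has_moments P (fun w => c * f w).
Proof. by move=> hf; apply: has_momentsM => //; exact: has_moments_cst. Qed.

Lemma has_momentsX (f : T -> R) k : has_moments P f -> has_moments P (fun w => f w ^+ k).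
Proof.
move=> hf; elim: k => [|k IH].
  rewrite (_ : (fun w => _) = cst 1); first exact: has_moments_cst.
  by apply/funext => w; rewrite expr0.
rewrite (_ : (fun w => _) = (fun w => f w * f w ^+ k)); first exact: has_momentsM.
by apply/funext => w; rewrite exprS.
Qed.

Section Wick.
Variables (N : nat) (v : 'I_N -> T -> R).

Definition evalp (p : mpoly N R) (w : T) : R := meval (fun i => v i w) p.

Lemma evalp_sum I (r : seq I) (F : I -> mpoly N R) w :
  evalp (\sum_(i <- r) F i) w = \sum_(i <- r) evalp (F i) w.
Proof. by rewrite /evalp raddf_sum. Qed.

Lemma evalpM (p q : mpoly N R) w : evalp (p * q) w = evalp p w * evalp q w.
Proof. by rewrite /evalp rmorphM. Qed.

Lemma has_moments_evalp p : (forall i, has_moments P (v i)) -> has_moments P (evalp p).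
Proof.
move=> hv; rewrite (_ : evalp p = fun w => \sum_(m <- msupp p)
  mcoeff m p * \prod_i v i w ^+ m i); last by apply/funext => w; exact: mevalE.
apply: has_moments_sum => m; apply: has_momentsZ; apply: has_moments_prod => i.
exact: has_momentsX.
Qed.

Hypothesis v_gaussian : forall a : 'I_N -> R,
  gaussian_law (pushforward P (fun w => \sum_i a i * v i w)).
Hypothesis v_measurable : forall i, measurable_fun setT (v i).
Hypothesis v_centered : forall i, mean P (v i) = 0.

Lemma gaussian_has_moments i : has_moments P (v i).
Proof.
apply: (gaussian_law_moments (v_measurable i) _ (v_centered i)).1.
have := v_gaussian (fun j => (j == i)%:R).
rewrite (_ : (fun w => _) = v i) //; apply/funext => w.
rewrite (bigD1 i) //= eqxx mul1r big1 ?addr0 // => j ji.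
by rewrite (negbTE ji) mul0r.
Qed.

(** On powers of a linear form both functionals obey the same two-step recursion with the same
    second moment; [eq_linform_powers] extends the equality to all polynomials. *)
Lemma mean_evalp p :
  mean P (evalp p) = wick (fun i j => mean P (fun w => v i w * v j w)) p.
Proof.
set K := (fun i j => _); have hv := gaussian_has_moments.
have Ksym i j : K i j = K j i.
  by rewrite /K; congr (mean P _); apply/funext => w; rewrite mulrC.
have hvv i j : has_moments P (fun w => v i w * v j w) by exact: has_momentsM.
have lin_f : linear_for *%R (fun p => mean P (evalp p)).
  move=> c p1 p2 /=; rewrite -meanZ -?meanD; do ?apply: has_momentsZ; try exact: has_moments_evalp.
  by congr (mean P _); apply/funext => w; rewrite /evalp mevalD mevalZ.
apply: (eq_linform_powers lin_f (@wick_is_linear _ _ K)) => a.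
pose Y w := \sum_i a i * v i w.
have hY : has_moments P Y by apply: has_moments_sum => i; exact: has_momentsZ.
have evY k w : evalp (linform a ^+ k) w = Y w ^+ k.
  rewrite /evalp rmorphXn /=; congr (_ ^+ _).
  rewrite /linform raddf_sum; apply: eq_bigr => i _ /=.
  by rewrite mevalZ mevalXU.
have mY : mean P Y = 0.
  rewrite mean_sum => [|i]; last exact: has_momentsZ.
  by rewrite big1 // => i _; rewrite meanZ // v_centered mulr0.
have Y2 : mean P (fun w => Y w ^+ 2) = \sum_i \sum_j a i * a j * K i j.
  transitivity (mean P (fun w => \sum_i \sum_j (a i * a j) * (v i w * v j w))).
    congr (mean P _); apply/funext => w; rewrite expr2 mulr_suml.
    apply: eq_bigr => i _; rewrite mulr_sumr; apply: eq_bigr => j _; ring.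
  rewrite mean_sum => [|i].
    apply: eq_bigr => i _; rewrite mean_sum => [|j]; last exact: has_momentsZ.
    by apply: eq_bigr => j _; rewrite meanZ.
  by apply: has_moments_sum => j; exact: has_momentsZ.
have [_ rec] := gaussian_law_moments hY.1 (v_gaussian a) mY.
move=> k; transitivity (mean P (fun w => Y w ^+ k)).
  by congr (mean P _); apply/funext => w.
have [j [->|->]] : exists j, k = (2 * j)%N \/ k = (2 * j).+1.
  by exists k./2; have := odd_double_half k; case: odd => /=; lia.
- elim: j => [|j IH].
    rewrite muln0 expr0 wick1 -[RHS](mean_cst P); congr (mean P _).
  have -> : (2 * j.+1 = (2 * j).+2)%N by lia.
  by rewrite rec IH Y2 wick_linform.
- elim: j => [|j IH].
    rewrite muln0 expr1 wick_linform1 // -[RHS]mY; congr (mean P _).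
  have -> : (2 * j.+1 = (2 * j).+2)%N by lia.
  by rewrite rec IH Y2 wick_linform.
Qed.

End Wick.
End GaussianWick.

(** * Spectral theorem for real symmetric matrices *)

Section RealSpectrum.
Import -(notations) complex.
Variable R : realType.
Local Notation C := (complex R).
Local Notation toC := (@real_complex_def R (Phant R)).

(** The matrix is diagonalized over the complex numbers; being hermitian it has a real diagonal
    form, so traces and eigenvalues descend to the reals. *)
Lemma symmetric_spectrum n (A : 'M[R]_n) : A^T = A -> (0 < n)%N ->
  exists dg : 'I_n -> R, [/\ forall m, \tr (A ^+ m) = \sum_i dg i ^+ m,
    forall i, eigenvalue A (dg i) & forall a, eigenvalue A a -> exists i, a = dg i].
Proof.
move=> symA n0; pose A' : 'M[C]_n := map_mx toC A.
have rA : A' \is a realmx.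
  by apply/mxOverP => i j; rewrite mxE; apply/complex_realP; exists (A i j).
have hA : A' \is hermsymmx.
  apply: realsym_hermsym => //; apply/is_hermitianmxP; rewrite expr0 scale1r.
  by apply/matrixP => i j; rewrite !mxE -{1}symA mxE.
have nA : A' \is normalmx by exact: hermitian_normalmx.
pose Q := spectralmx A'; pose sp := spectral_diag A'.
have Qu : Q \in unitmx by exact: spectral_unit.
have eA : A' = invmx Q *m diag_mx sp *m Q by exact/orthomx_spectralP.
have spr i : sp 0 i \is Num.real.
  by have /mxOverP := hermitian_spectral_diag_real hA; apply.
pose dg i := Re (sp 0 i).
have dgE i : toC (dg i) = sp 0 i by exact: RRe_real.
exists dg; split.
- move=> m; apply: (@complexI R); rewrite -trace_map_mx.
  have -> : map_mx toC (A ^+ m) = invmx Q *m (diag_mx sp ^+ m) *m Q.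
    rewrite rmorphXn /= -/A'; elim: m => [|m IH]; first by rewrite !expr0 mulmx1 mulVmx.
    have -> : A' ^+ m.+1 = A' *m A' ^+ m by rewrite exprS.
    have -> : diag_mx sp ^+ m.+1 = diag_mx sp *m diag_mx sp ^+ m by rewrite exprS.
    by rewrite IH {1}eA !mulmxA mulmxK.
  rewrite mxtrace_mulC mulmxA mulmxV // mul1mx.
  have -> : diag_mx sp ^+ m = diag_mx (\row_i (sp 0 i ^+ m)).
    elim: m => [|m IH].
      by rewrite expr0; apply/matrixP => i j; rewrite !mxE expr0.
    have -> : diag_mx sp ^+ m.+1 = diag_mx sp *m diag_mx sp ^+ m by rewrite exprS.
    rewrite IH; apply/matrixP => i j; rewrite mul_diag_mx !mxE.
    by rewrite exprS mulrnAr.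
  rewrite mxtrace_diag rmorph_sum; apply: eq_bigr => i _.
  by rewrite mxE rmorphXn /= dgE.
(* Eigenvectors are row vectors here, so row [i] of [Q] is one for [sp 0 i]; it is nonzero because
   [Q] is invertible. *)
- move=> i; rewrite -(eigenvalue_map toC) /= dgE; apply/eigenvalueP.
  exists (row i Q); last first.
    apply: contraTneq Qu => r0; rewrite -row_free_unit; apply/negP => /row_freeP[B QB].
    have := congr1 (row i) QB; rewrite row_mul r0 mul0mx => /rowP/(_ i).
    by rewrite !mxE eqxx => /eqP; rewrite eq_sym oner_eq0.
  rewrite -/A' eA -row_mul !mulmxA mulmxV // mul1mx row_mul row_diag_mx -scalemxAl -rowE //.
- move=> a; rewrite -(eigenvalue_map toC) /= => /eigenvalueP[v va v0].
  have vQ0 : v *m invmx Q != 0.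
    by apply: contraNneq v0 => h; rewrite -(mulmxKV Qu v) h mul0mx.
  have [i vi] : exists i, (v *m invmx Q) 0 i != 0.
    apply/existsP; apply: contraNT vQ0 => /existsPn h; apply/eqP/rowP => i.
    by rewrite [RHS]mxE; apply/eqP; have := h i; rewrite negbK.
  exists i; apply: (@complexI R); rewrite dgE.
  have : (v *m invmx Q) *m diag_mx sp = toC a *: (v *m invmx Q).
    rewrite scalemxAl -va -/A' eA !mulmxA -[RHS]mulmxA mulmxV // mulmx1.
    by rewrite -!mulmxA.
  move=> /rowP/(_ i); rewrite mul_mx_diag !mxE => /eqP.
  rewrite mulrC -subr_eq0 -mulrBl mulf_eq0 => /orP[]; last first.
    by move: vi; rewrite mxE => /negbTE ->.
  by rewrite subr_eq0 => /eqP.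
Qed.

End RealSpectrum.

(** * From random matrices to polynomials in a Gaussian vector *)

Section WignerPackage.
Import -(notations) mpoly.
Import WickFunctional WignerMoments.
Context d (T : measurableType d) (R : realType) (P : probability T R).

Lemma sorted_pair_sym n (i j : 'I_n) : sorted_pair i j = sorted_pair j i.
Proof.
apply/val_inj => /=; case: (ltngtP i j) => // h.
by congr (_, _); apply/val_inj.
Qed.

Lemma sorted_pair_inj n (i j k l : 'I_n) : sorted_pair i j = sorted_pair k l ->
  (i = k /\ j = l) \/ (i = l /\ j = k).
Proof.
by move=> /(congr1 val) /=; case: ifP => _; case: ifP => _ [-> ->]; [left|right|right|left].
Qed.

Variables (n : nat) (n_gt0 : (0 < n)%N) (X : upper_index n -> {RV P >-> R}).
Hypothesis X_gaussian : gaussian_vector X.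
Hypothesis X_centered : forall p, ('E_P[X p] = 0)%E.
Hypothesis X_var : forall p, ('V_P[X p] = 1)%E.

Let N := #|{: upper_index n}|.
Let ixn (i j : 'I_n) : 'I_N := enum_rank (sorted_pair i j).
Let c : R := (Num.sqrt (n%:R : R))^-1.
Let v (q : 'I_N) (w : T) : R := c * X (enum_val q) w.
Let delta := sup_cross_moment X.

Definition spectral_moment m (w : T) : R :=
  n%:R^-1 * \tr ((c *: sym_mx (fun p => X p w)) ^+ m).

Let evalp_mpow m i j w :
  evalp v (mpow R ixn m i j) w = ((c *: sym_mx (fun p => X p w)) ^+ m) i j.
Proof.
elim: m i j => [|m IH] i j.
  rewrite mpow0 expr0 mxE /evalp.
  by case: (i == j); [exact: mpoly.meval1|exact: mpoly.meval0].
rewrite mpowS evalp_sum exprS mxE; apply: eq_bigr => k _.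
by rewrite evalpM IH; congr (_ * _); rewrite /evalp mpoly.mevalXU /v enum_rankK !mxE.
Qed.

Let evalp_tau m : evalp v (tau R ixn m) = spectral_moment m.
Proof.
apply/funext => w; rewrite /tau evalpM; congr (_ * _); first exact: mpoly.mevalC.
by rewrite evalp_sum /mxtrace; apply: eq_bigr => i _; rewrite evalp_mpow.
Qed.

Let n0 : 0 < n%:R :> R. Proof. by rewrite ltr0n. Qed.

Let cc : c * c = n%:R^-1.
Proof. by rewrite /c -invfM -expr2 sqr_sqrtr // ltW. Qed.

Let ixn_sym i j : ixn i j = ixn j i.
Proof. by rewrite /ixn sorted_pair_sym. Qed.

Let ixn_inj i j k l : ixn i j = ixn k l -> (i = k /\ j = l) \/ (i = l /\ j = k).
Proof. by move=> /enum_rank_inj; exact: sorted_pair_inj. Qed.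

Let X_meas p : measurable_fun setT (X p).
Proof. exact: measurable_funP. Qed.

Let v_meas q : measurable_fun setT (v q).
Proof. by apply: measurable_funM => //; exact: X_meas. Qed.

Let v_gaussian (a : 'I_N -> R) :
  gaussian_law (pushforward P (fun w => \sum_i a i * v i w)).
Proof.
have := X_gaussian (fun p => a (enum_rank p) * c).
congr (gaussian_law (pushforward P _)); apply/funext => w.
rewrite (reindex (fun i : 'I_N => enum_val i)) /=; last by apply: onW_bij; exact: enum_val_bij.
by apply: eq_bigr => i _; rewrite enum_valK mulrA.
Qed.

Let X_moments p : has_moments P (X p).
Proof.
apply: (gaussian_law_moments (X_meas p) _ _).1; last first.
  by rewrite /mean /Rintegral; have := X_centered p; rewrite unlock => ->.
have := X_gaussian (fun q => (q == p)%:R).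
rewrite (_ : (fun w => _) = X p) //; apply/funext => w.
rewrite (bigD1 p) //= eqxx mul1r big1 ?addr0 // => q qp.
by rewrite (negbTE qp) mul0r.
Qed.

Let X_mean0 p : mean P (X p) = 0.
Proof. by rewrite /mean /Rintegral; have := X_centered p; rewrite unlock => ->. Qed.

Let v_centered q : mean P (v q) = 0.
Proof. by rewrite /v meanZ // X_mean0 mulr0. Qed.

Let XX p q : has_moments P (fun w => X p w * X q w). Proof. exact: has_momentsM. Qed.

Let S p q := mean P (fun w => v p w * v q w).

Let SE p q : S p q = n%:R^-1 * mean P (fun w => X (enum_val p) w * X (enum_val q) w).
Proof.
rewrite -cc -meanZ //; congr (mean P _); apply/funext => w; rewrite /v; ring.
Qed.

Let S_sym p q : S p q = S q p.
Proof. by congr (mean P _); apply/funext => w; rewrite mulrC. Qed.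

Let S_diag p : S p p = n%:R^-1.
Proof.
rewrite SE; have := X_var (enum_val p); rewrite /variance covariance.unlock X_centered /=.
rewrite expectation.unlock => h; rewrite /mean /Rintegral.
rewrite (_ : (\int[P]_x _)%E = 1%E) ?mulr1 // -h.
apply: eq_integral => w _; congr EFin.
by rewrite -[RHS]/((X (enum_val p) w - 0) * (X (enum_val p) w - 0)) subr0.
Qed.

Let cross_set := [set `|fine 'E_P[X pq.1 \* X pq.2]| |
  pq in [set pq : upper_index n * upper_index n | pq.1 != pq.2]].

Let cross_ub : has_ubound cross_set.
Proof.
exists (\sum_(pq : upper_index n * upper_index n) `|fine 'E_P[X pq.1 \* X pq.2]|).
move=> _ [pq _ <-]; rewrite (bigD1 pq) //= lerDl; exact: sumr_ge0.
Qed.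

Let delta_ge0 : 0 <= delta.
Proof.
(* For $n=1$ there is no pair of distinct indices, and the supremum of the empty set is 0. *)
have [[x cx]|/set0P/negP/negPn/eqP e] := pselect (cross_set !=set0).
  by apply: le_trans (ub_le_sup cross_ub cx); case: cx => pq _ <-.
by rewrite /delta /sup_cross_moment -/cross_set e sup0.
Qed.

Let S_off p q : p != q -> `|S p q| <= n%:R^-1 * delta.
Proof.
move=> pq; rewrite SE normrM ger0_norm ?invr_ge0 ?(ltW n0) // ler_wpM2l ?invr_ge0 ?(ltW n0) //.
apply: (ub_le_sup cross_ub); exists (enum_val p, enum_val q) => /=.
  by apply: contraNneq pq => /enum_val_inj ->.
by rewrite expectation.unlock.
Qed.

Let mean_wick p : mean P (evalp v p) = wick S p.
Proof. exact: (mean_evalp v_gaussian v_meas v_centered). Qed.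

Lemma has_moments_spectral m : has_moments P (spectral_moment m).
Proof.
rewrite -evalp_tau; apply: has_moments_evalp => q; exact: has_momentsZ.
Qed.

Lemma mean_spectral0 : mean P (spectral_moment 0) = 1.
Proof. by rewrite -evalp_tau mean_wick tau0 // wick1. Qed.

Lemma mean_spectral_rec eta m : n%:R^-1 <= eta -> n%:R * delta <= eta -> eta <= 1 ->
  `|mean P (spectral_moment m.+1) -
    \sum_(a < m) mean P (spectral_moment a) * mean P (spectral_moment (m - a.+1))| <=
  eta * rec_cst R m.
Proof.
move=> h1 h2 h3; rewrite -evalp_tau mean_wick.
under eq_bigr do rewrite -!evalp_tau !mean_wick.
exact: (tau_rec_bound n_gt0 ixn_sym ixn_inj delta_ge0 S_sym S_diag S_off).
Qed.

Lemma spectral_variance m : n%:R * delta <= 1 ->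
  mean P (fun w => (spectral_moment m w - mean P (spectral_moment m)) ^+ 2) <=
  n%:R^-1 ^+ 2 * (3 * (m%:R * m%:R) * moment_cst R (m + m)).
Proof.
move=> h; have := tau_cov_bound n_gt0 ixn_sym ixn_inj delta_ge0 S_sym S_diag S_off m m h.
apply: le_trans; apply: le_trans (ler_norm _); rewrite -!mean_wick.
have hs := has_moments_spectral m.
rewrite [evalp v (_ * _)%R](_ : _ = (fun w => spectral_moment m w * spectral_moment m w)); last first.
  by apply/funext => w; rewrite evalpM evalp_tau.
rewrite evalp_tau; set mu := mean P (spectral_moment m).
have e : (fun w => (spectral_moment m w - mu) ^+ 2) = (fun w =>
    (spectral_moment m w * spectral_moment m w + (- 2 * mu) * spectral_moment m w) + mu ^+ 2).
  by apply/funext => w; ring.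
rewrite e meanD; [|apply: has_momentsD; [exact: has_momentsM|exact: has_momentsZ]
  |exact: has_moments_cst].
rewrite meanD; [|exact: has_momentsM|exact: has_momentsZ].
rewrite meanZ // -/mu (mean_cst P (mu ^+ 2)) le_eqVlt; apply/orP; left; apply/eqP; ring.
Qed.

Lemma mean_spectral_le eta theta K : n%:R^-1 <= eta -> n%:R * delta <= eta -> 0 < theta ->
  (1 + eta) * (1 + (K.+1%:R)^-1) + 2 * K%:R * eta + 6 * K%:R * K.+1%:R ^+ 4 * eta
    <= theta ^+ 2 ->
  mean P (spectral_moment (2 * K)) <= (2 * theta) ^+ (2 * K).
Proof.
move=> h1 h2 h3 h4; rewrite -evalp_tau mean_wick.
exact: (tau_moment_le n_gt0 ixn_sym ixn_inj delta_ge0 S_diag S_off h1 h2 h3 h4).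
Qed.

Lemma sup_cross_moment_ge0 : 0 <= sup_cross_moment X.
Proof. exact: delta_ge0. Qed.

End WignerPackage.

(** * Traces of powers, the top eigenvalue and Catalan growth *)

Section SpectralBounds.
Variable R : realType.

Lemma sym_mx_tr n (x : upper_index n -> R) (c : R) : (c *: sym_mx x)^T = c *: sym_mx x.
Proof.
apply/matrixP => i j; rewrite !mxE; congr (_ * x _); apply/val_inj => /=.
case: (ltngtP i j) => // h; by congr (_, _); apply/val_inj.
Qed.

(** Each eigenvalue contributes $x^{2k}(1+x)$. This is nonpositive for $x\le -1$, and at most
    $c^{2k}(1+c)\le 2c^{2k+1}$ for $-1<x\le c$: the odd power disarms the negative eigenvalues,
    which [lambda1] does not control. *)
Lemma trace_le_of_lambda1 n (A : 'M[R]_n) c k : A^T = A -> (0 < n)%N -> 1 <= c ->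
  lambda1 A <= c -> \tr (A ^+ (2 * k)) + \tr (A ^+ (2 * k).+1) <= n%:R * (2 * c ^+ (2 * k).+1).
Proof.
move=> symA n0 c1 lc; have [dg [trE dgA Adg]] := symmetric_spectrum symA n0.
have ub : has_ubound [set a : R | eigenvalue A a].
  exists (\sum_i `|dg i|) => _ /= /Adg[i ->]; apply: le_trans (ler_norm _) _.
  by rewrite (bigD1 i) //= lerDl; exact: sumr_ge0.
have dc i : dg i <= c by apply: le_trans lc; apply: ub_le_sup => //; exact: dgA.
rewrite !trE -big_split /= -[n in n%:R]card_ord mulr_natl -sumr_const.
apply: ler_sum => i _; set x := dg i; rewrite [x ^+ _.+1]exprSr -[X in X + _]mulr1 -mulrDr.
have p0 : 0 <= x ^+ (2 * k) by rewrite exprM exprn_ge0 ?sqr_ge0.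
have c0 : 0 <= c by rewrite (le_trans ler01).
have [x1|x1] := leP (1 + x) 0.
  apply: le_trans (_ : 0 <= _); last by rewrite mulr_ge0 ?exprn_ge0.
  by rewrite mulr_ge0_le0.
rewrite exprSr mulrCA; apply: ler_pM => //; first exact: ltW.
  have xc : x ^+ 2 <= c ^+ 2.
    rewrite -subr_ge0 subr_sqr mulr_ge0 ?subr_ge0 //; first exact: dc.
    by move: x1 c1; clear; lra.
  by rewrite !exprM; apply: lerXn2r; rewrite ?nnegrE ?sqr_ge0.
by have := dc i; rewrite -/x; move: c1; clear; lra.
Qed.

Lemma trace_ge_of_lambda1 n (A : 'M[R]_n) b k : A^T = A -> (0 < n)%N -> 0 <= b ->
  b < lambda1 A -> b ^+ (2 * k) <= \tr (A ^+ (2 * k)).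
Proof.
move=> symA n0 b0 lb; have [dg [trE dgA Adg]] := symmetric_spectrum symA n0.
have ne : [set a : R | eigenvalue A a] !=set0 by exists (dg (Ordinal n0)); exact: dgA.
have [y /= /Adg[i ->] bi] := sup_gt ne lb.
rewrite trE (bigD1 i) //=; apply: le_trans (_ : dg i ^+ (2 * k) <= _); last first.
  by rewrite lerDl sumr_ge0 // => j _; rewrite exprM exprn_ge0 ?sqr_ge0.
have di := le_trans b0 (ltW bi).
by apply: lerXn2r; rewrite ?nnegrE //; exact: ltW.
Qed.

(** By [catalan_ge] it suffices that $(4/c^2)^k$ beats $2c(k+1)^2$, which the cubic term of the
    exponential series settles. *)
Lemma catalan_beats (c : R) : 1 <= c -> c < 2 -> exists k, 2 * c ^+ (2 * k).+1 < Catalan.catalan R k.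
Proof.
move=> c1 c2; have c0 : 0 < c by rewrite (lt_le_trans ltr01).
pose q := 4 / c ^+ 2; have cc : 0 < c ^+ 2 by rewrite exprn_gt0.
have q1 : 1 < q by rewrite /q ltr_pdivlMr // mul1r expr2; nra.
have q0 : 0 < q by rewrite (lt_trans ltr01).
pose a := ln q; have a0 : 0 < a by rewrite ln_gt0.
(* Since $2c(k+1)^2\le 8ck^2$ and $q^k\ge (ka)^3/6$, it is enough that $48c<ka^3$. *)
pose k := (Num.truncn (48 * c / a ^+ 3)).+1; exists k.
have k1 : 1 <= k%:R :> R by rewrite ler1n.
have hk : 48 * c < k%:R * a ^+ 3.
  by rewrite -ltr_pdivrMr ?exprn_gt0 // truncnS_gt.
have h1 : k%:R ^+ 3 * a ^+ 3 / 6 <= q ^+ k.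
  have -> : q ^+ k = expR (k%:R * a) by rewrite expRM_natl lnK.
  have ka0 : 0 <= k%:R * a by rewrite mulr_ge0 ?ler0n ?ltW.
  have := expR_ge1Dxn 2 ka0; rewrite exprMn => h; apply: le_trans h.
  by rewrite -[X in X <= _]add0r lerD.
have h2 : 2 * c * (k.+1%:R) ^+ 2 < q ^+ k.
  apply: lt_le_trans h1; rewrite -(natr1 k); set x : R := k%:R in k1 hk *.
  apply: le_lt_trans (_ : 8 * c * x ^+ 2 < _).
    have -> : 8 * c * x ^+ 2 = 2 * c * (4 * x ^+ 2) by ring.
    by rewrite ler_wpM2l ?mulr_ge0 ?(ltW c0) //; nra.
  have x2 : 0 < x ^+ 2 by rewrite exprn_gt0 // (lt_le_trans ltr01).
  have -> : x ^+ 3 * a ^+ 3 / 6 = (x * a ^+ 3 / 6) * x ^+ 2 by ring.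
  by rewrite ltr_pM2r //; lra.
have k0 : 0 < (k.+1%:R : R) ^+ 2 by rewrite exprn_gt0 // ltr0n.
rewrite -(ltr_pM2l k0); apply: lt_le_trans (Catalan.catalan_ge R k).
have -> : 4 ^+ k = q ^+ k * c ^+ (2 * k) by rewrite exprM -exprMn /q divfK // gt_eqF.
have -> : k.+1%:R ^+ 2 * (2 * c ^+ (2 * k).+1) = 2 * c * k.+1%:R ^+ 2 * c ^+ (2 * k) :> R.
  by rewrite [c ^+ _.+1]exprS; move: (c ^+ (2 * k)) (k.+1%:R ^+ 2) => y z; ring.
by rewrite ltr_pM2r // exprn_gt0.
Qed.

Definition semicircle_moment m : R := if odd m then 0 else Catalan.catalan R m./2.

Lemma semicircle_moment_even k : semicircle_moment (2 * k) = Catalan.catalan R k.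
Proof. by rewrite /semicircle_moment mul2n odd_double doubleK. Qed.

Lemma semicircle_moment_odd k : semicircle_moment (2 * k).+1 = 0.
Proof. by rewrite /semicircle_moment mul2n /= odd_double. Qed.

(** When [m] is even, one of the indices $a$ and $m-a-1$ is odd; when [m] is odd, the even pairs
    form Segner's convolution. *)
Lemma semicircle_moment_rec m : semicircle_moment m.+1 =
  \sum_(a < m) semicircle_moment a * semicircle_moment (m - a.+1).
Proof.
have sum_parity (f : nat -> R) k :
    \sum_(i < (2 * k)) f i = \sum_(i < k) (f (2 * i)%N + f (2 * i).+1).
  elim: k => [|k IH]; first by rewrite muln0 !big_ord0.
  by rewrite mulnS big_ord_recr big_ord_recr IH [RHS]big_ord_recr /= addrA.
have [k [->|->]] : exists k, m = (2 * k)%N \/ m = (2 * k).+1.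
  by exists m./2; have := odd_double_half m; case: odd => /=; lia.
  rewrite semicircle_moment_odd big1 // => a _; rewrite /semicircle_moment.
  have -> : odd (2 * k - a.+1) = ~~ odd a by have := ltn_ord a; lia.
  by case: odd; rewrite ?mul0r ?mulr0.
have -> : (2 * k).+2 = (2 * k.+1)%N by lia.
rewrite semicircle_moment_even -Catalan.catalan_segner.
rewrite [RHS]big_ord_recr /= (sum_parity (fun a => semicircle_moment a *
  semicircle_moment ((2 * k).+1 - a.+1)%N)) big_ord_recr /= subnn.
congr (_ + _); last by rewrite semicircle_moment_even subnn.
apply: eq_bigr => i _; have ik := ltn_ord i.
have -> : ((2 * k).+1 - (2 * i).+1 = 2 * (k - i))%N by lia.
by rewrite !semicircle_moment_even semicircle_moment_odd mul0r addr0.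
Qed.

End SpectralBounds.

(** * Markov's inequality and Borel-Cantelli *)

Section BorelCantelli.
Context d (T : measurableType d) (R : realType) (P : probability T R).

Lemma mean_markov (f : T -> R) (b : R) : has_moments P f -> (forall w, 0 <= f w) -> 0 < b ->
  measurable [set w : T | (b <= f w)%R] /\ (P [set w : T | (b <= f w)%R] <= (mean P f / b)%:E)%E.
Proof.
move=> hf f0 b0; have mf := hf.1.
have mS : measurable [set w : T | (b <= f w)%R].
  have := @measurable_fun_le _ _ _ setT (cst b) f measurableT.
  by rewrite setTI; apply=> //; exact: measurable_cst.
split=> //.
have mEf : measurable_fun setT (EFin \o f) by apply/measurable_EFinP.
have := @le_integral_abse _ _ _ P setT measurableT (EFin \o f) b mEf b0.
rewrite setTI (_ : [set x | _] = [set w : T | (b <= f w)%R]); last first.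
  by apply/seteqP; split=> w /=; rewrite lee_fin ger0_norm.
rewrite (eq_integral (EFin \o f)); last by move=> w _; rewrite /= ger0_norm.
have fin := integrable_fin_num measurableT (has_moments_integrable hf).
rewrite -[X in (_ <= X)%E -> _]fineK // -/(mean P f) => h.
by rewrite EFinM lee_pdivlMr // muleC.
Qed.

Lemma sum_inv_sqr_le (n : nat) : \sum_(k < n) (k.+1%:R ^+ 2)^-1 <= 2 :> R.
Proof.
case: n => [|n]; first by rewrite big_ord0.
(* Strengthened so that the induction closes: $1/(n+2)^2\le 1/(n+1)-1/(n+2)$. *)
suff h : \sum_(k < n.+1) (k.+1%:R ^+ 2)^-1 <= 2 - (n%:R + 1)^-1 :> R.
  by apply: le_trans h _; rewrite gerBl invr_ge0 addr_ge0 ?ler0n.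
elim: n => [|n IH]; first by rewrite big_ord_recr big_ord0 /= expr1n !add0r invr1; lra.
rewrite big_ord_recr /=; apply: le_trans (lerD IH (lexx _)) _.
rewrite -(natr1 n.+1) -(natr1 n); set x : R := n%:R; have x0 : 0 <= x by exact: ler0n.
rewrite -subr_ge0.
have -> : 2 - (x + 1 + 1)^-1 - (2 - (x + 1)^-1 + ((x + 1 + 1) ^+ 2)^-1) =
  ((x + 1) * (x + 1 + 1) ^+ 2)^-1 by field; rewrite !gt_eqF //; lra.
by rewrite invr_ge0 mulr_ge0 ?sqr_ge0 //; lra.
Qed.

(** The hypotheses hold only from [n0] on; shifting by [n0.+1] gives a sequence controlled
    everywhere and avoids $n=0$. *)
Lemma borel_cantelli_sqr (E : nat -> set T) (C : R) (n0 : nat) : 0 <= C ->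
  (forall n, (n0 <= n)%N -> measurable (E n)) ->
  (forall n, (n0 <= n)%N -> (P (E n) <= (C * (n%:R^-1 ^+ 2))%:E)%E) ->
  {ae P, forall w, \forall n \near \oo, ~ E n w}.
Proof.
move=> C0 mE hE; pose F n := E (n + n0.+1)%N.
have mF k : measurable (F k) by apply: mE; lia.
have hF k : (P (F k) <= (C * (k.+1%:R ^+ 2)^-1)%:E)%E.
  apply: le_trans (hE _ _) _; first by lia.
  rewrite lee_fin ler_wpM2l // -exprVn; apply: lerXn2r; rewrite ?nnegrE ?invr_ge0 ?ler0n //.
  by rewrite lef_pV2 ?posrE ?ltr0n // ?ler_nat; lia.
have sumF : (\sum_(n <oo) P (F n) < +oo)%E.
  apply: (@le_lt_trans _ _ (C * 2)%:E); last exact: ltry.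
  apply: lime_le; first by apply: is_cvg_nneseries => n _ _; exact: measure_ge0.
  apply: nearW => n; rewrite big_mkord.
  apply: (@le_trans _ _ (\sum_(k < n) (C * (k.+1%:R ^+ 2)^-1)%:E)%E).
    by apply: lee_sum => k _; exact: hF.
  by rewrite sumEFin lee_fin -mulr_sumr ler_wpM2l // sum_inv_sqr_le.
have h0 := lim_sup_set_cvg0 mF sumF.
exists (lim_sup_set F); split => //.
  by apply: bigcap_measurable => // k _; apply: bigcup_measurable.
move=> w /= hw; apply: contrapT => nw; apply: hw.
have [k hk] : exists k, forall j, (k <= j)%N -> ~ F j w.
  apply: contrapT => h; apply: nw => k _; apply: contrapT => h'; apply: h; exists k => j kj Fj.
  by apply: h'; exists j.
exists (k + n0.+1)%N => // n /= hn En; apply: (hk (n - n0.+1)%N); first by lia.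
by rewrite /F subnK //; lia.
Qed.

End BorelCantelli.

(** * Polynomial rates against powers of the logarithm *)

Section Rates.
Variable R : realType.

Lemma trunc_log_large (x : R) : \forall n \near \oo, (0 < n)%N /\ x <= (trunc_log 2 n)%:R.
Proof.
exists (2 ^ (Num.truncn x).+1)%N => // n /= hn; have n0 : (0 < n)%N.
  by apply: leq_trans hn; rewrite expn_gt0.
split=> //; apply: ltW; apply: lt_le_trans (truncnS_gt x) _.
by rewrite ler_nat; apply: trunc_log_max.
Qed.

(** Both terms are $O(n^{-\min(1,\epsilon)})$, smaller than any inverse power of the logarithm. The
    power 6 is one above the degree 5 in $K$ of the moment condition. *)
Lemma rate_bound (eps : R) (delta : nat -> R) : 0 < eps -> (forall n, 0 <= delta n) ->
  delta =O_\oo (fun n : nat => (n%:R `^ (1 + eps))^-1) ->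
  exists2 C, 0 <= C & \forall n \near \oo,
    (n%:R^-1 + n%:R * delta n) * (trunc_log 2 n)%:R ^+ 6 <= C.
Proof.
move=> eps0 d0 /eqO_exP[k k0 hk]; pose e := Num.min 1 eps.
have e0 : 0 < e by rewrite lt_min ltr01.
have ln20 : 0 < ln (2 : R) by rewrite ln_gt0 // ltr1n.
pose a := e * ln 2; have a0 : 0 < a by rewrite mulr_gt0.
have [F F0 hF] : exists2 F, 0 < F & forall y : R, 0 <= y -> y ^+ 6 / F <= expR y.
  exists (6`!%:R); first by rewrite ltr0n fact_gt0.
  by move=> y y0; apply: le_trans (expR_ge1Dxn 5 y0); rewrite lerDr.
exists ((1 + k) * (F / a ^+ 6)).
  by rewrite mulr_ge0 ?addr_ge0 ?(ltW k0) // divr_ge0 ?exprn_ge0 ?(ltW F0) ?(ltW a0).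
near=> n; have n0 : (0 < n)%N by near: n; exists 1%N.
set x : R := n%:R; have x0 : 0 < x by rewrite ltr0n.
have x1 : 1 <= x by rewrite ler1n.
have hd : delta n <= k * (x `^ (1 + eps))^-1.
  have : `|delta n| <= k * `|(n%:R `^ (1 + eps))^-1| by near: n; exact: hk.
  by rewrite (ger0_norm (d0 n)) ger0_norm // invr_ge0 powR_ge0.
have pe : 0 < x `^ e by rewrite powR_gt0.
have peps : 0 < x `^ eps by rewrite powR_gt0.
have h1 : x^-1 <= (x `^ e)^-1.
  rewrite lef_pV2 ?posrE // -[X in _ <= X](powRr1 (ltW x0)).
  by apply: ler_powR => //; rewrite ge_min lexx.
have h2 : x * delta n <= k * (x `^ e)^-1.
  apply: le_trans (ler_wpM2l (ltW x0) hd) _.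
  have -> : x `^ (1 + eps) = x * x `^ eps.
    rewrite powRD; last by rewrite (gt_eqF x0) implybT.
    by rewrite powRr1 // ltW.
  have -> : x * (k / (x * x `^ eps)) = k * (x `^ eps)^-1 by field; rewrite !gt_eqF.
  rewrite ler_wpM2l ?(ltW k0) // lef_pV2 ?posrE //.
  by apply: ler_powR => //; rewrite ge_min lexx orbT.
set t : R := (trunc_log 2 n)%:R; have t0 : 0 <= t by exact: ler0n.
have h3 : a ^+ 6 * t ^+ 6 / F <= x `^ e.
  rewrite /powR gt_eqF // -exprMn.
  have at0 : 0 <= a * t by rewrite mulr_ge0 // ltW.
  have tl : a * t <= e * ln x.
    rewrite /a -mulrA ler_wpM2l ?(ltW e0) // mulr_natr -lnXn // ler_ln ?posrE ?exprn_gt0 //.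
    by rewrite -natrX ler_nat trunc_logP.
  apply: le_trans (_ : expR (a * t) <= _); last by rewrite ler_expR.
  exact: hF.
have h4 : t ^+ 6 <= F / a ^+ 6 * x `^ e.
  apply: le_trans (_ : F / a ^+ 6 * (a ^+ 6 * t ^+ 6 / F) <= _).
    by rewrite le_eqVlt; apply/orP; left; apply/eqP; field; rewrite !gt_eqF.
  by rewrite ler_wpM2l // divr_ge0 ?exprn_ge0 ?(ltW F0) ?(ltW a0).
apply: le_trans (_ : ((1 + k) * (x `^ e)^-1) * (F / a ^+ 6 * x `^ e) <= _).
  apply: ler_pM; rewrite ?exprn_ge0 ?addr_ge0 ?invr_ge0 ?mulr_ge0 ?(ltW x0) //.
  by rewrite mulrDl mul1r lerD.
by rewrite le_eqVlt; apply/orP; left; apply/eqP; field; rewrite !gt_eqF.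
Unshelve. all: by end_near. Qed.

Variables (eta : nat -> R) (C : R).
Hypotheses (eta_ge0 : forall n, 0 <= eta n) (C_ge0 : 0 <= C).
Hypothesis eta_rate : \forall n \near \oo, eta n * (trunc_log 2 n)%:R ^+ 6 <= C.

Lemma rate_small (e : R) : 0 < e -> \forall n \near \oo, eta n <= e.
Proof.
move=> e0; near=> n.
have [_ h1] : (0 < n)%N /\ 1 + C / e <= (trunc_log 2 n)%:R by near: n; exact: trunc_log_large.
have h2 : eta n * (trunc_log 2 n)%:R ^+ 6 <= C by near: n.
move: h1 h2; set t : R := _%:R => h1 h2.
have Ce : 0 <= C / e by rewrite divr_ge0 // ltW.
have t1 : 1 <= t by lra.
have t6 : t <= t ^+ 6 by rewrite exprS ler_peMr ?exprn_ege1 //; lra.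
have h3 : eta n * t <= C by apply: le_trans h2; rewrite ler_wpM2l.
rewrite -(ler_pM2r (_ : 0 < t)); last by lra.
apply: le_trans h3 _; rewrite -ler_pdivrMl // mulrC; lra.
Unshelve. all: by end_near. Qed.

Lemma rate_condition (theta : R) (c : nat) : 1 < theta ->
  \forall n \near \oo, forall K : nat, K = (c.+1 * trunc_log 2 n)%N ->
  (1 + eta n) * (1 + (K.+1%:R : R)^-1) + 2 * K%:R * eta n + 6 * K%:R * K.+1%:R ^+ 4 * eta n
    <= theta ^+ 2.
Proof.
(* With $t$ the logarithm, the left side exceeds 1 by at most $M/t$: the 1 in [M] comes from
   $1/(K+1)$, and $10=2+2+6$ counts the multiples of $(K+1)^5\eta_n$, itself at most
   $(c+2)^5C/t$. *)
move=> th1; pose M := 1 + 10 * c.+2%:R ^+ 5 * C.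
have th2 : 0 < theta ^+ 2 - 1 by rewrite expr2; nra.
near=> n => K KD.
have [_ h1] : (0 < n)%N /\ 1 + M / (theta ^+ 2 - 1) <= (trunc_log 2 n)%:R.
  by near: n; exact: trunc_log_large.
have h2 : eta n * (trunc_log 2 n)%:R ^+ 6 <= C by near: n.
have M0 : 0 <= M by rewrite /M addr_ge0 ?mulr_ge0 ?exprn_ge0 ?ler0n.
have t1 : 1 <= (trunc_log 2 n)%:R :> R.
  by apply: le_trans h1; rewrite lerDl divr_ge0 // ltW.
have KE : K%:R = c.+1%:R * (trunc_log 2 n)%:R :> R by rewrite KD natrM.
have K1E : K.+1%:R = K%:R + 1 :> R by rewrite natr1.
have c0 : 0 <= c.+1%:R :> R by exact: ler0n.
have c2E : c.+2%:R = c.+1%:R + 1 :> R by rewrite natr1.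
have e0 := eta_ge0 n.
move: h1 h2 t1 KE; set t : R := (trunc_log 2 n)%:R => h1 h2 t1 KE.
have K0 : 0 <= K%:R :> R by exact: ler0n.
set y : R := K.+1%:R in K1E *; have y1 : 1 <= y by rewrite K1E; lra.
have y0 : 0 <= y by lra.
have ty : t <= y.
  have : t <= c.+1%:R * t by rewrite ler_peMl ?ler1n //; lra.
  by rewrite K1E KE; move=> ?; lra.
have yc : y <= c.+2%:R * t by rewrite K1E KE c2E mulrDl mul1r lerD2l.
have iy : y^-1 <= t^-1 by rewrite lef_pV2 // posrE; lra.
have iy1 : y^-1 <= 1 by rewrite invf_le1 //; lra.
have iy0 : 0 <= y^-1 by rewrite invr_ge0.
have y5 : y ^+ 5 <= c.+2%:R ^+ 5 * t ^+ 5.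
  by rewrite -exprMn; apply: lerXn2r; rewrite ?nnegrE // mulr_ge0 ?ler0n //; lra.
have y51 : 1 <= y ^+ 5 by exact: exprn_ege1.
have yy5 : y <= y ^+ 5 by rewrite exprS ler_peMr // exprn_ege1.
have Ky : K%:R <= y by rewrite K1E; lra.
have A1 : (1 + eta n) * (1 + y^-1) <= 1 + t^-1 + 2 * (y ^+ 5 * eta n).
  have p1 : eta n <= y ^+ 5 * eta n by rewrite ler_peMl.
  have p2 : eta n * y^-1 <= eta n by rewrite ler_piMr.
  have -> : (1 + eta n) * (1 + y^-1) = 1 + (y^-1 + (eta n + eta n * y^-1)) by ring.
  have -> : 1 + t^-1 + 2 * (y ^+ 5 * eta n) =
    1 + (t^-1 + (y ^+ 5 * eta n + y ^+ 5 * eta n)) by ring.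
  by rewrite lerD2l lerD // lerD // (le_trans p2).
have A2 : 2 * K%:R * eta n <= 2 * (y ^+ 5 * eta n).
  by rewrite -mulrA ler_pM2l // ler_wpM2r // (le_trans Ky).
have A3 : 6 * K%:R * y ^+ 4 * eta n <= 6 * (y ^+ 5 * eta n).
  have -> : 6 * K%:R * y ^+ 4 * eta n = 6 * (K%:R * y ^+ 4 * eta n) by ring.
  rewrite ler_pM2l // ler_wpM2r //.
  by rewrite [y ^+ 5]exprS ler_wpM2r // exprn_ge0.
have A4 : y ^+ 5 * eta n <= c.+2%:R ^+ 5 * C / t.
  apply: le_trans (ler_wpM2r e0 y5) _; rewrite ler_pdivlMr; last by lra.
  apply: le_trans (_ : c.+2%:R ^+ 5 * (eta n * t ^+ 6) <= _).
    by rewrite le_eqVlt; apply/orP; left; apply/eqP; ring.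
  by rewrite ler_wpM2l // exprn_ge0 // ler0n.
have A5 : t^-1 + 10 * (c.+2%:R ^+ 5 * C / t) <= theta ^+ 2 - 1.
  have -> : t^-1 + 10 * (c.+2%:R ^+ 5 * C / t) = M / t by rewrite /M; field; lra.
  rewrite ler_pdivrMr; last by lra.
  by rewrite mulrC -ler_pdivrMr //; lra.
apply: le_trans (lerD (lerD A1 A2) A3) _.
set z := y ^+ 5 * eta n in A4 *.
have -> : 1 + t^-1 + 2 * z + 2 * z + 6 * z = 1 + (t^-1 + 10 * z) by ring.
by rewrite -lerBrDl; apply: le_trans A5; rewrite lerD2l ler_pM2l.
Unshelve. all: by end_near. Qed.

End Rates.

(** Making $\rho^{c+1}\le 1/8$ turns the power into $8^{-\lfloor\log_2 n\rfloor}\le(2/n)^3$. The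
    cube leaves $n^{-2}$ after the factor $n$ lost between the top eigenvalue and the normalized
    trace. *)
Lemma geometric_le_inv_cube (R : realType) (rho : R) : 0 < rho -> rho < 1 ->
  exists c, forall n, (0 < n)%N -> rho ^+ (c.+1 * trunc_log 2 n) <= 8 * n%:R^-1 ^+ 3.
Proof.
move=> r0 r1; pose a := ln rho^-1.
have a0 : 0 < a by rewrite ln_gt0 // invf_gt1.
pose c := Num.truncn (8 / a); exists c => n n0.
have hc : rho ^+ c.+1 <= 8^-1.
  rewrite -[rho]invrK exprVn lef_pV2 ?posrE ?exprn_gt0 ?invr_gt0 //.
  have -> : rho^-1 ^+ c.+1 = expR (c.+1%:R * a) by rewrite expRM_natl lnK // posrE invr_gt0.
  apply: le_trans (expR_ge1Dx _); apply: le_trans (_ : c.+1%:R * a <= _).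
    by rewrite -ler_pdivrMr // ltW // truncnS_gt.
  by rewrite lerDr.
rewrite exprM; apply: le_trans (_ : 8^-1 ^+ trunc_log 2 n <= _).
  by apply: lerXn2r; rewrite ?nnegrE ?exprn_ge0 ?invr_ge0 ?(ltW r0).
have -> : (8^-1 : R) ^+ trunc_log 2 n = 8 * ((2 ^ (trunc_log 2 n).+1)%:R)^-1 ^+ 3.
  rewrite expnS natrM natrX; set p : R := 2 ^+ _.
  have p0 : p != 0 by rewrite expf_neq0 // pnatr_eq0.
  have -> : (8^-1 : R) ^+ trunc_log 2 n = p^-1 ^+ 3.
    by rewrite !exprVn /p -exprM mulnC exprM; congr ((_ ^+ _)^-1); ring.
  by field.
rewrite ler_wpM2l //; apply: lerXn2r; rewrite ?nnegrE ?invr_ge0 ?ler0n //.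
rewrite lef_pV2 ?posrE ?ltr0n ?expn_gt0 // ler_nat ltnW // trunc_log_ltn //.
Qed.

Lemma cvg_sumr (R : realType) I (r : seq I) (f : I -> nat -> R) (l : I -> R) :
  (forall i, f i n @[n --> \oo] --> l i) ->
  (\sum_(i <- r) f i n) @[n --> \oo] --> \sum_(i <- r) l i.
Proof.
move=> fl; elim: r => [|i r IH].
  rewrite big_nil (_ : (fun n => _) = cst 0); first exact: cvg_cst.
  by apply/funext => n; rewrite big_nil.
rewrite big_cons (_ : (fun n => _) = (fun n => f i n + \sum_(j <- r) f j n)).
  exact: cvgD.
by apply/funext => n; rewrite big_cons.
Qed.

(** * Almost sure convergence *)

Section AlmostSure.
Context (R : realType) (d : measure_display) (T : measurableType d) (P : probability T R).
Variables (eps : R) (eps_gt0 : 0 < eps) (X : forall n : nat, upper_index n -> {RV P >-> R}).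
Hypothesis X_gaussian : forall n, (0 < n)%N -> gaussian_vector (@X n).
Hypothesis X_centered : forall n (p : upper_index n), (0 < n)%N -> ('E_P[X p] = 0)%E.
Hypothesis X_var : forall n (p : upper_index n), (0 < n)%N -> ('V_P[X p] = 1)%E.
Hypothesis X_cross : (fun n : nat => sup_cross_moment (@X n)) =O_\oo
  (fun n : nat => (n%:R `^ (1 + eps))^-1).

Let delta n := sup_cross_moment (@X n).
Let eta n : R := n%:R^-1 + n%:R * delta n.
Let A n w : 'M[R]_n := (Num.sqrt (n%:R : R))^-1 *: sym_mx (fun p => X p w).
Let sm n m : T -> R := spectral_moment (@X n) m.

Let delta_ge0 n : 0 <= delta n. Proof. exact: sup_cross_moment_ge0. Qed.

Let eta_ge0 n : 0 <= eta n.
Proof. by rewrite addr_ge0 ?invr_ge0 ?mulr_ge0 ?ler0n. Qed.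

Let eta1 n : n%:R^-1 <= eta n. Proof. by rewrite lerDl mulr_ge0 ?ler0n. Qed.

Let eta2 n : n%:R * delta n <= eta n. Proof. by rewrite lerDr invr_ge0 ler0n. Qed.

Let eta_small (e : R) : 0 < e -> \forall n \near \oo, eta n <= e.
Proof. by have [C C0 hC] := rate_bound eps_gt0 delta_ge0 X_cross; exact: rate_small C0 hC _. Qed.

Let sm_moments n m : (0 < n)%N -> has_moments P (sm n m).
Proof.
move=> n0; apply: has_moments_spectral => //; first exact: X_gaussian.
by move=> p; exact: X_centered.
Qed.

(** The error in the trace recursion vanishes, leaving the recursion of the semicircle moments;
    strong induction, since the recursion reaches back to all smaller orders. *)
Lemma mean_spectral_cvg m : mean P (sm n m) @[n --> \oo] --> semicircle_moment R m.
Proof.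
move: {2}m.+1 (ltnSn m) => B; elim: B m => // B IH [|m] hm.
  apply: cvg_near_cst; exists 1%N => // n /= n0.
  transitivity (1 : R); last by [].
  exact: (mean_spectral0 n0 (X_gaussian n0) (fun p => X_centered p n0)).
pose s n := \sum_(a < m) mean P (sm n a) * mean P (sm n (m - a.+1)).
have cs : s n @[n --> \oo] --> semicircle_moment R m.+1.
  rewrite semicircle_moment_rec; apply: cvg_sumr => a; have am := ltn_ord a.
  by apply: cvgM; apply: IH; lia.
have c0 : (mean P (sm n m.+1) - s n) @[n --> \oo] --> (0 : R).
  apply/cvgr0Pnorm_le => e e0.
  pose L := 1 + `|WignerMoments.rec_cst R m|; have L0 : 0 < L by rewrite ltr_pwDl.
  near=> n; have n0 : (0 < n)%N by near: n; exists 1%N.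
  have h1 : eta n <= Num.min 1 (e / L).
    by near: n; apply: eta_small; rewrite lt_min ltr01 divr_gt0.
  move: h1; rewrite le_min => /andP[h1 h2].
  apply: le_trans (mean_spectral_rec n0 (X_gaussian n0) (fun p => X_centered p n0)
    (fun p => X_var p n0) m (eta1 n) (eta2 n) h1) _.
  apply: le_trans (_ : eta n * L <= _); last by rewrite -ler_pdivlMr.
  by rewrite ler_wpM2l // /L; apply: le_trans (ler_norm _) _; rewrite lerDr.
rewrite (_ : (fun n => mean P (sm n m.+1)) = (fun n => (mean P (sm n m.+1) - s n) + s n)).
  by rewrite -[X in _ --> X]add0r; apply: cvgD.
by apply/funext => n; rewrite subrK.
Unshelve. all: by end_near. Qed.

(** Chebyshev with variances $O(n^{-2})$ feeds Borel-Cantelli; the null sets are united over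
    countably many orders [m] and thresholds $1/(j+1)$. *)
Lemma spectral_moment_cvg : {ae P, forall w, forall m,
  sm n m w @[n --> \oo] --> semicircle_moment R m}.
Proof.
apply: ae_foralln => m.
have H j : {ae P, forall w, \forall n \near \oo,
    (sm n m w - mean P (sm n m)) ^+ 2 < j.+1%:R^-1}.
  pose b : R := j.+1%:R^-1; have b0 : 0 < b by rewrite invr_gt0 ltr0n.
  pose f n w := (sm n m w - mean P (sm n m)) ^+ 2.
  have [n1 _ hn1] := eta_small ltr01.
  pose C := 3 * (m%:R * m%:R) * WignerMoments.moment_cst R (m + m).
  have C0 : 0 <= C by rewrite !mulr_ge0 ?ler0n ?WignerMoments.moment_cst_ge0.
  have hf n : (0 < n)%N -> has_moments P (f n).
    move=> n0; apply: (@has_momentsX _ _ _ _ (fun w => sm n m w - mean P (sm n m))).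
    by apply: has_momentsD; [exact: sm_moments|exact: has_moments_cst].
  have mk n n0 := mean_markov (hf n n0) (fun w => sqr_ge0 _) b0.
  have : {ae P, forall w, \forall n \near \oo, ~ [set w : T | (b <= f n w)%R] w}.
    apply: (@borel_cantelli_sqr _ _ _ _ _ (C / b) (maxn 1 n1)).
    - by rewrite divr_ge0 // ltW.
    - by move=> n; rewrite geq_max => /andP[n0 _]; exact: (mk n n0).1.
    - move=> n; rewrite geq_max => /andP[n0 hn]; apply: le_trans (mk n n0).2 _.
      rewrite lee_fin mulrAC ler_pM2r ?invr_gt0 // mulrC.
      apply: spectral_variance => //; first exact: X_gaussian.
      + by move=> p; exact: X_centered.
      + by move=> p; exact: X_var.
      + exact: le_trans (eta2 n) (hn1 n hn).
  apply: filterS => w; apply: filterS => n /= h.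
  by rewrite ltNge; apply/negP.
have := ae_foralln H; apply: filterS => w hw.
have c0 : (sm n m w - mean P (sm n m)) @[n --> \oo] --> (0 : R).
  apply/cvgr0Pnorm_le => e e0; pose j := Num.truncn (e ^+ 2)^-1.
  apply: filterS (hw j) => n h; have e2 : 0 < e ^+ 2 by rewrite exprn_gt0.
  have hj : j.+1%:R^-1 <= e ^+ 2.
    by rewrite -[e ^+ 2]invrK lef_pV2 ?posrE ?ltr0n ?invr_gt0 // ltW // truncnS_gt.
  rewrite -(ler_pXn2r (_ : (0 < 2)%N)) ?nnegrE ?(ltW e0) //.
  by rewrite real_normK ?num_real // (le_trans (ltW h)).
rewrite (_ : (fun n => sm n m w) = (fun n => (sm n m w - mean P (sm n m)) + mean P (sm n m))).
  by rewrite -[X in _ --> X]add0r; apply: cvgD => //; exact: mean_spectral_cvg.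
by apply/funext => n; rewrite subrK.
Qed.

Lemma lambda1_upper (b : R) : 2 < b ->
  {ae P, forall w, \forall n \near \oo, lambda1 (A n w) <= b}.
Proof.
move=> b2; have b0 : 0 < b by rewrite (lt_trans _ b2).
(* Chosen so that $2\theta$ lies halfway between 2 and $b$. *)
pose theta := (1 + b / 2) / 2.
have th1 : 1 < theta by rewrite /theta; lra.
have thb : 2 * theta < b by rewrite /theta; lra.
have th0 : 0 < theta by lra.
pose rho := (2 * theta / b) ^+ 2.
have tt0 : 0 < 2 * theta by lra.
have q0 : 0 < 2 * theta / b by exact: divr_gt0.
have r0 : 0 < rho by exact: exprn_gt0.
have r1 : rho < 1 by rewrite /rho expr_lt1 ?(ltW q0) // ltr_pdivrMr // mul1r.
have [c hc] := geometric_le_inv_cube r0 r1.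
have [C C0 hC] := rate_bound eps_gt0 delta_ge0 X_cross.
have [n1 _ hn1] := rate_condition eta_ge0 C0 hC c th1.
pose K n := (c.+1 * trunc_log 2 n)%N.
(* A single eigenvalue beyond [b] forces the normalized trace up to this level. *)
pose b' n : R := n%:R^-1 * b ^+ (2 * K n).
have symA n w : (A n w)^T = A n w by exact: sym_mx_tr.
have b'0 n : (0 < n)%N -> 0 < b' n.
  by move=> n0; rewrite mulr_gt0 ?invr_gt0 ?ltr0n ?exprn_gt0.
have sm0 n w : (0 < n)%N -> 0 <= sm n (2 * K n) w.
  move=> n0; have [dg [trE _ _]] := symmetric_spectrum (symA n w) n0.
  rewrite /sm /spectral_moment -/(A n w) trE mulr_ge0 ?invr_ge0 ?ler0n // sumr_ge0 // => i _.
  by rewrite exprM exprn_ge0 ?sqr_ge0.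
have mk n (n0 : (0 < n)%N) := mean_markov (sm_moments (2 * K n) n0) (fun w => sm0 n w n0) (b'0 n n0).
have : {ae P, forall w, \forall n \near \oo, ~ [set w : T | (b' n <= sm n (2 * K n) w)%R] w}.
  apply: (@borel_cantelli_sqr _ _ _ _ _ 8 (maxn 1 n1)) => //.
  - by move=> n; rewrite geq_max => /andP[n0 _]; exact: (mk n n0).1.
  move=> n; rewrite geq_max => /andP[n0 hn]; apply: le_trans (mk n n0).2 _.
  rewrite lee_fin ler_pdivrMr ?b'0 //.
  apply: le_trans (mean_spectral_le n0 (X_gaussian n0) (fun p => X_centered p n0)
    (fun p => X_var p n0) (eta1 n) (eta2 n) th0 (hn1 n hn (K n) erefl)) _.
  rewrite -/(K n); have -> : (2 * theta) ^+ (2 * K n) = rho ^+ K n * b ^+ (2 * K n).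
    by rewrite /rho -exprM -exprMn divfK // gt_eqF.
  rewrite /b' mulrA ler_pM2r ?exprn_gt0 //; apply: le_trans (hc n n0) _.
  by rewrite [n%:R^-1 ^+ 3]exprSr mulrA.
apply: filterS => w hw; near=> n; have n0 : (0 < n)%N by near: n; exists 1%N.
have hn : ~ [set w : T | (b' n <= sm n (2 * K n) w)%R] w by near: n.
rewrite leNgt; apply/negP => lb; apply: hn => /=.
rewrite /b' /sm /spectral_moment -/(A n w) ler_wpM2l ?invr_ge0 ?ler0n //.
by apply: trace_ge_of_lambda1 => //; exact: ltW.
Unshelve. all: by end_near. Qed.

Lemma lambda1_cvg : {ae P, forall w, lambda1 (A n w) @[n --> \oo] --> (2 : R)}.
Proof.
have up : {ae P, forall w, forall j : nat, \forall n \near \oo,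
    lambda1 (A n w) <= 2 + j.+1%:R^-1}.
  by apply: ae_foralln => j; apply: lambda1_upper; rewrite ltrDl invr_gt0 ltr0n.
move: up; apply: filterS2 spectral_moment_cvg => w hm up.
apply/cvgrPdist_le => e e0.
(* The cut at 1 keeps [c] within reach of [trace_le_of_lambda1] when [e] exceeds 1. *)
pose c := Num.max 1 (2 - e).
have c1 : 1 <= c by rewrite le_max lexx.
have c2 : c < 2 by rewrite gt_max ltr1n /= ltrBlDr ltrDl.
have [k hk] := catalan_beats c1 c2.
(* The odd semicircle moment is 0, so adding it leaves the limit $C_k$, which exceeds what a top
   eigenvalue below [c] would allow. *)
have cv : (fun n => sm n (2 * k) w + sm n (2 * k).+1 w) @ \oo --> Catalan.catalan R k.
  rewrite -(semicircle_moment_even R k) -[X in _ --> X]addr0 -(semicircle_moment_odd R k).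
  by apply: cvgD; exact: hm.
have gap : 0 < Catalan.catalan R k - 2 * c ^+ (2 * k).+1 by rewrite subr_gt0.
have ev : \forall n \near \oo, 2 * c ^+ (2 * k).+1 < sm n (2 * k) w + sm n (2 * k).+1 w.
  move/cvgrPdist_lt: cv => /(_ _ gap); apply: filterS => j.
  by rewrite ltr_norml => /andP[_]; rewrite ltrD2l ltrN2.
near=> n.
have n0 : (0 < n)%N by near: n; exists 1%N.
have h1 : lambda1 (A n w) <= 2 + (Num.truncn e^-1).+1%:R^-1 by near: n; exact: up.
have h2 : (Num.truncn e^-1).+1%:R^-1 <= e.
  by rewrite -[X in _ <= X]invrK lef_pV2 ?posrE ?ltr0n ?invr_gt0 // ltW // truncnS_gt.
rewrite ler_norml; apply/andP; split.
  by rewrite lerNl opprB lerBlDl; apply: le_trans h1 _; rewrite lerD2l.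
rewrite lerBlDr -lerBlDl leNgt; apply/negP => h3.
have h4 : 2 * c ^+ (2 * k).+1 < sm n (2 * k) w + sm n (2 * k).+1 w.
  by near: n; exact: ev.
have lc : lambda1 (A n w) <= c by rewrite le_max (ltW h3) orbT.
have := trace_le_of_lambda1 k (sym_mx_tr _ _) n0 c1 lc.
rewrite -ler_pdivrMl ?ltr0n // mulrDr => h5.
by move: h4; rewrite ltNge h5.
Unshelve. all: by end_near. Qed.

End AlmostSure.

Theorem theorem1 (R : realType) (d : measure_display) (T : measurableType d)
    (P : probability T R) (eps : R) (eps_gt0 : 0 < eps)
    (X : forall n : nat, upper_index n -> {RV P >-> R})
    (X_gaussian : forall n, (0 < n)%N -> gaussian_vector (X n))
    (X_centered : forall n (p : upper_index n), (0 < n)%N ->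
       ('E_P[X n p] = 0)%E)
    (X_var : forall n (p : upper_index n), (0 < n)%N -> ('V_P[X n p] = 1)%E)
    (X_cross : (fun n : nat => sup_cross_moment (X n)) =O_\oo
       (fun n : nat => (n%:R `^ (1 + eps))^-1)) :
  {ae P, forall w : T,
    lambda1 ((Num.sqrt (n%:R : R))^-1 *: sym_mx (fun p => X n p w))
      @[n --> \oo] --> (2 : R)}.
Proof.
exact: (lambda1_cvg eps_gt0 X_gaussian X_centered X_var X_cross).
Qed.
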